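(* Let $m>2$ be an integer and, in formal coordinates $(\theta,x_1,\dots,x_{2n})$ on $(\mathbb{C}^{2n+1},O)$, let $\alpha=d(\theta^m-x_1\theta)+\gamma$, where $\gamma=\sum_{i=1}^{2n}g_i(x)\,dx_i$ has coefficients independent of $\theta$, $\gamma(O)=0$, $d\gamma$ is a symplectic form in the variables $x_1,\dots,x_{2n}$, and $(g_1,\dots,g_{2n})$ is a local diffeomorphism of $(\mathbb{C}^{2n},O)$. Let $X$ be a formal vector field vanishing at $O$ with $\mathcal{L}_X\alpha=0$. Then there is a formal coordinate system $(\theta,x'_1,\dots,x'_{2n})$ (with $\theta$ unchanged) and a formal function $f(x')$ with $f(O)=0$, $df(O)\neq0$, such that $\alpha=d(\theta^m-f\theta)+\gamma'$ with $\gamma'$ in primitive normal form (P) in the coordinates $x'$, $X$ is in Poincaré–Dulac normal form, $X(\theta)=X(f)=0$, and the functions $Q=\sum_sQ_s$ and $R$ of (P) are first integrals of the semisimple part $X^s$ of the linear part of $X$. In particular this applies to the generically tangent case $m=3$.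
   Context: Primitive normal form (P): in coordinates $(x_1,\dots,x_{2n})$, a 1-form $\gamma=\sum_ig_i(x)dx_i$ is in primitive normal form if $d\gamma=\sum_{i=1}^ndx_i\wedge dx_{i+n}$ and there are integers $1=n_1<n_2<\cdots<n_k<n_{k+1}=n+1$ and complex numbers $\lambda_1,\dots,\lambda_{2n}$ (the eigenvalues of the vector field $Z$ defined by $Z\lrcorner d\gamma=\gamma$) with $\lambda_i+\lambda_{n+i}=1$ for all $i\le n$ and $\lambda_i=\lambda_j$ whenever $n_s\le i<j<n_{s+1}$, such that $\gamma=\sum_{s=1}^k(\gamma_s+dQ_s)+dR$, where (i) $\gamma_s=\sum_{j=n_s}^{n_{s+1}-1}\big(\lambda_{n_s}x_jdx_{n+j}+(\lambda_{n_s}-1)x_{n+j}dx_j\big)$; (ii) if $\lambda_{n_s}\neq\frac12$ then $Q_s=0$ or $Q_s=\sum_{j=n_s}^{n_{s+1}-2}x_{j+1}x_{n+j}$; if $\lambda_{n_s}=\frac12$ then $Q_s$ is one of: $0$; $x_{n_s+n}^2$ (only when $n_{s+1}=n_s+1$); $2\sum_{j=n_s}^{n_{s+1}-2}x_jx_{n+j+1}+(-1)^{n_{s+1}-n_s}x_{n_{s+1}-1}^2$; $2\sum_{j=n_s}^{n_{s+1}-2}x_jx_{n+j+1}$ (only when $n_{s+1}-n_s\ge3$ is odd); (iii) $R$ is a formal function of $x_1,\dots,x_{2n}$ containing only monomials $\prod x_i^{a_i}$ with $\sum_ia_i\lambda_i=1$ and $\sum_ia_i\ge3$. For a formal vector field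 $X$ vanishing at $O$, let $X^{(1)}=X^s+X^n$ be the Jordan decomposition of its linear part; $X$ is in Poincaré–Dulac normal form if $[X^s,X]=0$. *)

(* Defs.v *)
From HB Require Import structures.
From mathcomp Require Import all_boot all_order all_algebra.
Set Implicit Arguments. Unset Strict Implicit. Unset Printing Implicit Defensive.
Import Order.TTheory GRing.Theory Num.Theory.
Local Open Scope ring_scope.

Section FPS.
Variable C : numClosedFieldType.

Definition mon (d : nat) := {ffun 'I_d -> nat}.
Definition fps (d : nat) := mon d -> C.

Definition mdeg d (a : mon d) : nat := (\sum_i a i)%N.
Definition mon0 d : mon d := [ffun => 0%N].
Arguments mon0 d : clear implicits.
Definition monv d (j : nat) : mon d := [ffun i : 'I_d => if (i : nat) == j then 1%N else 0%N].
Arguments monv d : clear implicits.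

Definition cst d (f : fps d) : C := f (@mon0 d).
Definition lcoef d (f : fps d) (j : 'I_d) : C := f (@monv d j).

Definition fps0 d : fps d := fun _ => 0.
Arguments fps0 d : clear implicits.
Definition fpsC d (c : C) : fps d := fun a => if a == @mon0 d then c else 0.
Arguments fpsC d : clear implicits.
Definition fpsXn d (j : nat) : fps d := fun a => if a == @monv d j then 1 else 0.
Arguments fpsXn d : clear implicits.
Definition fpsX d (j : 'I_d) : fps d := @fpsXn d j.
Definition fpsadd d (f g : fps d) : fps d := fun a => f a + g a.
Definition fpsopp d (f : fps d) : fps d := fun a => - f a.
Definition fpssub d (f g : fps d) : fps d := fun a => f a - g a.
Definition fpsscale d (c : C) (f : fps d) : fps d := fun a => c * f a.
Definition fpsmul d (f g : fps d) : fps d := fun a =>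
  \sum_(b : {ffun 'I_d -> 'I_(mdeg a).+1} | [forall i, (nat_of_ord (b i) <= a i)%N])
     f [ffun i => nat_of_ord (b i)] * g [ffun i => (a i - b i)%N].
Definition fpsexp d (f : fps d) (k : nat) : fps d := iter k (fpsmul f) (@fpsC d 1).
Definition fpssum d (I : finType) (F : I -> fps d) : fps d := fun a => \sum_(i : I) F i a.
Definition fpssumn d (lo hi : nat) (F : nat -> fps d) : fps d :=
  fun a => \sum_(lo <= j < hi) F j a.
Definition fderiv d (i : 'I_d) (f : fps d) : fps d :=
  fun a => (a i).+1%:R * f [ffun j => (a j + (j == i))%N].
(* substitution f(phi_1, ..., phi_d); meaningful when cst (phi j) = 0 *)
Definition fpscomp d e (f : fps d) (phi : 'I_d -> fps e) : fps e := fun a =>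
  \sum_(b : {ffun 'I_d -> 'I_(mdeg a).+1} | (mdeg [ffun i => nat_of_ord (b i)] <= mdeg a)%N)
     f [ffun i => nat_of_ord (b i)] *
     (\big[@fpsmul e/@fpsC e 1]_(i : 'I_d) fpsexp (phi i) (b i)) a.

Definition vf d := 'I_d -> fps d.
Definition form1 d := 'I_d -> fps d.

Definition vapply d (X : vf d) (h : fps d) : fps d :=
  fpssum (fun l => fpsmul (X l) (fderiv l h)).
Definition lie_bracket d (V W : vf d) : vf d :=
  fun k => fpssub (vapply V (W k)) (vapply W (V k)).
Definition lie_form1 d (X : vf d) (al : form1 d) : form1 d :=
  fun k => fpsadd (vapply X (al k)) (fpssum (fun l => fpsmul (al l) (fderiv k (X l)))).

Definition linpart d (X : vf d) : 'M[C]_d := \matrix_(k, l) lcoef (X k) l.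
Definition linvf d (S : 'M[C]_d) : vf d :=
  fun k => fpssum (fun l => fpsscale (S k l) (fpsX l)).

Definition jordan_decomp d (A S N : 'M[C]_d) : Prop :=
  [/\ A = S + N, S *m N = N *m S, diagonalizable S & exists k, N ^+ k = 0].
Definition semisimple_part d (A S : 'M[C]_d) : Prop := exists N, jordan_decomp A S N.

(* ---------- coordinates (theta, x_1 .. x_{2n}) on C^{2n+1} ----------
   index ord0 is theta, index (lift ord0 i) is x_{i+1}, i : 'I_(n.*2). *)
Definition theta (n : nat) : fps (n.*2).+1 := fpsX ord0.
Arguments theta n : clear implicits.
Definition xcoords (n : nat) : 'I_(n.*2) -> fps (n.*2).+1 :=
  fun i => fpsX (lift ord0 i).
Arguments xcoords n : clear implicits.
Definition coordsys (n : nat) (phi : 'I_(n.*2) -> fps (n.*2).+1) : 'I_(n.*2).+1 -> fps (n.*2).+1 :=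
  fun k => match unlift ord0 k with None => theta n | Some i => phi i end.

Definition pform (n : nat) (h : fps (n.*2).+1) (G : 'I_(n.*2) -> fps n.*2)
    (phi : 'I_(n.*2) -> fps (n.*2).+1) : form1 (n.*2).+1 :=
  fun k => fpsadd (fderiv k h) (fpssum (fun i => fpsmul (fpscomp (G i) phi) (fderiv k (phi i)))).

Definition alpha0 (n m : nat) (g : 'I_(n.*2) -> fps n.*2) : form1 (n.*2).+1 :=
  pform (fpssub (fpsexp (theta n) m) (fpsmul (fpsXn _ 1) (theta n))) g (xcoords n).

(* ---------- primitive normal form (P), 0-based indices ----------
   variables x_0 .. x_{2n-1} (paper's x_1 .. x_{2n}); blocks are given by a
   strictly increasing list bs = [:: 0 = n_1-1; n_2-1; ...; n_{k+1}-1 = n];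
   block s is the index range [bs_s, bs_{s+1}). *)
Definition omega_std (n : nat) (j k : 'I_(n.*2)) : C :=
  if ((j : nat) + n == k)%N then 1 else if ((k : nat) + n == j)%N then -1 else 0.

Definition blocks_ok (n : nat) (bs : seq nat) : Prop :=
  [/\ (1 < size bs)%N, sorted ltn bs, head 0%N bs = 0%N & last 0%N bs = n].

Definition bstart (bs : seq nat) (s : nat) : nat := nth 0%N bs s.
Definition bend (bs : seq nat) (s : nat) : nat := nth 0%N bs s.+1.
Definition nblocks (bs : seq nat) : nat := (size bs).-1.

Definition Q_admissible (n : nat) (lam : nat -> C) (a b : nat) (Q : fps n.*2) : Prop :=
  let L := (b - a)%N in
  let xx := fpsXn n.*2 in
  let S1 := fpssumn a b.-1 (fun j => fpsmul (xx j.+1) (xx (n + j)%N)) in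
  let S2 := fpsscale 2 (fpssumn a b.-1 (fun j => fpsmul (xx j) (xx (n + j.+1)%N))) in
  if lam a != 2^-1 then Q = fps0 _ \/ Q = S1
  else [\/ Q = fps0 _,
           L = 1%N /\ Q = fpsmul (xx (a + n)%N) (xx (a + n)%N),
           Q = fpsadd S2 (fpsscale ((-1) ^+ L) (fpsmul (xx b.-1) (xx b.-1))) |
           [/\ (3 <= L)%N, odd L & Q = S2]].

Definition gamma_lin (n : nat) (bs : seq nat) (lam : nat -> C) : 'I_(n.*2) -> fps n.*2 :=
  fun k => fpssumn 0 (nblocks bs) (fun s =>
    fpssumn (bstart bs s) (bend bs s) (fun j =>
      fpsadd (if (k : nat) == (n + j)%N then fpsscale (lam (bstart bs s)) (fpsXn _ j) else fps0 _)
             (if (k : nat) == j then fpsscale (lam (bstart bs s) - 1) (fpsXn _ (n + j)%N) else fps0 _))).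

Definition primitive_normal_form (n : nat) (g : 'I_(n.*2) -> fps n.*2)
    (bs : seq nat) (lam : nat -> C) (Q : nat -> fps n.*2) (R : fps n.*2) : Prop :=
  [/\
      (forall j k : 'I_(n.*2), fpssub (fderiv j (g k)) (fderiv k (g j)) = fpsC _ (omega_std j k)),
      blocks_ok n bs,
      (forall i, (i < n)%N -> lam i + lam (n + i)%N = 1),
      (forall s i j, (s < nblocks bs)%N -> (bstart bs s <= i)%N -> (i < j)%N ->
           (j < bend bs s)%N -> lam i = lam j) &
      (forall s, (s < nblocks bs)%N -> @Q_admissible n lam (bstart bs s) (bend bs s) (Q s)) /\
      (forall a : mon n.*2, R a != 0 ->
           \sum_i (a i)%:R * lam i = 1 /\ (3 <= mdeg a)%N) /\
      (forall k : 'I_(n.*2),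
           g k = fpsadd (@gamma_lin n bs lam k)
                   (fpsadd (fpssumn 0 (nblocks bs) (fun s => fderiv k (Q s))) (fderiv k R)))].

Definition Qtotal (n : nat) (bs : seq nat) (Q : nat -> fps n.*2) : fps n.*2 :=
  fpssumn 0 (nblocks bs) Q.

End FPS.

Arguments mon0 d.
Arguments monv d j.
Arguments fps0 {C} d _.
Arguments fpsC {C} d c _.
Arguments fpsXn {C} d j _.
Arguments theta {C} n _.
Arguments xcoords {C} n _ _.

(* Main.v *)
(** Differentiating the invariance of alpha, written in powers of theta, forces X(theta) = 0
    and X(x_1) = 0, because m - 1 >= 2 (this is where m > 2 is used); X is then a field in
    the x alone that preserves gamma.  Let Z be the field dual to gamma.  The linear parts
    of Z and X commute, and a Jordan-Chevalley polynomial can be chosen compatibly with the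
    symplectic form, so that a linear change of coordinates diagonalizes both semisimple
    parts.  A Moser-type normalization, degree by degree, then makes gamma of weight (1, 0)
    and X of weight 0 for the pair of semisimple parts, with d gamma constant.  What is left
    is linear algebra: the nilpotent part of Z is skew for the symplectic form, and
    splitting off Jordan chains of maximal length gives the blocks gamma_s + dQ_s.  The
    terms of degree at least 3 integrate to R by the Poincare lemma, and all weights for
    X^s being 0 makes Q and R first integrals of X^s. *)

(* Why a pair of weights works: a field preserving gamma also preserves the dual field Z, and for
   the symplectic form the adjoint of the linear part of Z is [1 - Z], while that of the linear part
   B of X is [- B]. Hence symplectically paired coordinates have weights adding up to (1, 0), and
   gamma and X can be normalized together. In each degree the parts still to be normalized come from
   two functions: S, with differential the part of gamma, and h, a Hamiltonian of the part of X.
   Moving along the Hamiltonian field of F changes S by [Z F - F] and h by [B F], while invariance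
   gives [B S = Z h - h] off the resonant weight. So (S, h) is a cocycle of the Koszul complex of
   the commuting operators [Z - 1] and [B], and it is a coboundary wherever some combination
   [Z - 1 + t B] is invertible; a generic t achieves this off weight (1, 0). Theta stays fixed
   because every coordinate change involves the x alone, and f is the old x_1 read in the new
   coordinates. *)
Require Import Defs.
From HB Require Import structures.
From mathcomp Require Import all_boot all_order all_algebra.
From mathcomp Require Import boolp ring zify.
Set Implicit Arguments. Unset Strict Implicit. Unset Printing Implicit Defensive.
Import Order.TTheory GRing.Theory Num.Theory.
Local Open Scope ring_scope.

(** * Formal power series as a commutative ring *)

Section Monomials.
Variable d : nat.
Implicit Types a b c : mon d.

Definition madd a b : mon d := [ffun i => (a i + b i)%N].
Definition msub a b : mon d := [ffun i => (a i - b i)%N].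
Definition mle a b := [forall i, (a i <= b i)%N].

Lemma mleP a b : reflect (forall i, (a i <= b i)%N) (mle a b).
Proof. exact: forallP. Qed.

Lemma mdeg_madd a b : mdeg (madd a b) = (mdeg a + mdeg b)%N.
Proof. by rewrite /mdeg -big_split; apply: eq_bigr => i _; rewrite ffunE. Qed.

Lemma mdeg_monv (j : 'I_d) : mdeg (monv d j) = 1%N.
Proof.
rewrite /mdeg (bigD1 j) //= ffunE eqxx big1 // => i ij.
by rewrite ffunE -(inj_eq val_inj) /= in ij *; rewrite (negbTE ij).
Qed.

Lemma mdeg_mon0 : mdeg (mon0 d) = 0%N.
Proof. by rewrite /mdeg big1 // => i _; rewrite ffunE. Qed.

Lemma mdeg_eq0 a : (mdeg a == 0%N) = (a == mon0 d).
Proof.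
apply/eqP/eqP => [h|->]; last exact: mdeg_mon0.
apply/ffunP => i; rewrite ffunE; apply/eqP; rewrite -leqn0 -h.
by rewrite /mdeg (bigD1 i) //= leq_addr.
Qed.

Lemma leq_mdeg a i : (a i <= mdeg a)%N.
Proof. by rewrite /mdeg (bigD1 i) //= leq_addr. Qed.

Lemma maddC a b : madd a b = madd b a.
Proof. by apply/ffunP => i; rewrite !ffunE addnC. Qed.

Lemma msubK a b : mle b a -> madd (msub a b) b = a.
Proof. by move=> /mleP h; apply/ffunP => i; rewrite !ffunE subnK. Qed.

Lemma monvE (k i : 'I_d) : monv d k i = (i == k).
Proof. by rewrite ffunE -(inj_eq val_inj); case: eqP. Qed.

Lemma mle_monv (k : 'I_d) a : mle (monv d k) a = (0 < a k)%N.
Proof.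
apply/mleP/idP => [/(_ k)|h i]; first by rewrite monvE eqxx.
by rewrite monvE; case: eqP => // ->.
Qed.

Lemma monv_neq0 (k : 'I_d) : (monv d k == mon0 d) = false.
Proof. by apply/negbTE; rewrite -mdeg_eq0 mdeg_monv. Qed.

Lemma mdeg_msub a b : mle b a -> mdeg (msub a b) = (mdeg a - mdeg b)%N.
Proof. by move=> h; rewrite -[in RHS](msubK h) mdeg_madd addnK. Qed.

(** Singles out one variable dividing a nonconstant monomial; taking the first one makes the
    splitting in [hadamardE] unambiguous. *)
Lemma mon_fst a : a != mon0 d -> exists2 k : 'I_d, (0 < a k)%N & forall j : 'I_d, (j < k)%N -> a j = 0%N.
Proof.
move=> h; have [i0 hi0] : exists i, (0 < a i)%N.
  apply/existsP; apply: contraNT h; rewrite negb_exists => /forallP h.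
  by apply/eqP/ffunP => i; rewrite ffunE; apply/eqP; rewrite -leqn0 leqNgt.
case: (@arg_minnP _ i0 (fun i => 0 < a i)%N (fun i => nat_of_ord i) hi0) => k hk hmin; exists k => // j jk.
by apply/eqP; rewrite -leqn0 leqNgt; apply: contraL jk => /hmin; rewrite -leqNgt.
Qed.

End Monomials.

Section Ring.
Variables (C : numClosedFieldType) (d : nat).
Local Notation A := (fps C d).
Implicit Types (f g h : A) (a b : mon d) (k : 'I_d).

Lemma fps_ext f g : (forall a, f a = g a) -> f = g.
Proof. by move=> h; apply: funext. Qed.

(** Multiplication by the [k]-th variable, given on coefficients because the ring axioms are derived
    from it. *)
Definition shift k f : A := fun a => if (0 < a k)%N then f (msub a (monv d k)) else 0.
(** Membership in the [n]-th power of the maximal ideal, the filtration for which the inductions and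
    limits below are taken. *)
Definition vanish (n : nat) f := forall a, (mdeg a < n)%N -> f a = 0.

Lemma fpsmulE f g a : fpsmul f g a =
  \sum_(b : {ffun 'I_d -> 'I_(mdeg a).+1} | mle [ffun i => b i : nat] a)
     f [ffun i => b i : nat] * g (msub a [ffun i => b i : nat]).
Proof.
rewrite /fpsmul; apply: eq_big => b.
  by apply/forallP/mleP => h i; have := h i; rewrite ffunE.
by move=> _; congr (_ * g _); apply/ffunP => i; rewrite !ffunE.
Qed.

Lemma fpsmulC f g : fpsmul f g = fpsmul g f.
Proof.
apply: fps_ext => a; rewrite !fpsmulE.
pose r (b : {ffun 'I_d -> 'I_(mdeg a).+1}) : {ffun 'I_d -> 'I_(mdeg a).+1} :=
  [ffun i => inord (a i - b i)].
have rE' (b : {ffun 'I_d -> 'I_(mdeg a).+1}) i : r b i = (a i - b i)%N :> nat.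
  by rewrite ffunE inordK // ltnS (leq_trans (leq_subr _ _) (leq_mdeg a i)).
have rE (b : {ffun 'I_d -> 'I_(mdeg a).+1}) : [ffun i => r b i : nat] = msub a [ffun i => b i : nat].
  by apply/ffunP => i; rewrite ffunE rE' !ffunE.
have rK (b : {ffun 'I_d -> 'I_(mdeg a).+1}) : mle [ffun i => b i : nat] a -> r (r b) = b.
  move=> /mleP h; apply/ffunP => i; apply: val_inj; have := h i.
  by rewrite /= !rE' ffunE => hb; rewrite subKn.
rewrite (reindex_onto r r) /=; last exact: rK.
apply: eq_big => b.
  apply/andP/idP => [[_ /eqP <-]|h]; last first.
    split; last by rewrite rK.
    by apply/mleP => i; rewrite rE !ffunE leq_subr.
  by apply/mleP => i; rewrite rE !ffunE leq_subr.
move=> /andP [/mleP h1 /eqP h2]; rewrite mulrC rE; congr (g _ * f _).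
rewrite -{2}h2 rE; congr msub; exact/esym/rE.
Qed.

Lemma fpsmul_shiftr k f g : fpsmul f (shift k g) = shift k (fpsmul f g).
Proof.
apply: fps_ext => a; rewrite fpsmulE /shift.
case: ifPn => [ak|]; last first.
  rewrite -leqNgt leqn0 => /eqP ak; rewrite big1 // => b /mleP hb.
  by rewrite !ffunE ak /= mulr0.
have ha : mle (monv d k) a by rewrite mle_monv.
have hd : (mdeg (msub a (monv d k))) .+1 = mdeg a.
  by rewrite mdeg_msub // mdeg_monv subn1 prednK // (leq_trans ak) // leq_mdeg.
rewrite fpsmulE.
(* The convolutions at [a] and at [a] without one [x_k] range over different ordinal types; [u] and
   [v] translate the indices. *)
pose u (b : {ffun 'I_d -> 'I_(mdeg (msub a (monv d k))).+1}) :
   {ffun 'I_d -> 'I_(mdeg a).+1} := [ffun i => inord (b i)].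
pose v (b : {ffun 'I_d -> 'I_(mdeg a).+1}) :
   {ffun 'I_d -> 'I_(mdeg (msub a (monv d k))).+1} := [ffun i => inord (b i)].
have uE' (b : {ffun 'I_d -> 'I_(mdeg (msub a (monv d k))).+1}) i : u b i = b i :> nat.
  by rewrite ffunE inordK // ltnS -hd ltnW.
have uE (b : {ffun 'I_d -> 'I_(mdeg (msub a (monv d k))).+1}) : [ffun i => u b i : nat] = [ffun i => b i : nat].
  by apply/ffunP => i; rewrite ffunE uE' !ffunE.
have vE' (b : {ffun 'I_d -> 'I_(mdeg a).+1}) i : mle [ffun i => b i : nat] (msub a (monv d k)) -> v b i = b i :> nat.
  move=> /mleP h; rewrite ffunE inordK // ltnS.
  by have := h i; rewrite ffunE => /leq_trans; apply; apply: leq_mdeg.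
have le1 b : mle b (msub a (monv d k)) -> mle b a.
  by move=> /mleP h; apply/mleP => i; apply: leq_trans (h i) _; rewrite ffunE leq_subr.
have key b : mle b a -> (0 < msub a b k)%N -> mle b (msub a (monv d k)).
  move=> /mleP h; rewrite ffunE => hk; apply/mleP => i; rewrite !ffunE.
  case: eqP => [/val_inj -> |_]; [lia | by rewrite subn0].
rewrite (bigID (fun b : {ffun 'I_d -> 'I_(mdeg a).+1} => mle [ffun i => b i : nat] (msub a (monv d k)))) /=.
rewrite [X in _ + X]big1 ?addr0; last first.
  move=> b /andP [h1 h2]; case: ifP => // hk; last by rewrite mulr0.
  by rewrite (key _ h1 hk) in h2.
rewrite (reindex_onto u v) /=; last first.
  move=> b /andP [_ h]; apply/ffunP => i; apply: val_inj.
  by rewrite /= uE' vE'.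
apply: eq_big => b.
  rewrite uE; apply/andP/idP => [[/andP [_ ->]] //|h]; rewrite h le1 //; split => //.
  apply/eqP/ffunP => i; apply: val_inj.
  by rewrite /= vE' ?uE // uE'.
rewrite uE => /andP [/andP [_ /mleP h]] _.
have hk : (0 < msub a [ffun i => nat_of_ord (b i)] k)%N.
  by have := h k; rewrite !ffunE eqxx; lia.
rewrite hk; congr (_ * g _); apply/ffunP => i; rewrite !ffunE; lia.
Qed.

Lemma fpsmul_shiftl k f g : fpsmul (shift k f) g = shift k (fpsmul f g).
Proof. by rewrite fpsmulC fpsmul_shiftr fpsmulC. Qed.

Lemma fpsmul_addl f g h : fpsmul (fpsadd f g) h = fpsadd (fpsmul f h) (fpsmul g h).
Proof.
apply: fps_ext => a; rewrite /fpsadd !fpsmulE -big_split /=.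
by apply: eq_bigr => b _; rewrite mulrDl.
Qed.

Lemma fpsmulCc (c : C) f : fpsmul (fpsC d c) f = fpsscale c f.
Proof.
apply: fps_ext => a; rewrite fpsmulE (bigD1 [ffun => ord0]) /=; last first.
  by apply/mleP => i; rewrite !ffunE.
have E : [ffun i : 'I_d => nat_of_ord ([ffun => ord0 : 'I_(mdeg a).+1] i)] = mon0 d.
  by apply/ffunP => i; rewrite !ffunE.
rewrite E /fpsC eqxx big1 ?addr0; last first.
  move=> b /andP [_ hb]; case: eqP => [h|]; last by rewrite mul0r.
  case/negP: hb; apply/eqP/ffunP => i; apply: val_inj; move/ffunP: h => /(_ i).
  by rewrite !ffunE.
by congr (_ * f _); apply/ffunP => i; rewrite !ffunE subn0.
Qed.

HB.instance Definition _ := gen_eqMixin (fps C d).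
HB.instance Definition _ := gen_choiceMixin (fps C d).

Let addA : associative (@fpsadd C d).
Proof. by move=> f g h; apply: fps_ext => a; rewrite /fpsadd addrA. Qed.
Let addC : commutative (@fpsadd C d).
Proof. by move=> f g; apply: fps_ext => a; rewrite /fpsadd addrC. Qed.
Let add0 : left_id (@fps0 C d) (@fpsadd C d).
Proof. by move=> f; apply: fps_ext => a; rewrite /fpsadd /fps0 add0r. Qed.
Let addN : left_inverse (@fps0 C d) (@fpsopp C d) (@fpsadd C d).
Proof. by move=> f; apply: fps_ext => a; rewrite /fpsadd /fps0 /fpsopp addNr. Qed.
HB.instance Definition _ := GRing.isZmodule.Build (fps C d) addA addC add0 addN.

Lemma fps_addE f g a : (f + g) a = f a + g a. Proof. by []. Qed.
Lemma fps_oppE f a : (- f) a = - f a. Proof. by []. Qed.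
Lemma fps_zeroE a : (0 : A) a = 0. Proof. by []. Qed.
Lemma fps_subE f g a : (f - g) a = f a - g a. Proof. by []. Qed.
Lemma fps_sumE (I : Type) (r : seq I) (P : pred I) (F : I -> A) a :
  (\sum_(i <- r | P i) F i) a = \sum_(i <- r | P i) F i a.
Proof. by elim/big_rec2: _ => // i x y _ <-. Qed.

Lemma vanish_le m n f : (m <= n)%N -> vanish n f -> vanish m f.
Proof. by move=> h hf a ha; apply: hf; apply: leq_trans h. Qed.
Lemma vanishD n f g : vanish n f -> vanish n g -> vanish n (f + g).
Proof. by move=> hf hg a ha; rewrite fps_addE hf // hg // addr0. Qed.
Lemma vanishN n f : vanish n f -> vanish n (- f).
Proof. by move=> hf a ha; rewrite fps_oppE hf // oppr0. Qed.
Lemma vanishB n f g : vanish n f -> vanish n g -> vanish n (f - g).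
Proof. by move=> hf hg; apply: vanishD => //; apply: vanishN. Qed.
Lemma vanish_sum (I : Type) (r : seq I) (P : pred I) (F : I -> A) n :
  (forall i, P i -> vanish n (F i)) -> vanish n (\sum_(i <- r | P i) F i).
Proof. by move=> h a ha; rewrite fps_sumE big1 // => i Pi; apply: h. Qed.
Lemma vanish_all f : (forall n, vanish n f) -> f = 0.
Proof. by move=> h; apply: fps_ext => a; apply: (h (mdeg a).+1). Qed.

Lemma vanish_shift n k f : vanish n f -> vanish n.+1 (shift k f).
Proof.
move=> hf a ha; rewrite /shift; case: ifP => // ak; apply: hf.
by rewrite mdeg_msub ?mle_monv // mdeg_monv; have := leq_mdeg a k; lia.
Qed.

(** Quotient by [x_k] of the part of [f] whose monomials have [x_k] as first variable, so that each
    nonconstant monomial is counted for exactly one [k]. *)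
Definition hadamard k f : A := fun b =>
  if [forall j : 'I_d, (j < k)%N ==> (b j == 0%N)] then f (madd b (monv d k)) else 0.

Lemma hadamardE f : f = fpsC d (f (mon0 d)) + \sum_k shift k (hadamard k f).
Proof.
apply: fps_ext => a; rewrite fps_addE fps_sumE /fpsC.
have [->|a0] := eqVneq a (mon0 d).
  by rewrite big1 ?addr0 // => k _; rewrite /shift ffunE.
rewrite add0r; have [k ak hk] := mon_fst a0.
rewrite (bigD1 k) //= big1 ?addr0.
  rewrite /shift ak /hadamard; case: ifPn => [_|/forallP []].
    by rewrite msubK // mle_monv.
  by move=> j; apply/implyP => jk; rewrite ffunE hk.
move=> j jk; rewrite /shift; case: ifP => // aj; rewrite /hadamard.
case: ifP => // /forallP /(_ k); rewrite ffunE monvE.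
have /negbTE -> : k != j by rewrite eq_sym.
rewrite subn0 => /implyP h; case: (ltngtP k j) => [kj|kj|/val_inj kj].
- by move: (h kj); rewrite -leqn0 leqNgt ak.
- by rewrite hk in aj.
- by rewrite kj eqxx in jk.
Qed.

End Ring.

(* By Hadamard's lemma: every application of the hypothesis on [shift] gains one order of vanishing. *)
Lemma hadamard_ind0 (C : numClosedFieldType) (d e : nat) (E : fps C d -> fps C e) :
  (forall f g, E (f + g) = E f + E g) -> (forall c, E (fpsC d c) = 0) ->
  (forall n, (forall f, vanish n (E f)) -> forall k f, vanish n.+1 (E (shift k f))) ->
  forall f, E f = 0.
Proof.
move=> ED EC ES f; apply: vanish_all => n; elim: n f => [f a|n IH f]; first by [].
have E0 : E 0 = 0 by apply: (addIr (E 0)); rewrite -ED !add0r.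
rewrite (hadamardE f) ED EC add0r.
have -> (F : 'I_d -> fps C d) : E (\sum_k F k) = \sum_k E (F k).
  by elim/big_rec2: _ => // k x y _ <-.
by apply: vanish_sum => k _; apply: ES.
Qed.

Section Ring2.
Variables (C : numClosedFieldType) (d : nat).
Local Notation A := (fps C d).
Implicit Types (f g h : A) (a b : mon d) (k : 'I_d).

Lemma fpsscaleA (c : C) f g : fpsmul (fpsscale c f) g = fpsscale c (fpsmul f g).
Proof.
by apply: fps_ext => a; rewrite /fpsscale !fpsmulE mulr_sumr; apply: eq_bigr => b _; rewrite mulrA.
Qed.

Lemma shiftD k f g : shift k (f + g) = shift k f + shift k g.
Proof. by apply: fps_ext => a; rewrite fps_addE /shift; case: ifP; rewrite ?addr0. Qed.
Lemma shiftN k f : shift k (- f) = - shift k f.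
Proof. by apply: fps_ext => a; rewrite fps_oppE /shift; case: ifP; rewrite ?oppr0. Qed.

Let mulDl : left_distributive (@fpsmul C d) +%R.
Proof. by move=> f g h; apply: fpsmul_addl. Qed.
Let mul1 : left_id (fpsC d 1) (@fpsmul C d).
Proof. by move=> f; rewrite fpsmulCc; apply: fps_ext => a; rewrite /fpsscale mul1r. Qed.
(** No triple convolution is needed: the associator is additive in [f], kills constants and commutes
    with every [shift], so it gains an order of vanishing with each variable pulled out. *)
Let mulA : associative (@fpsmul C d).
Proof.
move=> f g h; apply/eqP; rewrite -subr_eq0; apply/eqP.
pose E f := fpsmul f (fpsmul g h) - fpsmul (fpsmul f g) h.
apply: (@hadamard_ind0 _ _ _ E _ _ _ f) => [f1 f2|c|n IH k f1].
- by rewrite /E !mulDl opprD addrACA.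
- by rewrite /E !fpsmulCc fpsscaleA subrr.
- by rewrite /E !fpsmul_shiftl -shiftN -shiftD; apply: vanish_shift (IH f1).
Qed.
Let one_neq0 : fpsC d 1 != 0 :> A.
Proof.
apply/eqP => /(congr1 (fun f : A => f (mon0 d))); rewrite /fpsC eqxx fps_zeroE.
by move/eqP; rewrite oner_eq0.
Qed.
HB.instance Definition _ :=
  GRing.Zmodule_isComNzRing.Build (fps C d) mulA (@fpsmulC C d) mul1 mulDl one_neq0.

Lemma fpsmul_ringE f g : fpsmul f g = f * g. Proof. by []. Qed.

Lemma fpsC0 : fpsC d (0 : C) = 0.
Proof. by apply: fps_ext => a; rewrite /fpsC; case: eqP. Qed.
Lemma fpsscaleE (c : C) f : fpsscale c f = fpsC d c * f.
Proof. by rewrite -fpsmul_ringE fpsmulCc. Qed.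
Lemma mulCE (c : C) f a : (fpsC d c * f) a = c * f a.
Proof. by rewrite -fpsscaleE. Qed.
Lemma fpsCM (c e : C) : fpsC d (c * e) = fpsC d c * fpsC d e.
Proof. by apply: fps_ext => a; rewrite mulCE /fpsC; case: eqP; rewrite ?mulr0. Qed.
Lemma fpsC_zmod : zmod_morphism (fpsC d : C -> A).
Proof.
move=> c e; apply: fps_ext => a; rewrite fps_subE /fpsC; case: eqP; rewrite ?subr0 //.
Qed.
Lemma fpsC_monoid : monoid_morphism (fpsC d : C -> A).
Proof. by split=> // c e; apply: fpsCM. Qed.
HB.instance Definition _ := GRing.isZmodMorphism.Build C A (fpsC d) fpsC_zmod.
HB.instance Definition _ := GRing.isMonoidMorphism.Build C A (fpsC d) fpsC_monoid.

Lemma fpsaddE f g : fpsadd f g = f + g. Proof. by []. Qed.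
Lemma fpssubE f g : fpssub f g = f - g. Proof. by []. Qed.
Lemma fpsC1E : fpsC d 1 = 1 :> A. Proof. by []. Qed.
Lemma fpsexpE f n : fpsexp f n = f ^+ n.
Proof. by elim: n => // n IH; rewrite exprS -IH. Qed.
Lemma fpssumE (I : finType) (F : I -> A) : fpssum F = \sum_i F i.
Proof. by apply: fps_ext => a; rewrite fps_sumE. Qed.
Lemma fpssumnE lo hi (F : nat -> A) : fpssumn lo hi F = \sum_(lo <= j < hi) F j.
Proof. by apply: fps_ext => a; rewrite fps_sumE. Qed.
Lemma bigmulE (I : Type) (r : seq I) (P : pred I) (F : I -> A) :
  \big[@fpsmul C d/fpsC d 1]_(i <- r | P i) F i = \prod_(i <- r | P i) F i.
Proof. by []. Qed.

Lemma shiftE k f : shift k f = fpsX C k * f.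
Proof.
rewrite -[in LHS](mul1r f) -fpsmul_ringE -fpsmul_shiftl; congr (fpsmul _ f).
apply: fps_ext => a; rewrite /shift /fpsX /fpsXn -fpsC1E /fpsC.
have [->|ne] := eqVneq a (monv d k).
  rewrite monvE eqxx /=; suff -> : msub (monv d k) (monv d k) = mon0 d by rewrite eqxx.
  by apply/ffunP => i; rewrite !ffunE subnn.
case: ifP => // ak; case: eqP => // h; case/negP: ne; apply/eqP.
rewrite -[a](@msubK _ _ (monv d k)) ?mle_monv // h.
by apply/ffunP => i; rewrite !ffunE.
Qed.

Lemma XmulE k f a : (fpsX C k * f) a = if (0 < a k)%N then f (msub a (monv d k)) else 0.
Proof. by rewrite -shiftE. Qed.

Lemma cstE f : cst f = f (mon0 d). Proof. by []. Qed.
Lemma cstD f g : cst (f + g) = cst f + cst g. Proof. by []. Qed.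
Lemma cstN f : cst (- f) = - cst f. Proof. by []. Qed.
Lemma cst_sum (I : Type) (r : seq I) (P : pred I) (F : I -> A) :
  cst (\sum_(i <- r | P i) F i) = \sum_(i <- r | P i) cst (F i).
Proof. exact: fps_sumE. Qed.
Lemma cstC (c : C) : cst (fpsC d c) = c.
Proof. by rewrite /cst /fpsC eqxx. Qed.
Lemma cst_fpsX k : cst (fpsX C k) = 0.
Proof. by rewrite /cst /fpsX /fpsXn eq_sym monv_neq0. Qed.

Lemma vanishM m n f g : vanish m f -> vanish n g -> vanish (m + n) (f * g).
Proof.
move=> hf hg a ha; rewrite -fpsmul_ringE fpsmulE big1 // => b hb.
set b' := [ffun i => _] in hb *.
have [h|h] := ltnP (mdeg b') m; first by rewrite hf ?mul0r.
rewrite hg ?mulr0 // mdeg_msub //.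
by move: ha; rewrite -[in mdeg a](msubK hb) mdeg_madd mdeg_msub //; lia.
Qed.

Lemma vanishMl n f g : vanish n f -> vanish n (f * g).
Proof. by move=> hf; rewrite -[n]addn0; apply: vanishM. Qed.
Lemma vanishMr n f g : vanish n g -> vanish n (f * g).
Proof. by move=> hf; rewrite mulrC; apply: vanishMl. Qed.
Lemma vanishX m n f : vanish m f -> vanish (m * n) (f ^+ n).
Proof. by move=> hf; elim: n => [|n IH]; rewrite ?muln0 // exprS mulnS; apply: vanishM. Qed.
Lemma vanish_prod (I : finType) (F : I -> A) (m : I -> nat) :
  (forall i, vanish (m i) (F i)) -> vanish (\sum_i m i) (\prod_i F i).
Proof. by move=> h; elim/big_ind2: _ => // m1 f m2 g h1 h2; apply: vanishM. Qed.
Lemma vanish1P f : vanish 1 f <-> cst f = 0.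
Proof.
split=> [h|h a]; first by apply: h; rewrite mdeg_mon0.
by rewrite ltnS leqn0 mdeg_eq0 => /eqP ->.
Qed.
Lemma vanish1_fpsX k : vanish 1 (fpsX C k).
Proof. by apply/vanish1P; apply: cst_fpsX. Qed.

Lemma cstM f g : cst (f * g) = cst f * cst g.
Proof.
have h (u : A) : vanish 1 (u - fpsC d (cst u)) by apply/vanish1P; rewrite cstD cstN cstC subrr.
have -> : f * g = f * (g - fpsC d (cst g)) + fpsC d (cst g) * f by ring.
have -> : cst (f * (g - fpsC d (cst g)) + fpsC d (cst g) * f) =
  cst (f * (g - fpsC d (cst g))) + cst g * cst f by rewrite cstD /cst mulCE.
by rewrite (iffLR (vanish1P _) (vanishMr _ (h g))) add0r mulrC.
Qed.

Lemma fps_decomp f : f = fpsC d (cst f) + \sum_k fpsX C k * hadamard k f.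
Proof.
by rewrite {1}(hadamardE f); congr (_ + _); apply: eq_bigr => k _; rewrite shiftE.
Qed.
End Ring2.

(** The tool for identities between series: the difference of the two sides is additive, kills
    constants and turns a factor [x_k] into [phi k], which has order at least one; so it vanishes to
    every order. *)
Lemma hadamard_ind (C : numClosedFieldType) (d e : nat) (E : fps C d -> fps C e)
    (phi : 'I_d -> fps C e) :
  (forall i, cst (phi i) = 0) ->
  (forall f g, E (f + g) = E f + E g) -> (forall c, E (fpsC d c) = 0) ->
  (forall k f, E (fpsX C k * f) = phi k * E f) ->
  forall f, E f = 0.
Proof.
move=> h0 ED EC ES; apply: hadamard_ind0 => // n IH k f.
by rewrite shiftE ES -add1n; apply: vanishM (IH f); apply/vanish1P/h0.
Qed.
Arguments vanish_le {C d m n f}.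
Arguments vanishD {C d n f g}.
Arguments vanishN {C d n f}.
Arguments vanishB {C d n f g}.
Arguments vanishM {C d m n f g}.
Arguments vanishMl {C d n f} g.
Arguments vanishMr {C d n} f {g}.
(** * Derivations and substitution *)

Section Derivation.
Variables (C : numClosedFieldType) (d : nat).
Local Notation A := (fps C d).
Implicit Types (f g h : A) (a b : mon d) (i j k : 'I_d).

Lemma fderivE j f a : fderiv j f a = (a j).+1%:R * f (madd a (monv d j)).
Proof.
by rewrite /fderiv; congr (_ * f _); apply/ffunP => i; rewrite !ffunE -(inj_eq val_inj); case: eqP.
Qed.

Lemma fderiv_zmod j : zmod_morphism (@fderiv C d j).
Proof. by move=> f g; apply: fps_ext => a; rewrite fps_subE !fderivE mulrBr. Qed.
HB.instance Definition _ j := GRing.isZmodMorphism.Build A A (@fderiv C d j) (fderiv_zmod j).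

Lemma fderivC j c : fderiv j (fpsC d c) = 0 :> A.
Proof.
apply: fps_ext => a; rewrite fderivE /fpsC.
by rewrite -mdeg_eq0 mdeg_madd mdeg_monv addn1 mulr0.
Qed.

Lemma fderivXM j k f : fderiv j (fpsX C k * f) = (j == k)%:R * f + fpsX C k * fderiv j f.
Proof.
apply: fps_ext => a; rewrite fps_addE fderivE !XmulE fderivE !ffunE.
have -> : ((j == k)%:R * f) a = (j == k)%:R * f a.
  by case: eqP; rewrite ?mul1r ?mul0r.
have [->|jk] := eqVneq j k.
  rewrite eqxx addn1 /= mul1r.
  have -> : msub (madd a (monv d k)) (monv d k) = a by apply/ffunP => i; rewrite !ffunE addnK.
  case: posnP => ak; first by rewrite ak mul1r addr0.
  by rewrite msubK ?mle_monv // subn1 prednK // -natr1; ring.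
rewrite !(inj_eq val_inj) (eq_sym k j) (negbTE jk) addn0 mul0r add0r subn0.
case: posnP => ak; first by rewrite mulr0.
congr (_ * f _).
apply/ffunP => i; rewrite !ffunE; case: (i =P k :> nat) => [/val_inj ->|_]; last by rewrite !subn0.
by rewrite (inj_eq val_inj) eq_sym (negbTE jk) !addn0.
Qed.

Lemma fderivM j f g : fderiv j (f * g) = fderiv j f * g + f * fderiv j g.
Proof.
apply/eqP; rewrite -subr_eq0; apply/eqP.
pose E f := fderiv j (f * g) - (fderiv j f * g + f * fderiv j g).
apply: (@hadamard_ind _ _ _ E (fun k => fpsX C k) _ _ _ _ f) => [k|f1 f2|c|k f1].
- exact: cst_fpsX.
- by rewrite /E mulrDl !raddfD /=; ring.
- rewrite /E fderivC mul0r add0r; apply: fps_ext => a.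
  by rewrite fps_subE fderivE !mulCE fderivE mulrCA subrr.
- rewrite /E -mulrA !fderivXM; ring.
Qed.

Lemma fderiv_fpsX j k : fderiv j (fpsX C k) = (j == k)%:R.
Proof. by rewrite -[fpsX C k]mulr1 fderivXM -fpsC1E fderivC mulr0 addr0 mulr1. Qed.

Lemma fderivCM j c f : fderiv j (fpsC d c * f) = fpsC d c * fderiv j f.
Proof. by rewrite fderivM fderivC mul0r add0r. Qed.

Lemma fderiv_comm i j f : fderiv i (fderiv j f) = fderiv j (fderiv i f).
Proof.
apply: fps_ext => a; rewrite !fderivE !ffunE !mulrA; congr (_ * f _).
  by rewrite eq_sym; case: eqP => [/val_inj ->|_] //; rewrite !addn0 mulrC.
by apply/ffunP => l; rewrite !ffunE addnAC.
Qed.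

Lemma vanish_fderiv n j f : vanish n.+1 f -> vanish n (fderiv j f).
Proof.
by move=> h a ha; rewrite fderivE h ?mulr0 // mdeg_madd mdeg_monv addn1.
Qed.

Lemma cst_fderiv j f : cst (fderiv j f) = lcoef f j.
Proof.
rewrite /cst /lcoef fderivE ffunE mul1r; congr f.
by apply/ffunP => i; rewrite !ffunE.
Qed.

Lemma fderiv_inj0 f : cst f = 0 -> (forall j, fderiv j f = 0) -> f = 0.
Proof.
move=> h0 h; apply: fps_ext => a; have [->//|/mon_fst [k ak _]] := eqVneq a (mon0 d).
have := congr1 (fun g : A => g (msub a (monv d k))) (h k); rewrite fderivE msubK ?mle_monv //.
by move/eqP; rewrite mulf_eq0 pnatr_eq0 /= => /eqP.
Qed.

End Derivation.

(** * Substitution of power series without constant term *)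

Section Composition.
Variables (C : numClosedFieldType) (d e : nat).
Implicit Types (f g : fps C d) (phi : 'I_d -> fps C e) (b : mon d).

Definition mons K : seq (mon d) :=
  map (fun b : {ffun 'I_d -> 'I_K.+1} => [ffun i => b i : nat]) (enum [pred b : {ffun 'I_d -> 'I_K.+1} | (mdeg [ffun i => b i : nat] <= K)%N]).

Lemma mons_uniq K : uniq (mons K).
Proof.
rewrite map_inj_uniq ?enum_uniq // => b c /ffunP h; apply/ffunP => i; apply: val_inj.
by have := h i; rewrite !ffunE.
Qed.

Lemma mem_mons K b : (b \in mons K) = (mdeg b <= K)%N.
Proof.
apply/mapP/idP => [[c + ->]|h]; first by rewrite mem_enum.
pose c : {ffun 'I_d -> 'I_K.+1} := [ffun i => inord (b i)].
have cE : [ffun i => c i : nat] = b.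
  by apply/ffunP => i; rewrite !ffunE inordK // ltnS (leq_trans (leq_mdeg b i)).
by exists c; rewrite ?cE // mem_enum inE cE.
Qed.

Definition mexp phi b : fps C e := \prod_i phi i ^+ b i.

Lemma mexpS phi b (k : 'I_d) : mexp phi (madd b (monv d k)) = phi k * mexp phi b.
Proof.
rewrite /mexp (bigD1 k) //= [in RHS](bigD1 k) //= !ffunE eqxx addn1 exprS mulrA.
congr (_ * _); apply: eq_bigr => i ik; rewrite !ffunE (inj_eq val_inj) (negbTE ik) addn0 //.
Qed.

Lemma vanish_mexp phi b : (forall i, cst (phi i) = 0) -> vanish (mdeg b) (mexp phi b).
Proof.
move=> h; apply: vanish_prod => i; rewrite -[X in vanish X _]mul1n.
by apply: vanishX; apply/vanish1P.
Qed.

Definition comp_trunc f phi K := \sum_(b <- mons K) fpsC e (f b) * mexp phi b.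

(** [fpscomp] truncates at a degree depending on the coefficient. As [mexp phi b] vanishes to order
    [mdeg b], one fixed truncation serves all coefficients of degree at most [K], and the algebra
    can be done on finite sums. *)
Lemma fpscomp_trunc f phi K : (forall i, cst (phi i) = 0) ->
  vanish K.+1 (fpscomp f phi - comp_trunc f phi K).
Proof.
move=> h0 a; rewrite ltnS => ha; rewrite fps_subE; apply/eqP; rewrite subr_eq0; apply/eqP.
have -> : fpscomp f phi a = \sum_(b <- mons (mdeg a)) (fpsC e (f b) * mexp phi b) a.
  rewrite /mons big_map big_enum /fpscomp; apply: eq_big => [b|b _]; first by rewrite inE.
  rewrite mulCE bigmulE /mexp; congr (_ * _).
  have -> // : \prod_i fpsexp (phi i) (b i) = \prod_i phi i ^+ [ffun i => nat_of_ord (b i)] i.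
  by apply: eq_bigr => i _; rewrite fpsexpE ffunE.
rewrite /comp_trunc fps_sumE [RHS](bigID (fun b => mdeg b <= mdeg a)%N) /=.
rewrite [X in _ = _ + X]big1 ?addr0; last first.
  by move=> b; rewrite -ltnNge => hb; rewrite mulCE vanish_mexp ?mulr0.
rewrite -[RHS]big_filter; apply: perm_big; apply: uniq_perm; rewrite ?filter_uniq ?mons_uniq //.
by move=> b; rewrite mem_filter !mem_mons; lia.
Qed.

Lemma fpscompD phi f g : fpscomp (f + g) phi = fpscomp f phi + fpscomp g phi.
Proof.
apply: fps_ext => a; rewrite fps_addE /fpscomp -big_split /=.
by apply: eq_bigr => b _; rewrite fps_addE mulrDl.
Qed.

Lemma fpscompN phi f : fpscomp (- f) phi = - fpscomp f phi.
Proof.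
apply: fps_ext => a; rewrite fps_oppE /fpscomp -sumrN.
by apply: eq_bigr => b _; rewrite fps_oppE mulNr.
Qed.

Section Subst.
Variable (phi : 'I_d -> fps C e).
Hypothesis h0 : forall i, cst (phi i) = 0.

Lemma fpscompC c : fpscomp (fpsC d c) phi = fpsC e c.
Proof.
apply/eqP; rewrite -subr_eq0; apply/eqP/vanish_all => n.
have -> : fpsC e c = comp_trunc (fpsC d c) phi n.
  rewrite /comp_trunc (bigD1_seq (mon0 d)) ?mons_uniq ?mem_mons ?mdeg_mon0 //= big1 ?addr0.
    by rewrite /fpsC eqxx /mexp big1 ?mulr1 // => i _; rewrite ffunE.
  by move=> b /negbTE hb; rewrite [fpsC d c b]/fpsC hb rmorph0 mul0r.
exact: vanish_le (leqnSn n) (fpscomp_trunc _ h0).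
Qed.

Lemma fpscompXM k f : fpscomp (fpsX C k * f) phi = phi k * fpscomp f phi.
Proof.
apply/eqP; rewrite -subr_eq0; apply/eqP/vanish_all => n.
have -> : fpscomp (fpsX C k * f) phi - phi k * fpscomp f phi =
  (fpscomp (fpsX C k * f) phi - comp_trunc (fpsX C k * f) phi n.+1)
  + (comp_trunc (fpsX C k * f) phi n.+1 - phi k * comp_trunc f phi n)
  - phi k * (fpscomp f phi - comp_trunc f phi n) by ring.
(* Monomials of degree at most [n.+1] divisible by [x_k] are exactly [x_k] times those of degree at
   most [n], whence the two different truncation orders. *)
have tE : comp_trunc (fpsX C k * f) phi n.+1 = phi k * comp_trunc f phi n.
  rewrite /comp_trunc (bigID (fun b : mon d => 0 < b k)%N) /= [X in _ + X]big1 ?addr0; last first.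
    by move=> b /negbTE hb; rewrite XmulE hb rmorph0 mul0r.
  rewrite mulr_sumr -big_filter.
  rewrite (perm_big [seq madd b (monv d k) | b <- mons n]).
    rewrite big_map; apply: eq_bigr => b _; rewrite XmulE !ffunE eqxx addn1 /= mexpS mulrCA.
    by congr (_ * (fpsC e (f _) * _)); apply/ffunP => i; rewrite !ffunE addnK.
  apply: uniq_perm; rewrite ?filter_uniq ?mons_uniq //.
    rewrite map_inj_uniq ?mons_uniq // => b c /ffunP h; apply/ffunP => i.
    by have := h i; rewrite !ffunE => /addIn.
  move=> b; rewrite mem_filter mem_mons; apply/andP/mapP => [[bk hb]|[c + ->]].
    exists (msub b (monv d k)); last by rewrite msubK // mle_monv.
    by rewrite mem_mons mdeg_msub ?mle_monv // mdeg_monv; lia.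
  by rewrite mem_mons mdeg_madd mdeg_monv !ffunE eqxx; lia.
rewrite [X in _ + (X - _) - _]tE subrr addr0; apply: vanishB.
  by apply: (@vanish_le _ _ _ n.+2); [lia | apply: fpscomp_trunc].
by apply: vanishMr; apply: (@vanish_le _ _ _ n.+1) => //; apply: fpscomp_trunc.
Qed.

Lemma fpscompM f g : fpscomp (f * g) phi = fpscomp f phi * fpscomp g phi.
Proof.
apply/eqP; rewrite -subr_eq0; apply/eqP.
pose E f := fpscomp (f * g) phi - fpscomp f phi * fpscomp g phi.
apply: (@hadamard_ind _ _ _ E phi h0 _ _ _ f) => [f1 f2|c|k f1].
- by rewrite /E mulrDl !fpscompD; ring.
- rewrite /E fpscompC; apply: fps_ext => a; rewrite fps_subE mulCE /fpscomp mulr_sumr.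
  by rewrite -sumrB big1 // => b _; rewrite mulCE mulrA subrr.
- by rewrite /E -mulrA !fpscompXM; ring.
Qed.

Lemma fpscompX k : fpscomp (fpsX C k) phi = phi k.
Proof. by rewrite -[fpsX C k]mulr1 fpscompXM -fpsC1E fpscompC mulr1. Qed.

Lemma fpscompCM c f : fpscomp (fpsC d c * f) phi = fpsC e c * fpscomp f phi.
Proof. by rewrite fpscompM fpscompC. Qed.

Lemma fpscomp_sum (I : Type) (r : seq I) (P : pred I) (F : I -> fps C d) :
  fpscomp (\sum_(i <- r | P i) F i) phi = \sum_(i <- r | P i) fpscomp (F i) phi.
Proof.
elim/big_rec2: _ => [|i y1 y2 _ <-]; last by rewrite fpscompD.
by rewrite -(fpsC0 C d) fpscompC fpsC0.
Qed.

Lemma cst_fpscomp f : cst (fpscomp f phi) = cst f.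
Proof.
rewrite (fps_decomp f) fpscompD fpscompC !cstD !cstC fpscomp_sum !cst_sum.
by congr (_ + _); apply: eq_bigr => k _; rewrite fpscompXM !cstM h0 cst_fpsX !mul0r.
Qed.

Lemma vanish_fpscomp n f : vanish n f -> vanish n (fpscomp f phi).
Proof.
move=> h a ha; rewrite -[fpscomp f phi](subrK (comp_trunc f phi (mdeg a))) fps_addE.
rewrite fpscomp_trunc // add0r /comp_trunc fps_sumE big_seq big1 // => b.
by rewrite mem_mons => hb; rewrite h ?rmorph0 ?mul0r //; apply: leq_ltn_trans ha.
Qed.

Lemma fderiv_fpscomp j f :
  fderiv j (fpscomp f phi) = \sum_k fpscomp (fderiv k f) phi * fderiv j (phi k).
Proof.
apply/eqP; rewrite -subr_eq0; apply/eqP.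
pose E f := fderiv j (fpscomp f phi) - \sum_k fpscomp (fderiv k f) phi * fderiv j (phi k).
apply: (@hadamard_ind _ _ _ E phi h0 _ _ _ f) => [f1 f2|c|k f1].
- rewrite /E fpscompD !raddfD /=.
  under eq_bigr do rewrite raddfD fpscompD mulrDl /=.
  by rewrite big_split /=; ring.
- rewrite /E fpscompC fderivC big1 ?subrr // => k _; rewrite fderivC -(fpsC0 C d).
  by rewrite fpscompC fpsC0 mul0r.
- rewrite /E fpscompXM fderivM.
  have -> : \sum_i fpscomp (fderiv i (fpsX C k * f1)) phi * fderiv j (phi i) =
     fpscomp f1 phi * fderiv j (phi k) + phi k * \sum_i fpscomp (fderiv i f1) phi * fderiv j (phi i).
    rewrite mulr_sumr (bigD1 k) //= [in RHS](bigD1 k) //= addrA.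
    rewrite fderivXM eqxx mul1r fpscompD fpscompXM mulrDl mulrA; congr (_ + _).
    apply: eq_bigr => i ik; rewrite fderivXM (negbTE ik) mul0r add0r fpscompXM; ring.
  ring.
Qed.

End Subst.

End Composition.

Lemma fpscompA (C : numClosedFieldType) (d e l : nat) (f : fps C d) (phi : 'I_d -> fps C e)
   (psi : 'I_e -> fps C l) : (forall i, cst (phi i) = 0) -> (forall i, cst (psi i) = 0) ->
  fpscomp (fpscomp f phi) psi = fpscomp f (fun i => fpscomp (phi i) psi).
Proof.
move=> h1 h2; have h3 i : cst (fpscomp (phi i) psi) = 0 by rewrite cst_fpscomp.
apply/eqP; rewrite -subr_eq0; apply/eqP.
pose E f := fpscomp (fpscomp f phi) psi - fpscomp f (fun i => fpscomp (phi i) psi).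
apply: (@hadamard_ind _ _ _ E _ h3 _ _ _ f) => [f1 f2|c|k f1].
- by rewrite /E !fpscompD; ring.
- by rewrite /E !fpscompC ?subrr.
- by rewrite /E !fpscompXM ?fpscompM //; ring.
Qed.

Lemma fpscomp_id (C : numClosedFieldType) (d : nat) (f : fps C d) : fpscomp f (fun i => fpsX C i) = f.
Proof.
have h0 i : cst (fpsX C i : fps C d) = 0 by apply: cst_fpsX.
apply/eqP; rewrite -subr_eq0; apply/eqP.
pose E (f : fps C d) := fpscomp f (fun i => fpsX C i) - f.
apply: (@hadamard_ind _ _ _ E _ h0 _ _ _ f) => [f1 f2|c|k f1].
- by rewrite /E !fpscompD; ring.
- by rewrite /E fpscompC ?subrr.
- by rewrite /E fpscompXM //; ring.
Qed.
Lemma vapplyE (C : numClosedFieldType) d (Y : vf C d) f :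
  vapply Y f = \sum_l Y l * fderiv l f.
Proof. by rewrite /vapply fpssumE. Qed.

Lemma lie_form1E (C : numClosedFieldType) d (Y : vf C d) G k :
  lie_form1 Y G k = vapply Y (G k) + \sum_l G l * fderiv k (Y l).
Proof. by rewrite /lie_form1 fpssumE. Qed.

Lemma linvfE (C : numClosedFieldType) d (S : 'M[C]_d) k :
  linvf S k = \sum_l fpsC d (S k l) * fpsX C l.
Proof. by rewrite /linvf fpssumE; apply: eq_bigr => l _; rewrite fpsscaleE. Qed.

(** * Pullback, Lie derivative and formal charts *)

Section Pullback.
Variables (C : numClosedFieldType).

Definition based d e (phi : 'I_d -> fps C e) := forall i, cst (phi i) = 0.
Definition pull d e (phi : 'I_d -> fps C e) (G : 'I_d -> fps C d) : 'I_e -> fps C e :=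
  fun k => \sum_i fpscomp (G i) phi * fderiv k (phi i).

Lemma based_comp d e l (psi : 'I_d -> fps C e) (phi : 'I_e -> fps C l) : based psi -> based phi ->
  based (fun i => fpscomp (psi i) phi).
Proof. by move=> h1 h2 i; rewrite cst_fpscomp. Qed.

Lemma based_fpsX d : based (fun i : 'I_d => fpsX C i).
Proof. by move=> i; apply: cst_fpsX. Qed.

Lemma pull_pull d e l (psi : 'I_d -> fps C e) (phi : 'I_e -> fps C l) G k :
  based psi -> based phi ->
  pull phi (pull psi G) k = pull (fun i => fpscomp (psi i) phi) G k.
Proof.
move=> h1 h2; rewrite /pull.
under eq_bigr do rewrite fpscomp_sum // mulr_suml.
rewrite exchange_big; apply: eq_bigr => i _; rewrite fderiv_fpscomp // mulr_sumr.
by apply: eq_bigr => j _; rewrite fpscompM // fpscompA // mulrA.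
Qed.

Lemma pull_id d G k : pull (fun i : 'I_d => fpsX C i) G k = G k.
Proof.
rewrite /pull (bigD1 k) //= fpscomp_id fderiv_fpsX eqxx mulr1 big1 ?addr0 // => i ik.
by rewrite fderiv_fpsX eq_sym (negbTE ik) mulr0.
Qed.

Lemma pull0 d e (phi : 'I_d -> fps C e) k : based phi -> pull phi (fun _ => 0) k = 0.
Proof.
by move=> h; rewrite /pull big1 // => i _; rewrite -(fpsC0 C d) fpscompC // fpsC0 mul0r.
Qed.

Lemma vapply_fpscomp d e (phi : 'I_d -> fps C e) Y Y' f : based phi ->
  (forall i, vapply Y (phi i) = fpscomp (Y' i) phi) ->
  vapply Y (fpscomp f phi) = fpscomp (vapply Y' f) phi.
Proof.
move=> h1 h2; rewrite !vapplyE fpscomp_sum //.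
under eq_bigr do rewrite fderiv_fpscomp // mulr_sumr.
rewrite exchange_big; apply: eq_bigr => k _; rewrite fpscompM // -h2 vapplyE mulr_suml.
by apply: eq_bigr => l _; ring.
Qed.

Lemma vapplyM d (Y : vf C d) f g : vapply Y (f * g) = vapply Y f * g + f * vapply Y g.
Proof.
rewrite !vapplyE mulr_suml mulr_sumr -big_split; apply: eq_bigr => l _ /=.
by rewrite fderivM; ring.
Qed.

Lemma vapplyD d (Y : vf C d) f g : vapply Y (f + g) = vapply Y f + vapply Y g.
Proof.
by rewrite !vapplyE -big_split; apply: eq_bigr => l _ /=; rewrite raddfD mulrDr.
Qed.

Lemma vapplyN d (Y : vf C d) f : vapply Y (- f) = - vapply Y f.
Proof.
by rewrite !vapplyE -sumrN; apply: eq_bigr => l _ /=; rewrite raddfN mulrN.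
Qed.

Lemma vapplyB d (Y : vf C d) f g : vapply Y (f - g) = vapply Y f - vapply Y g.
Proof. by rewrite vapplyD vapplyN. Qed.

Lemma vapply0 d (Y : vf C d) : vapply Y 0 = 0.
Proof. by rewrite -(subrr (0 : fps C d)) vapplyB !subrr. Qed.

Lemma vapply_sum d (Y : vf C d) (I : Type) (r : seq I) (P : pred I) (F : I -> fps C d) :
  vapply Y (\sum_(i <- r | P i) F i) = \sum_(i <- r | P i) vapply Y (F i).
Proof.
elim/big_rec2: _ => [|i y1 y2 _ <-]; last by rewrite vapplyD.
exact: vapply0.
Qed.

Lemma vapplyC d (Y : vf C d) c : vapply Y (fpsC d c) = 0.
Proof. by rewrite vapplyE big1 // => l _; rewrite fderivC mulr0. Qed.

Lemma vapplyCM d (Y : vf C d) c f : vapply Y (fpsC d c * f) = fpsC d c * vapply Y f.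
Proof. by rewrite vapplyM vapplyC mul0r add0r. Qed.

Lemma vapplyX d (Y : vf C d) i : vapply Y (fpsX C i) = Y i.
Proof.
rewrite vapplyE (bigD1 i) //= fderiv_fpsX eqxx mulr1 big1 ?addr0 // => j ji.
by rewrite fderiv_fpsX (negbTE ji) mulr0.
Qed.

(** [G] is the pullback of [G'], and [Y], [Y'] are [phi]-related. As a relation it needs no inverse
    of [phi] and allows [phi] to change the number of variables. *)
Definition transf d e (phi : 'I_d -> fps C e) (G : form1 C e) (Y : vf C e) (G' : form1 C d) (Y' : vf C d) :=
  (forall k, G k = pull phi G' k) /\ (forall i, vapply Y (phi i) = fpscomp (Y' i) phi).

(** Naturality of the Lie derivative, which holds for related fields without invertibility of
    [phi]. *)
Lemma lie_transf d e (phi : 'I_d -> fps C e) G Y G' Y' k : based phi -> transf phi G Y G' Y' ->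
  lie_form1 Y G k = pull phi (lie_form1 Y' G') k.
Proof.
move=> h0 [hG hY]; rewrite lie_form1E hG /pull vapply_sum.
under [in RHS]eq_bigr do rewrite lie_form1E fpscompD mulrDl -(vapply_fpscomp _ h0 hY).
under [X in X + _ = _]eq_bigr do rewrite vapplyM.
rewrite !big_split /= -addrA; congr (_ + _).
(* The intermediate expression uses that the Lie derivative commutes with d on the functions
   [phi i]. *)
transitivity (\sum_i fpscomp (G' i) phi * fderiv k (vapply Y (phi i))).
  under [X in _ + X]eq_bigr do rewrite hG /pull mulr_suml.
  rewrite [X in _ + X]exchange_big /= -big_split /=; apply: eq_bigr => i _.
  rewrite !vapplyE raddf_sum mulr_sumr mulr_sumr -big_split /=; apply: eq_bigr => l _.
  by rewrite fderivM (fderiv_comm k l); ring.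
transitivity (\sum_i \sum_j fpscomp (G' i * fderiv j (Y' i)) phi * fderiv k (phi j)).
  apply: eq_bigr => i _; rewrite hY fderiv_fpscomp // mulr_sumr.
  by apply: eq_bigr => j _; rewrite fpscompM // mulrA.
rewrite exchange_big /=; apply: eq_bigr => j _; rewrite -mulr_suml.
by rewrite fpscomp_sum.
Qed.

Lemma transf_comp d e l (psi : 'I_d -> fps C e) (phi : 'I_e -> fps C l) G Y G1 Y1 G2 Y2 :
  based psi -> based phi -> transf phi G Y G1 Y1 -> transf psi G1 Y1 G2 Y2 ->
  transf (fun i => fpscomp (psi i) phi) G Y G2 Y2.
Proof.
move=> h1 h2 [hG hY] [hG1 hY1]; split=> [k|i].
  rewrite hG -pull_pull //; apply: eq_bigr => i _; congr (fpscomp _ _ * _); exact: hG1.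
by rewrite (vapply_fpscomp _ h2 hY) hY1 fpscompA.
Qed.

Lemma transf_id d G Y : transf (fun i : 'I_d => fpsX C i) G Y G Y.
Proof. by split=> [k|i]; rewrite ?pull_id // vapplyX fpscomp_id. Qed.

(** * Formal charts and their inverses *)

Section Chart.
Variable d : nat.
Implicit Types phi psi : 'I_d -> fps C d.

Definition inv_chart phi psi :=
  [/\ based phi, based psi, forall i, fpscomp (psi i) phi = fpsX C i
    & forall i, fpscomp (phi i) psi = fpsX C i].
Definition chart phi := exists psi, inv_chart phi psi.

Lemma inv_chart_sym phi psi : inv_chart phi psi -> inv_chart psi phi.
Proof. by case. Qed.

Lemma chart_based phi : chart phi -> based phi.
Proof. by case=> psi []. Qed.

Lemma inv_chartK phi psi f : inv_chart phi psi -> fpscomp (fpscomp f phi) psi = f.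
Proof.
case=> h1 h2 _ h4; rewrite fpscompA // -[RHS]fpscomp_id; congr fpscomp.
by apply: funext => i; rewrite h4.
Qed.

Lemma chart_inj phi f g : chart phi -> fpscomp f phi = fpscomp g phi -> f = g.
Proof. by case=> psi h e; rewrite -[f](inv_chartK _ h) e (inv_chartK _ h). Qed.

Lemma chart_surj phi f : chart phi -> exists g, fpscomp g phi = f.
Proof. by case=> psi /inv_chart_sym h; exists (fpscomp f psi); rewrite (inv_chartK _ h). Qed.

Lemma inv_pullK phi psi G k : inv_chart phi psi -> pull psi (pull phi G) k = G k.
Proof.
case=> h1 h2 _ h4; rewrite pull_pull // -[RHS]pull_id; congr (pull _ G k).
by apply: funext => i; rewrite h4.
Qed.

Lemma pull_eq0 phi G : chart phi -> (forall k, pull phi G k = 0) -> forall k, G k = 0.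
Proof.
case=> psi h e k; rewrite -(inv_pullK _ _ h).
have -> : pull phi G = fun _ => 0 by apply: funext.
by rewrite pull0 //; case: h.
Qed.

Lemma lie_transf0 phi G Y G' Y' : chart phi -> transf phi G Y G' Y' ->
  (forall k, lie_form1 Y G k = 0) -> forall k, lie_form1 Y' G' k = 0.
Proof.
move=> h ht h0; apply: (pull_eq0 h) => k.
by rewrite -(lie_transf k (chart_based h) ht).
Qed.

Lemma transf_ex phi G Y : chart phi -> exists G' Y', transf phi G Y G' Y'.
Proof.
case=> psi h; exists (pull psi G), (fun i => fpscomp (vapply Y (phi i)) psi); split=> [k|i].
  by rewrite (inv_pullK _ _ (inv_chart_sym h)).
by rewrite (inv_chartK _ (inv_chart_sym h)).
Qed.

Lemma chart_comp psi phi : chart psi -> chart phi -> chart (fun i => fpscomp (psi i) phi).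
Proof.
move=> [psi' h1] [phi' h2]; exists (fun i => fpscomp (phi' i) psi').
case: (h1) => a1 a2 a3 a4; case: (h2) => b1 b2 b3 b4; split.
- exact: based_comp.
- exact: based_comp.
- move=> i; rewrite -fpscompA // [fpscomp (fpscomp _ _) psi](inv_chartK _ (inv_chart_sym h1)).
  exact: b3.
- move=> i; rewrite -fpscompA // [fpscomp (fpscomp _ _) phi'](inv_chartK _ h2).
  exact: a4.
Qed.

Lemma based_linvf (S : 'M[C]_d) : based (linvf S).
Proof. by move=> i; rewrite linvfE cst_sum big1 // => l _; rewrite cstM cst_fpsX mulr0. Qed.

Lemma linvf_comp (S T : 'M[C]_d) i : fpscomp (linvf S i) (linvf T) = linvf (S *m T) i.
Proof.
have h := based_linvf T; rewrite linvfE fpscomp_sum //.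
under eq_bigr do rewrite fpscompCM // fpscompX // linvfE mulr_sumr.
rewrite exchange_big linvfE; apply: eq_bigr => j _; rewrite mxE raddf_sum mulr_suml.
by apply: eq_bigr => k _; rewrite mulrA -fpsCM.
Qed.

Lemma linvf1 i : linvf (1%:M : 'M[C]_d) i = fpsX C i.
Proof.
rewrite linvfE (bigD1 i) //= mxE eqxx big1 ?addr0 ?fpsC1E ?mul1r // => j ji.
by rewrite mxE eq_sym (negbTE ji) fpsC0 mul0r.
Qed.

Lemma inv_chart_linvf (S : 'M[C]_d) : S \in unitmx -> inv_chart (linvf S) (linvf (invmx S)).
Proof.
move=> hS; split; try exact: based_linvf.
- by move=> i; rewrite linvf_comp mulVmx // linvf1.
- by move=> i; rewrite linvf_comp mulmxV // linvf1.
Qed.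

Lemma chart_linvf (S : 'M[C]_d) : S \in unitmx -> chart (linvf S).
Proof. by move=> h; exists (linvf (invmx S)); apply: inv_chart_linvf. Qed.

Lemma fderiv_linvf k (S : 'M[C]_d) i : fderiv k (linvf S i) = fpsC d (S i k).
Proof.
rewrite linvfE raddf_sum (bigD1 k) //= fderivCM fderiv_fpsX eqxx mulr1 big1 ?addr0 // => j jk.
by rewrite fderivCM fderiv_fpsX eq_sym (negbTE jk) mulr0.
Qed.

Lemma lcoef_linvf (S : 'M[C]_d) i k : lcoef (linvf S i) k = S i k.
Proof. by rewrite -cst_fderiv fderiv_linvf cstC. Qed.

Lemma linpart_comp psi phi : based phi -> linpart (fun i => fpscomp (psi i) phi) = linpart psi *m linpart phi.
Proof.
move=> h; apply/matrixP => i j; rewrite !mxE -cst_fderiv fderiv_fpscomp // cst_sum.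
by apply: eq_bigr => k _; rewrite cstM cst_fpscomp // !cst_fderiv !mxE.
Qed.

Lemma linpart_chart phi : chart phi -> linpart phi \in unitmx.
Proof.
case=> psi [h1 h2 h3 h4]; have := linpart_comp phi h2.
have -> : (fun i => fpscomp (phi i) psi) = linvf 1%:M by apply: funext => i; rewrite h4 linvf1.
have -> : linpart (linvf (1%:M : 'M[C]_d)) = 1%:M.
  by apply/matrixP => i j; rewrite mxE lcoef_linvf.
by move=> e; have [] := mulmx1_unit (esym e).
Qed.

(** If [F m.+1 - F m] has order [m] for all [m], the coefficient at [a] is constant from stage
    [(mdeg a).+1] on, and this is its final value. *)
Definition fpslim (F : nat -> fps C d) : fps C d := fun a => F (mdeg a).+1 a.

Lemma vanish_fpslim F n : (forall m, vanish m (F m.+1 - F m)) -> vanish n (fpslim F - F n).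
Proof.
move=> h a ha; rewrite fps_subE /fpslim; elim: n ha => // n IH.
rewrite ltnS leq_eqVlt => /orP [/eqP ->|ha]; first by rewrite subrr.
by move/eqP: (h _ _ ha); rewrite fps_subE subr_eq0 => /eqP ->; apply: IH.
Qed.

(* Geometric-series inversion of an operator that is the identity up to terms of higher order. *)
Lemma near_id_surj (U : fps C d -> fps C d) :
  (forall f g, U (f + g) = U f + U g) -> (forall n f, vanish n f -> vanish n.+1 (U f - f)) ->
  forall h, exists f, U f = h.
Proof.
move=> UD UV h.
have U0 : U 0 = 0 by apply: (addIr (U 0)); rewrite -UD !add0r.
have UN f : U (- f) = - U f by apply: (addIr (U f)); rewrite -UD !addNr.
pose F := fix F n := if n is n'.+1 then F n' + (h - U (F n')) else 0.
have hF n : vanish n (h - U (F n)).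
  elim: n => [|n IH] //=; rewrite UD.
  have -> : h - (U (F n) + U (h - U (F n))) = - (U (h - U (F n)) - (h - U (F n))) by ring.
  exact/vanishN/UV.
have lF n : vanish n (fpslim F - F n).
  apply: vanish_fpslim => m /=; have -> : F m + (h - U (F m)) - F m = h - U (F m) by ring.
  exact: hF.
exists (fpslim F); apply/eqP; rewrite -subr_eq0; apply/eqP/vanish_all => n.
have -> : U (fpslim F) - h = (U (fpslim F - F n) - (fpslim F - F n)) + (fpslim F - F n) - (h - U (F n)).
  by rewrite UD UN; ring.
apply: vanishB (hF n); apply: vanishD (lF n).
exact: vanish_le (leqnSn n) (UV _ _ (lF n)).
Qed.

Lemma near_id_inj (U : fps C d -> fps C d) :
  (forall n f, vanish n f -> vanish n.+1 (U f - f)) -> forall f, U f = 0 -> f = 0.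
Proof.
move=> UV f Uf; apply: vanish_all; elim=> // n IH.
by have := UV _ _ IH; rewrite Uf sub0r => /vanishN; rewrite opprK.
Qed.

Lemma vanish_hadamard n k (f : fps C d) : vanish n.+1 f -> vanish n (hadamard k f).
Proof.
by move=> h a ha; rewrite /hadamard; case: ifP => // _; apply: h; rewrite mdeg_madd mdeg_monv addn1.
Qed.

Definition near_id phi := forall i, vanish 2 (phi i - fpsX C i).

Lemma near_id_based phi : near_id phi -> based phi.
Proof.
move=> h i; apply/vanish1P; rewrite -[phi i](subrK (fpsX C i)).
apply: vanishD; last exact: vanish1_fpsX.
exact: vanish_le (h i).
Qed.

Lemma vanish_near_id phi n f : near_id phi -> vanish n f -> vanish n.+1 (fpscomp f phi - f).
Proof.
move=> h; have h0 := near_id_based h; elim: n f => [|n IH] f hf.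
  by apply/vanish1P; rewrite cstD cstN cst_fpscomp // subrr.
rewrite {2}(fps_decomp f) {1}(fps_decomp f) fpscompD fpscompC // fpscomp_sum //.
have -> : cst f = 0 by apply: hf; rewrite mdeg_mon0.
rewrite fpsC0 !add0r -sumrB; apply: vanish_sum => k _; rewrite fpscompXM //.
set u := hadamard k f; have hu : vanish n u by apply: vanish_hadamard.
have -> : phi k * fpscomp u phi - fpsX C k * u = phi k * (fpscomp u phi - u) + (phi k - fpsX C k) * u by ring.
by apply: vanishD; [rewrite -[n.+2]add1n; apply: vanishM (IH _ hu); apply/vanish1P
  | rewrite -[n.+2]add2n; apply: vanishM hu].
Qed.

(** Substitution of [phi] is the identity up to higher order, hence bijective on series. The
    preimages of the variables form the inverse chart, and injectivity gives the other
    composition. *)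
Lemma chart_near_id phi : near_id phi -> chart phi.
Proof.
move=> h; have h0 := near_id_based h.
have hU n f : vanish n f -> vanish n.+1 (fpscomp f phi - f) by apply: vanish_near_id.
have UD f g : fpscomp (f + g) phi = fpscomp f phi + fpscomp g phi by apply: fpscompD.
have inj f g : fpscomp f phi = fpscomp g phi -> f = g.
  move=> e; apply/eqP; rewrite -subr_eq0; apply/eqP/(near_id_inj hU).
  by rewrite fpscompD fpscompN e subrr.
have /choice [psi hpsi] : forall i, exists f, fpscomp f phi = fpsX C i.
  by move=> i; apply: (near_id_surj UD hU).
have h1 : based psi by move=> i; rewrite -(cst_fpscomp h0) hpsi cst_fpsX.
exists psi; split=> // i; apply: inj; rewrite fpscompA // fpscompX //.
by rewrite -[RHS]fpscomp_id; congr fpscomp; apply: funext.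
Qed.

End Chart.

End Pullback.

(** * Weights and the homological equation *)

Section Weights.
Variables (C : numClosedFieldType) (d : nat).
Local Notation A := (fps C d).
Implicit Types (f g h : A) (a b : mon d) (i j k l : 'I_d) (P : pred (mon d)) (S T : 'M[C]_d).

(** Values lie in an arbitrary additive group, as both single eigenvalues and pairs of eigenvalues
    serve as weights. *)
Definition mwt (V : zmodType) (w : 'I_d -> V) a : V := \sum_i w i *+ a i.

Lemma mwt_madd (V : zmodType) (w : 'I_d -> V) a b : mwt w (madd a b) = mwt w a + mwt w b.
Proof. by rewrite /mwt -big_split; apply: eq_bigr => i _; rewrite ffunE mulrnDr. Qed.

Lemma mwt_monv (V : zmodType) (w : 'I_d -> V) k : mwt w (monv d k) = w k.
Proof.
rewrite /mwt (bigD1 k) //= monvE eqxx big1 ?addr0 // => i ik.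
by rewrite monvE (negbTE ik).
Qed.

Definition supp_in P f := forall a, f a != 0 -> P a.

Lemma supp_in0 P : supp_in P 0.
Proof. by move=> a; rewrite eqxx. Qed.
Lemma supp_inD P f g : supp_in P f -> supp_in P g -> supp_in P (f + g).
Proof.
move=> hf hg a; rewrite fps_addE; have [->|/hf //] := eqVneq (f a) 0.
by rewrite add0r => /hg.
Qed.
Lemma supp_inN P f : supp_in P f -> supp_in P (- f).
Proof. by move=> hf a; rewrite fps_oppE oppr_eq0 => /hf. Qed.
Lemma supp_in_sum P (I : Type) (r : seq I) (F : I -> A) :
  (forall x, supp_in P (F x)) -> supp_in P (\sum_(x <- r) F x).
Proof.
move=> h; elim/big_rec: _ => [|y x _ hx]; [exact: supp_in0 | exact: supp_inD].
Qed.
Lemma supp_inCM P c f : supp_in P f -> supp_in P (fpsC d c * f).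
Proof. by move=> hf a; rewrite mulCE mulf_eq0 negb_or => /andP [_ /hf]. Qed.

Lemma supp_inM (P Q R : pred (mon d)) f g : (forall a b, P a -> Q b -> R (madd a b)) ->
  supp_in P f -> supp_in Q g -> supp_in R (f * g).
Proof.
move=> h hf hg a; rewrite -fpsmul_ringE fpsmulE => ne.
have [b hb]: exists2 b : {ffun 'I_d -> 'I_(mdeg a).+1}, mle [ffun i => b i : nat] a &
   f [ffun i => b i : nat] * g (msub a [ffun i => b i : nat]) != 0.
  apply/exists_inP; apply: contraNT ne; rewrite negb_exists_in => /forall_inP h0.
  by rewrite big1 // => b /h0; rewrite negbK => /eqP.
rewrite mulf_eq0 negb_or => /andP [/hf h1 /hg h2].
by rewrite -(msubK hb) maddC; apply: h.
Qed.

Lemma supp_in_fderiv (P Q : pred (mon d)) k f : (forall a, P (madd a (monv d k)) -> Q a) ->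
  supp_in P f -> supp_in Q (fderiv k f).
Proof.
move=> h hf a; rewrite fderivE mulf_eq0 negb_or => /andP [_ /hf]; exact: h.
Qed.

Lemma supp_in_fpsX P k : P (monv d k) -> supp_in P (fpsX C k).
Proof. by move=> h a; rewrite /fpsX /fpsXn; case: (a =P monv d k) => [->|_] //; rewrite eqxx. Qed.

Lemma supp_of_fderiv P f : cst f = 0 ->
  (forall k a, fderiv k f a != 0 -> P (madd a (monv d k))) -> supp_in P f.
Proof.
move=> h0 h a; have [->|/mon_fst [k ak _]] := eqVneq a (mon0 d).
  by rewrite -cstE h0 eqxx.
move=> fa; rewrite -(@msubK _ a (monv d k)) ?mle_monv //; apply: h.
by rewrite fderivE msubK ?mle_monv // mulf_neq0 // pnatr_eq0.
Qed.

Definition pr P f : A := fun a => if P a then f a else 0.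

Lemma prD P f g : pr P (f + g) = pr P f + pr P g.
Proof. by apply: fps_ext => a; rewrite fps_addE /pr; case: ifP; rewrite ?addr0. Qed.
Lemma prN P f : pr P (- f) = - pr P f.
Proof. by apply: fps_ext => a; rewrite fps_oppE /pr; case: ifP; rewrite ?oppr0. Qed.
Lemma pr_zmod P : zmod_morphism (pr P).
Proof. by move=> f g; rewrite prD prN. Qed.
HB.instance Definition _ P := GRing.isZmodMorphism.Build A A (pr P) (pr_zmod P).
Lemma prCM P c f : pr P (fpsC d c * f) = fpsC d c * pr P f.
Proof. by apply: fps_ext => a; rewrite mulCE /pr; case: ifP; rewrite ?mulCE ?mulr0. Qed.
Lemma supp_pr P f : supp_in P (pr P f).
Proof. by move=> a; rewrite /pr; case: ifP; rewrite ?eqxx. Qed.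
Lemma pr_id P f : supp_in P f -> pr P f = f.
Proof.
move=> h; apply: fps_ext => a; rewrite /pr; case: ifP => // /negP Pa.
by apply/esym/eqP; apply: contra_notT Pa => /h.
Qed.
Lemma pr_eq0 P f : pr P f = 0 -> forall a, f a != 0 -> ~~ P a.
Proof.
move=> h a fa; apply/negP => Pa; case/negP: fa; apply/eqP.
by have := congr1 (fun g : A => g a) h; rewrite /pr Pa.
Qed.

Definition linop (S : 'M[C]_d) f := vapply (linvf S) f.

Lemma linopE S f a : linop S f a =
  \sum_l \sum_m S l m * ((fpsX C m * fderiv l f) a).
Proof.
rewrite /linop vapplyE fps_sumE; apply: eq_bigr => l _.
by rewrite linvfE mulr_suml fps_sumE; apply: eq_bigr => m _; rewrite -mulrA mulCE.
Qed.

Lemma pr_linop P S f :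
  (forall l m a, S l m != 0 -> P (madd a (monv d m)) = P (madd a (monv d l))) ->
  pr P (linop S f) = linop S (pr P f).
Proof.
move=> h; apply: fps_ext => a; rewrite [LHS]/pr !linopE.
transitivity (\sum_l \sum_m (if P a then S l m * ((fpsX C m * fderiv l f) a) else 0)).
  by case: ifP => // _; rewrite big1 // => l _; rewrite big1.
apply: eq_bigr => l _; apply: eq_bigr => m _; have [->|nz] := eqVneq (S l m) 0.
  by rewrite !mul0r; case: ifP.
rewrite !XmulE; case: (posnP (a m)) => am; first by rewrite mulr0; case: ifP.
rewrite !fderivE [pr P f _]/pr -(h l m _ nz) msubK ?mle_monv //.
by case: ifP => // _; rewrite !mulr0.
Qed.

Lemma linopD S f g : linop S (f + g) = linop S f + linop S g.
Proof. exact: vapplyD. Qed.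
Lemma linopB S f g : linop S (f - g) = linop S f - linop S g.
Proof. exact: vapplyB. Qed.
Lemma linopN S f : linop S (- f) = - linop S f.
Proof. exact: vapplyN. Qed.
Lemma linop0 S : linop S 0 = 0.
Proof. exact: vapply0. Qed.
Lemma linopCM S c f : linop S (fpsC d c * f) = fpsC d c * linop S f.
Proof. exact: vapplyCM. Qed.

Lemma linop_add S T f : linop (S + T) f = linop S f + linop T f.
Proof.
apply: fps_ext => a; rewrite fps_addE !linopE -big_split; apply: eq_bigr => l _ /=.
by rewrite -big_split; apply: eq_bigr => m _ /=; rewrite mxE mulrDl.
Qed.
Lemma linop_scale c S f : linop (c *: S) f = fpsC d c * linop S f.
Proof.
apply: fps_ext => a; rewrite mulCE !linopE mulr_sumr; apply: eq_bigr => l _ /=.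
by rewrite mulr_sumr; apply: eq_bigr => m _ /=; rewrite mxE mulrA.
Qed.
Lemma linop_linvf S T i : linop S (linvf T i) = linvf (T *m S) i.
Proof.
rewrite [linvf T i]linvfE /linop vapply_sum [RHS]linvfE.
under eq_bigr do rewrite vapplyCM vapplyX linvfE mulr_sumr.
rewrite exchange_big /=; apply: eq_bigr => l _; rewrite mxE raddf_sum mulr_suml.
by apply: eq_bigr => k _; rewrite mulrA -fpsCM.
Qed.

Lemma linop_commute S T f : S *m T = T *m S -> linop S (linop T f) = linop T (linop S f).
Proof.
move=> ST; rewrite /linop !vapplyE.
under eq_bigr do rewrite raddf_sum mulr_sumr /=.
under [in RHS]eq_bigr do rewrite raddf_sum mulr_sumr /=.
under eq_bigr do under eq_bigr do rewrite fderivM fderiv_linvf mulrDr.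
under [in RHS]eq_bigr do under eq_bigr do rewrite fderivM fderiv_linvf mulrDr.
under eq_bigr do rewrite big_split /=.
under [in RHS]eq_bigr do rewrite big_split /=.
rewrite !big_split /=; congr (_ + _); last first.
  rewrite exchange_big; apply: eq_bigr => l _; apply: eq_bigr => k _.
  by rewrite fderiv_comm; ring.
have key (U V : 'M[C]_d) : \sum_l \sum_k linvf U l * (fpsC d (V k l) * fderiv k f) =
    \sum_k linvf (V *m U) k * fderiv k f.
  rewrite exchange_big /=; apply: eq_bigr => k _; rewrite -linop_linvf /linop vapplyE mulr_suml.
  by apply: eq_bigr => l _; rewrite fderiv_linvf; ring.
by rewrite !key ST.
Qed.

Lemma linop_diag (u : 'I_d -> C) f a : linop (\matrix_(i, j) (u i *+ (i == j))) f a = mwt u a * f a.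
Proof.
rewrite linopE /mwt mulr_suml; apply: eq_bigr => l _.
rewrite (bigD1 l) //= mxE eqxx mulr1n big1 ?addr0; last first.
  by move=> m ml; rewrite mxE eq_sym (negbTE ml) mul0r.
rewrite XmulE; case: posnP => al; first by rewrite al mulr0n mulr0 mul0r.
rewrite fderivE msubK ?mle_monv // mulrA -[u l *+ a l]mulr_natr; congr (_ * _%:R * _).
by rewrite !ffunE eqxx; lia.
Qed.

(** By the product rule each of the [m + n] applications falls on one of the factors, and one of the
    two is hit often enough to vanish. *)
Lemma iter_linopM S m n f g : iter m (linop S) f = 0 -> iter n (linop S) g = 0 ->
  iter (m + n) (linop S) (f * g) = 0.
Proof.
have it0 q : iter q (linop S) 0 = 0 by elim: q => //= q ->; apply: linop0.
have itD q u v : iter q (linop S) (u + v) = iter q (linop S) u + iter q (linop S) v.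
  by elim: q => //= q ->; apply: linopD.
move: {2}(m + n)%N (leqnn (m + n)) => s; elim: s m n f g => [|s IH] [|m] [|n] f g //=.
- by move=> _ ->; rewrite mul0r.
- by move=> _ -> _; rewrite mul0r.
- by move=> _ -> _; rewrite mul0r -iterS it0.
- by move=> _ _ ->; rewrite addn0 mulr0 -iterS it0.
rewrite addSn -!iterS !iterSr /linop vapplyM -/(linop S) itD => hs hf hg.
have e1 := IH m n.+1 (linop S f) g; have e2 := IH m.+1 n f (linop S g).
rewrite -addSnnS in e1; rewrite addnS -addSn.
by rewrite e1 ?e2 ?addr0 ?iterSr //; lia.
Qed.

Lemma iter_linop0 S q : iter q (linop S) 0 = 0.
Proof. by elim: q => //= q ->; apply: linop0. Qed.

Lemma iter_linopD S q u v : iter q (linop S) (u + v) = iter q (linop S) u + iter q (linop S) v.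
Proof. by elim: q => //= q ->; apply: linopD. Qed.

Lemma iter_linopS S m n f : iter m (linop S) f = 0 -> (m <= n)%N -> iter n (linop S) f = 0.
Proof. by move=> h /subnK <-; rewrite iterD h iter_linop0. Qed.

(** A nilpotent matrix acts nilpotently on linear forms, and [iter_linopM] passes this on to
    products; the bound [K] keeps the number of factors finite. *)
Lemma linop_locnil S K f : (exists m, S ^+ m = 0) -> supp_in (fun a => mdeg a <= K)%N f ->
  exists m, iter m (linop S) f = 0.
Proof.
case=> p hp; elim: K f => [|K IH] f hf.
  exists 1%N => /=; have -> : f = fpsC d (cst f).
    apply: fps_ext => a; rewrite /fpsC; case: eqP => [->//|ne].
    apply/eqP; apply: contra_notT ne => /hf.
    by rewrite leqn0 mdeg_eq0 => /eqP.
  exact: vapplyC.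
have hX k : iter p (linop S) (fpsX C k) = 0.
  have -> : iter p (linop S) (fpsX C k) = linvf (S ^+ p) k.
    elim: (p) => [|q IHq] /=; first by rewrite linvf1.
    by rewrite IHq linop_linvf exprSr.
  by rewrite hp linvfE big1 // => l _; rewrite mxE fpsC0 mul0r.
have /choice [q hq] : forall k, exists m, iter m (linop S) (fpsX C k * hadamard k f) = 0.
  move=> k; have [m hm] : exists m, iter m (linop S) (hadamard k f) = 0.
    apply: IH => a; rewrite /hadamard; case: ifP => _; last by rewrite eqxx.
    by move/hf; rewrite mdeg_madd mdeg_monv; lia.
  by exists (p + m)%N; apply: iter_linopM.
pose N := (1 + \sum_k q k)%N; exists N; rewrite (fps_decomp f) iter_linopD.
have -> : iter N (linop S) (fpsC d (cst f)) = 0.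
  by apply: (@iter_linopS _ 1) => //=; apply: vapplyC.
have hN k : iter N (linop S) (fpsX C k * hadamard k f) = 0.
  by apply: iter_linopS (hq k) _; rewrite /N (bigD1 k) //= addnCA leq_addr.
rewrite add0r; clearbody N; elim/big_ind: _ => [|x y hx hy|k _].
- exact: iter_linop0.
- by rewrite iter_linopD hx hy addr0.
- exact: hN.
Qed.

(** Supplies the generic parameter for a combination of two commuting operators; the witness exceeds
    every modulus in the list. *)
Lemma exists_avoiding (s : seq C) : exists t : C, t \notin s.
Proof.
exists (1 + \sum_(x <- s) `|x|); apply/negP => h.
have : `|1 + \sum_(x <- s) `|x| | <= \sum_(x <- s) `|x|.
  by rewrite [leRHS](big_rem _ h) /= lerDl sumr_ge0.
by rewrite ger0_norm ?addr_ge0 ?sumr_ge0 // gerDr ler10.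
Qed.

(* [linop S - 1] is invertible on series whose support consists of monomials of
   bounded degree on which the semisimple part of S has no eigenvalue 1. *)
Section Solve.
Variables (S : 'M[C]_d) (u : 'I_d -> C) (P : pred (mon d)) (K : nat).
Let D := \matrix_(i, j) (u i *+ (i == j)) : 'M[C]_d.
Let N := S - D.
Hypothesis Nnil : exists m, N ^+ m = 0.
Hypothesis Ngr : forall l m, N l m != 0 -> u l = u m.
Hypothesis PN : forall l m a, N l m != 0 -> P (madd a (monv d m)) = P (madd a (monv d l)).
Hypothesis PK : forall a, P a -> (mdeg a <= K)%N.
Hypothesis Pu : forall a, P a -> mwt u a != 1.

Let linopS f : linop S f - f = (linop D f - f) + linop N f.
Proof. by rewrite {1}(_ : S = D + N) ?linop_add ?[D + _]addrC ?subrK //; ring. Qed.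

Let Dinv f : A := fun a => if P a then (mwt u a - 1)^-1 * f a else 0.

Let DinvK f : supp_in P f -> linop D (Dinv f) - Dinv f = f.
Proof.
move=> hf; apply: fps_ext => a; rewrite fps_subE linop_diag /Dinv; case: ifP => Pa.
  by have := Pu Pa; rewrite -subr_eq0 => nz; rewrite -[X in _ - X]mul1r -mulrBl mulVKf.
by rewrite mulr0 subr0; apply/esym/eqP; apply: contraFT Pa => /hf.
Qed.

Let supp_Dinv f : supp_in P (Dinv f).
Proof. by move=> a; rewrite /Dinv; case: ifP; rewrite ?eqxx. Qed.

Let supp_N f : supp_in P f -> supp_in P (linop N f).
Proof. by move=> hf; rewrite -(pr_id hf) -pr_linop //; apply: supp_pr. Qed.

Let N_Dinv f : linop N (Dinv f) = Dinv (linop N f).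
Proof.
apply: fps_ext => a; rewrite linopE.
transitivity (\sum_l \sum_m (if P a then (mwt u a - 1)^-1 * (N l m * ((fpsX C m * fderiv l f) a)) else 0)).
  apply: eq_bigr => l _; apply: eq_bigr => m _.
  have [->|nz] := eqVneq (N l m) 0; first by rewrite !mul0r mulr0; case: ifP.
  rewrite !XmulE; case: (posnP (a m)) => am; first by rewrite !mulr0; case: ifP.
  rewrite !fderivE [Dinv f _]/Dinv -(PN _ nz).
  have -> : mwt u (madd (msub a (monv d m)) (monv d l)) = mwt u (madd (msub a (monv d m)) (monv d m)).
    by rewrite !mwt_madd !mwt_monv (Ngr nz).
  rewrite msubK ?mle_monv //; case: ifP => _; rewrite ?mulr0 //; ring.
rewrite /Dinv; case: ifP => _; last by rewrite big1 // => l _; rewrite big1.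
by rewrite linopE mulr_sumr; apply: eq_bigr => l _; rewrite mulr_sumr.
Qed.

Let Dinv0 : Dinv 0 = 0.
Proof. by apply: fps_ext => a; rewrite /Dinv fps_zeroE mulr0; case: ifP. Qed.

Let locnil f : supp_in P f -> exists m, iter m (linop N) f = 0.
Proof. by move=> h; apply: (linop_locnil (K := K) Nnil) => a /h /PK. Qed.

Let iterN_Dinv m f : iter m (linop N) (Dinv f) = Dinv (iter m (linop N) f).
Proof. by elim: m => //= m ->; rewrite N_Dinv. Qed.

(** [Dinv] inverts the diagonal part of [linop S - 1] and commutes with [linop N]. The first
    approximation [Dinv g] leaves the error [- Dinv (linop N g)], which one power less of [linop N]
    annihilates. *)
Lemma linop_solve g : supp_in P g -> exists2 f, supp_in P f & linop S f - f = g.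
Proof.
move=> hg; have [m] := locnil hg; elim: m g hg => [|m IH] g hg.
  by move=> /= ->; exists 0; [exact: supp_in0 | rewrite linop0 subrr].
rewrite iterSr => hm; have [||f hf ef] := IH (- linop N (Dinv g)).
- exact/supp_inN/supp_N/supp_Dinv.
- rewrite N_Dinv; have -> : - Dinv (linop N g) = Dinv (- linop N g).
    by apply: fps_ext => a; rewrite fps_oppE /Dinv fps_oppE; case: ifP; rewrite ?oppr0 ?mulrN.
  rewrite iterN_Dinv; have -> : iter m (linop N) (- linop N g) = - iter m (linop N) (linop N g).
    by elim: (m) => //= q ->; rewrite linopN.
  by rewrite hm oppr0 Dinv0.
exists (Dinv g + f); first exact: supp_inD.
rewrite linopD opprD addrACA ef linopS DinvK //; ring.
Qed.

(** [linop N] preserves the fixed vectors of [linop S] and lowers the nilpotency exponent, so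
    [linop N f = 0] by induction; then [f] is fixed by the diagonal part, which has no eigenvalue 1
    on [P]. *)
Lemma linop_inj f : supp_in P f -> linop S f = f -> f = 0.
Proof.
have comm h : linop N (linop D h) = linop D (linop N h).
  apply: linop_commute; apply/matrixP => i j; rewrite !mxE (bigD1 j) //= [RHS](bigD1 i) //=.
  rewrite !big1 ?addr0; first last.
  - by move=> k kj; rewrite [D _ _]mxE (negbTE kj) mulr0.
  - by move=> k ki; rewrite [D _ _]mxE eq_sym (negbTE ki) mul0r.
  rewrite ![D _ _]mxE !eqxx !mulr1n; have [->|/Ngr ->] := eqVneq (N i j) 0; last exact: mulrC.
  by rewrite mul0r mulr0.
move=> hf; have [m] := locnil hf; elim: m f hf => [|m IH] f hf //; rewrite iterSr => hm /eqP.
rewrite -subr_eq0 linopS => /eqP e.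
have N0 : linop N f = 0.
  apply: IH => //; first exact: supp_N.
  have := congr1 (linop N) e; rewrite linop0 linopD linopB comm -linopS.
  by move/eqP; rewrite subr_eq0 => /eqP.
apply: fps_ext => a; apply/eqP; apply: contraT => fa.
move/eqP: (congr1 (fun g : A => g a) e); rewrite N0 addr0 fps_subE linop_diag.
rewrite -[X in _ - X]mul1r -mulrBl mulf_eq0 (negbTE fa) orbF subr_eq0.
by rewrite (negbTE (Pu (hf _ fa))).
Qed.

End Solve.

End Weights.

(** * Simultaneous normalization of the form and the field *)

Section Perturbation.
Variables (C : numClosedFieldType) (d : nat).
Local Notation A := (fps C d).
Implicit Types (f g h : A) (a b : mon d) (i j l : 'I_d) (phi psi : 'I_d -> A) (G Y V : 'I_d -> A).

Lemma vanish_comp_congr n phi psi f : based phi -> based psi -> (forall i, vanish n (phi i - psi i)) ->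
  vanish n (fpscomp f phi - fpscomp f psi).
Proof.
move=> h1 h2 h; suff H m : (m <= n)%N -> forall f, vanish m (fpscomp f phi - fpscomp f psi) by apply: H.
elim: m => [|m IH] hm // {}f; rewrite (fps_decomp f) !fpscompD !fpscompC // !fpscomp_sum //.
rewrite opprD addrACA subrr add0r -sumrB; apply: vanish_sum => k _; rewrite !fpscompXM //.
set u := hadamard k f.
have -> : phi k * fpscomp u phi - psi k * fpscomp u psi =
  phi k * (fpscomp u phi - fpscomp u psi) + (phi k - psi k) * fpscomp u psi by ring.
apply: vanishD; last exact/vanishMl/(vanish_le hm)/h.
by rewrite -add1n; apply: vanishM; [apply/vanish1P | apply: IH; apply: ltnW].
Qed.

(** In a product of [n] factors of order one, replacing one factor by a difference of order [k.+1]
    leaves order [n + k]. *)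
Lemma vanish_comp_sub n k phi f : based phi -> (forall i, vanish k.+1 (phi i - fpsX C i)) ->
  vanish n f -> vanish (n + k) (fpscomp f phi - f).
Proof.
move=> h1 h; elim: n f => [|n IH] f hf.
  rewrite -[in X in _ - X](fpscomp_id f); apply: (vanish_le (leqnSn k)).
  exact: vanish_comp_congr (@based_fpsX _ _) h.
rewrite {2}(fps_decomp f) {1}(fps_decomp f) fpscompD fpscompC // fpscomp_sum //.
have -> : cst f = 0 by apply: hf; rewrite mdeg_mon0.
rewrite fpsC0 !add0r -sumrB; apply: vanish_sum => l _; rewrite fpscompXM //.
set u := hadamard l f; have hu : vanish n u by apply: vanish_hadamard.
have -> : phi l * fpscomp u phi - fpsX C l * u = phi l * (fpscomp u phi - u) + (phi l - fpsX C l) * u by ring.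
apply: vanishD.
  by rewrite addSn -add1n; apply: vanishM (IH _ hu); apply/vanish1P.
by rewrite addnC addnS -addSn; apply: vanishM hu.
Qed.

Lemma vanish_linvf (S : 'M[C]_d) i : vanish 1 (linvf S i).
Proof. by apply/vanish1P; apply: based_linvf. Qed.

Lemma fpscomp_linvf phi (S : 'M[C]_d) i : based phi ->
  fpscomp (linvf S i) phi = \sum_l fpsC d (S i l) * phi l.
Proof.
by move=> h; rewrite linvfE fpscomp_sum //; apply: eq_bigr => l _; rewrite fpscompCM // fpscompX.
Qed.

(* First-order effect on a 1-form and a vector field of the change of coordinates x + V. *)
Section Effect.
Variables (k : nat) (V G Y G' Y' : 'I_d -> A) (M B : 'M[C]_d).
Hypothesis (hV : forall i, vanish k.+2 (V i)).
Let phi i := fpsX C i + V i.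
Hypothesis (hG : forall i, vanish 2 (G i - linvf M i)) (hY : forall i, vanish 2 (Y i - linvf B i)).
Hypothesis (ht : transf phi G Y G' Y').

Let hphi i : vanish k.+2 (phi i - fpsX C i).
Proof. by rewrite /phi addrAC subrr add0r. Qed.

Lemma perturb_near_id : near_id phi.
Proof. by move=> i; apply: vanish_le (hphi i). Qed.

Let bphi : based phi.
Proof. exact/near_id_based/perturb_near_id. Qed.

Let vG i : vanish 1 (G i).
Proof.
rewrite -(subrK (linvf M i) (G i)); apply: vanishD (vanish_linvf _ _).
exact: vanish_le (hG i).
Qed.
Let vY i : vanish 1 (Y i).
Proof.
rewrite -(subrK (linvf B i) (Y i)); apply: vanishD (vanish_linvf _ _).
exact: vanish_le (hY i).
Qed.

Let GE j : G j = fpscomp (G' j) phi + \sum_i fpscomp (G' i) phi * fderiv j (V i).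
Proof.
rewrite ht.1 /pull /phi; under eq_bigr do rewrite raddfD /= fderiv_fpsX mulrDr.
rewrite big_split /= (bigD1 j) //= eqxx mulr1 big1 ?addr0 // => i ij.
by rewrite eq_sym (negbTE ij) mulr0.
Qed.

Let YE i : fpscomp (Y' i) phi = Y i + vapply Y (V i).
Proof. by rewrite -ht.2 /phi vapplyD vapplyX. Qed.

Let hdV j i : vanish k.+1 (fderiv j (V i)).
Proof. exact: vanish_fderiv. Qed.

Let vG' i : vanish 1 (G' i).
Proof.
have -> : G' i = G i - (fpscomp (G' i) phi - G' i) - \sum_l fpscomp (G' l) phi * fderiv i (V l).
  by rewrite [G i]GE; ring.
apply: vanishB; first apply: vanishB => //.
  by apply: (@vanish_le _ _ _ k.+1) => //; rewrite -[k.+1]add0n; apply: vanish_comp_sub.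
by apply: vanish_sum => l _; apply: vanishMr; apply: vanish_le (hdV _ _).
Qed.

Lemma perturb_form_low i : vanish k.+2 (G' i - G i).
Proof.
have -> : G' i - G i = - (fpscomp (G' i) phi - G' i) - \sum_l fpscomp (G' l) phi * fderiv i (V l).
  by rewrite [G i]GE; ring.
apply: vanishB; first apply: vanishN.
  by rewrite -[k.+2]add1n; apply: vanish_comp_sub.
apply: vanish_sum => l _; rewrite -[k.+2]add1n; apply: vanishM (hdV _ _).
exact: vanish_fpscomp.
Qed.

Let hG' i : vanish 2 (G' i - linvf M i).
Proof.
have -> : G' i - linvf M i = (G' i - G i) + (G i - linvf M i) by ring.
by apply: vanishD => //; apply: vanish_le (perturb_form_low i).
Qed.

(** The correction is minus the Lie derivative of the linear part along [V], in Cartan's form: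
    [M^T - M] is the matrix of its exterior derivative. The nonlinear terms of the form contribute
    only from order [k.+3] on. *)
Lemma perturb_form j : vanish k.+3 (G' j -
  (G j - fderiv j (\sum_l V l * linvf M l) - \sum_l V l * fpsC d ((M^T - M) l j))).
Proof.
have -> : fderiv j (\sum_l V l * linvf M l) =
   \sum_l fderiv j (V l) * linvf M l + \sum_l V l * fpsC d (M l j).
  rewrite raddf_sum -big_split; apply: eq_bigr => l _ /=.
  by rewrite fderivM fderiv_linvf.
have -> : \sum_l V l * fpsC d ((M^T - M) l j) = \sum_l V l * fpsC d (M j l) - \sum_l V l * fpsC d (M l j).
  by rewrite -sumrB; apply: eq_bigr => l _; rewrite !mxE raddfB /= mulrBr.
rewrite [G j]GE.
set g := linvf M j.
have -> : \sum_l V l * fpsC d (M j l) = fpscomp g phi - g.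
  rewrite fpscomp_linvf // /g linvfE -sumrB; apply: eq_bigr => l _; rewrite /phi; ring.
set s1 := \sum_i _ * _; set s2 := \sum_i _ * _; set s3 := \sum_l _ * _.
have -> : G' j - (fpscomp (G' j) phi + s1 - (s2 + s3) - (fpscomp g phi - g - s3)) =
  - (fpscomp (G' j - g) phi - (G' j - g)) - (s1 - s2).
  rewrite fpscompD fpscompN; ring.
apply: vanishB; first apply: vanishN.
  by rewrite -[k.+3]add2n; apply: vanish_comp_sub; last exact: hG'.
rewrite /s1 /s2 -sumrB; apply: vanish_sum => i _.
have -> : fpscomp (G' i) phi * fderiv j (V i) - fderiv j (V i) * linvf M i =
  (fpscomp (G' i) phi - G' i + (G' i - linvf M i)) * fderiv j (V i) by ring.
rewrite -[k.+3]add2n; apply: vanishM (hdV _ _); apply: vanishD (hG' i).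
by apply: (@vanish_le _ _ _ k.+2) => //; rewrite -[k.+2]add1n; apply: vanish_comp_sub.
Qed.

Let vYV i : vanish k.+2 (vapply Y (V i)).
Proof.
rewrite vapplyE; apply: vanish_sum => l _; rewrite -[k.+2]add1n.
exact: vanishM (vY l) (hdV _ _).
Qed.

Let vY' i : vanish 1 (Y' i).
Proof.
have -> : Y' i = Y i + vapply Y (V i) - (fpscomp (Y' i) phi - Y' i) by rewrite YE; ring.
apply: vanishB; first by apply: vanishD => //; apply: vanish_le (vYV i).
by apply: (@vanish_le _ _ _ k.+1) => //; rewrite -[k.+1]add0n; apply: vanish_comp_sub.
Qed.

Lemma perturb_vf_low i : vanish k.+2 (Y' i - Y i).
Proof.
have -> : Y' i - Y i = vapply Y (V i) - (fpscomp (Y' i) phi - Y' i) by rewrite YE; ring.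
by apply: vanishB => //; rewrite -[k.+2]add1n; apply: vanish_comp_sub.
Qed.

Let hY' i : vanish 2 (Y' i - linvf B i).
Proof.
have -> : Y' i - linvf B i = (Y' i - Y i) + (Y i - linvf B i) by ring.
by apply: vanishD => //; apply: vanish_le (perturb_vf_low i).
Qed.

(** The correction is the bracket of the linear field [linvf B] with [V]; the nonlinear terms of [Y]
    contribute only from order [k.+3] on. *)
Lemma perturb_vf i : vanish k.+3 (Y' i -
  (Y i + linop B (V i) - \sum_l fpsC d (B i l) * V l)).
Proof.
set b := linvf B i.
have -> : \sum_l fpsC d (B i l) * V l = fpscomp b phi - b.
  rewrite fpscomp_linvf // /b linvfE -sumrB; apply: eq_bigr => l _; rewrite /phi; ring.
have -> : Y' i - (Y i + linop B (V i) - (fpscomp b phi - b)) =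
  (vapply Y (V i) - linop B (V i)) - (fpscomp (Y' i - b) phi - (Y' i - b)).
  rewrite fpscompD fpscompN YE; ring.
apply: vanishB.
  rewrite /linop !vapplyE -sumrB; apply: vanish_sum => l _; rewrite -mulrBl.
  by rewrite -[k.+3]add2n; apply: vanishM (hdV _ _).
by rewrite -[k.+3]add2n; apply: vanish_comp_sub; last exact: hY'.
Qed.

End Effect.

Lemma pr_fderiv (P Q : pred (mon d)) j f : (forall a, Q (madd a (monv d j)) = P a) ->
  pr P (fderiv j f) = fderiv j (pr Q f).
Proof.
move=> h; apply: fps_ext => a; rewrite fderivE /pr h; case: ifP => _; last by rewrite mulr0.
by rewrite fderivE.
Qed.

Lemma poincare G : (forall i j, fderiv i (G j) = fderiv j (G i)) ->
  exists2 S, cst S = 0 & forall j, fderiv j S = G j.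
Proof.
move=> h; pose u := \sum_l fpsX C l * G l.
(* Contraction with the radial field, divided by the degree; in degree 0 the inverse of zero is
   zero, which gives the normalization [cst S = 0]. *)
exists (fun a => (mdeg a)%:R^-1 * u a) => [|j].
  by rewrite /cst mdeg_mon0 invr0 mul0r.
apply: fps_ext => a; rewrite fderivE mulrCA -fderivE mdeg_madd mdeg_monv addn1.
have -> : fderiv j u = G j + \sum_l fpsX C l * fderiv l (G j).
  rewrite /u raddf_sum /=; under eq_bigr do rewrite fderivM fderiv_fpsX (h j).
  rewrite big_split /= (bigD1 j) //= eqxx mul1r big1 ?addr0 // => i ij.
  by rewrite eq_sym (negbTE ij) mul0r.
suff -> : (G j + \sum_l fpsX C l * fderiv l (G j)) a = (mdeg a).+1%:R * G j a.
  by rewrite mulKf // pnatr_eq0.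
rewrite -nat1r mulrDl mul1r fps_addE fps_sumE; congr (_ + _).
rewrite /mdeg natr_sum mulr_suml; apply: eq_bigr => l _.
rewrite XmulE; case: posnP => al; first by rewrite al mul0r.
by rewrite fderivE msubK ?mle_monv // !ffunE eqxx; congr (_%:R * _); lia.
Qed.

Lemma supp_fderiv_deg n f : cst f = 0 -> (forall j, supp_in (fun a => mdeg a == n) (fderiv j f)) ->
  supp_in (fun a => mdeg a == n.+1) f.
Proof.
move=> h0 h; apply: supp_of_fderiv => // j a /h.
by rewrite mdeg_madd mdeg_monv addn1 eqSS.
Qed.

Lemma supp_vanish n f : supp_in (fun a => mdeg a < n)%N f -> vanish n f -> f = 0.
Proof.
move=> h hv; apply: fps_ext => a; rewrite fps_zeroE; apply/eqP; apply: contraT => fa.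
by move: (fa); rewrite hv ?eqxx //; apply: h.
Qed.

Definition low n f := pr (fun a => mdeg a < n)%N f.
Definition hpart n f := pr (fun a => mdeg a == n) f.

Lemma hpart_zmod n : zmod_morphism (hpart n).
Proof. exact: pr_zmod. Qed.
HB.instance Definition _ n := GRing.isZmodMorphism.Build A A (hpart n) (hpart_zmod n).

Lemma vanish_low n f : vanish n (f - low n f).
Proof. by move=> a ha; rewrite fps_subE /low /pr ha subrr. Qed.
Lemma vanish_low_hpart n f : vanish n.+1 (f - (low n f + hpart n f)).
Proof.
move=> a ha; rewrite fps_subE fps_addE /low /hpart /pr; case: (ltngtP (mdeg a) n) ha => h ha.
- by rewrite addr0 subrr.
- by move: ha; rewrite ltnS leqNgt h.
- by rewrite add0r subrr.
Qed.
Lemma vanish_hpart n f : vanish n (hpart n f).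
Proof. by move=> a ha; rewrite /hpart /pr; case: eqP ha => // ->; rewrite ltnn. Qed.
Lemma hpart_vanish n f : vanish n.+1 f -> hpart n f = 0.
Proof. by move=> h; apply: fps_ext => a; rewrite /hpart /pr; case: eqP => // e; rewrite h ?e. Qed.
Lemma hpart_fderiv n j f : hpart n (fderiv j f) = fderiv j (hpart n.+1 f).
Proof. by apply: pr_fderiv => a; rewrite mdeg_madd mdeg_monv addn1 eqSS. Qed.
Lemma hpartMC n f c : hpart n (f * fpsC d c) = hpart n f * fpsC d c.
Proof. by rewrite mulrC /hpart prCM mulrC. Qed.

Lemma lie_form1_vanish p q Y G j : (forall i, vanish p (Y i)) -> (forall i, vanish q.+1 (G i)) ->
  (0 < p)%N -> vanish (p + q) (lie_form1 Y G j).
Proof.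
case: p => // p hY hG _; rewrite lie_form1E vapplyE; apply: vanishD; apply: vanish_sum => l _.
  by apply: vanishM => //; apply: vanish_fderiv.
rewrite addnC addnS -addSn; apply: vanishM => //.
exact: vanish_fderiv.
Qed.

Lemma lie_form1Dl Y1 Y2 G j : lie_form1 (fun i => Y1 i + Y2 i) G j = lie_form1 Y1 G j + lie_form1 Y2 G j.
Proof.
rewrite !lie_form1E !vapplyE -!big_split; apply: eq_bigr => l _ /=.
by rewrite raddfD /=; ring.
Qed.
Lemma lie_form1Dr Y G1 G2 j : lie_form1 Y (fun i => G1 i + G2 i) j = lie_form1 Y G1 j + lie_form1 Y G2 j.
Proof.
rewrite !lie_form1E !vapplyE -!big_split; apply: eq_bigr => l _ /=.
by rewrite raddfD /=; ring.
Qed.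

Lemma lie_cartan Y G j : lie_form1 Y G j =
  fderiv j (\sum_l Y l * G l) + \sum_l Y l * (fderiv l (G j) - fderiv j (G l)).
Proof.
rewrite lie_form1E vapplyE raddf_sum -!big_split; apply: eq_bigr => l _ /=.
rewrite fderivM; ring.
Qed.

End Perturbation.

(* M and B are the linear parts of the form and of the field, Z is the linear part of the
   field dual to the form, and [w i] is the pair of eigenvalues of Z and B on the i-th
   coordinate.  A coefficient of the form is resonant if its total weight is (1, 0). *)
Section Normalization.
Variables (C : numClosedFieldType) (d : nat).
Local Notation A := (fps C d).
Local Notation V2 := (C * C)%type.
Variables (M B Z J : 'M[C]_d) (w : 'I_d -> V2).
Implicit Types (f g h : A) (a b : mon d) (i j l : 'I_d) (G Y V phi : 'I_d -> A).

Let e : V2 := (1, 0).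
Hypothesis JE : J = M^T - M.
Hypothesis Junit : J \in unitmx.
Hypothesis MJZ : M = - (J *m Z).
Hypothesis BJ : B^T *m J = - (J *m B).
Hypothesis ZB : Z *m B = B *m Z.
Hypothesis Zgr : forall i j, Z i j != 0 -> w i = w j.
Hypothesis Bgr : forall i j, B i j != 0 -> w i = w j.
Hypothesis Jgr : forall i j, J i j != 0 -> w i + w j = e.
Hypothesis nilp : forall t : C, exists m,
  (Z + t *: B - \matrix_(i, j) (((w i).1 + t * (w i).2) *+ (i == j))) ^+ m = 0.

Let Ji := invmx J.

(** [K] keeps only the entries of [Ji] that the weights allow. The grading of [J] makes [K] a right
    inverse of [J] all the same, so nothing was discarded. *)
Let Jigr i j : Ji i j != 0 -> w i + w j = e.
Proof.
pose K := \matrix_(i, j) (if w i + w j == e then Ji i j else 0).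
suff -> : Ji = K by rewrite mxE; case: (w i + w j =P e) => // _; rewrite eqxx.
suff JK : J *m K = 1%:M by rewrite -[K]mul1mx -(mulVmx Junit) -mulmxA JK mulmx1.
rewrite -(mulmxV Junit); apply/matrixP => k m; rewrite !mxE.
have Jinv : \sum_j0 J k j0 * Ji j0 m = (k == m)%:R.
  by have /matrixP /(_ k m) := mulmxV Junit; rewrite !mxE.
have [E|ne] := eqVneq (w k) (w m).
  apply: eq_bigr => l _; rewrite mxE; have [->|/Jgr h] := eqVneq (J k l) 0; first by rewrite !mul0r.
  by rewrite -E addrC h eqxx.
rewrite Jinv; case: (k =P m) ne => [->|_ ne]; first by rewrite eqxx.
rewrite big1 // => l _; rewrite mxE; have [->|/Jgr h] := eqVneq (J k l) 0; first by rewrite mul0r.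
case: (w l + w m =P e) => [h2|]; last by rewrite mulr0.
by case/negP: ne; apply/eqP; apply: (addrI (w l)); rewrite h2 addrC h.
Qed.

Let Mgr i j : M i j != 0 -> w i + w j = e.
Proof.
rewrite MJZ !mxE oppr_eq0 => nz.
have /existsP [l] : [exists l, J i l * Z l j != 0].
  apply: contraNT nz; rewrite negb_exists => /forallP h; rewrite big1 // => l _.
  by apply/eqP; rewrite -[_ == _]negbK h.
by rewrite mulf_eq0 negb_or => /andP [/Jgr h1 /Zgr h2]; rewrite -h2.
Qed.

Definition closed_upto p G := forall i j,
  vanish p (fderiv i (G j) - fderiv j (G i) - fpsC d (J i j)).

Definition normal_upto k G Y :=
  [/\ forall i, vanish 2 (G i - linvf M i), forall i, vanish 2 (Y i - linvf B i),
      forall i, supp_in (fun a => mwt w a + w i == e) (low k (G i)),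
      forall i, supp_in (fun a => mwt w a == w i) (low k (Y i)) &
      forall j, lie_form1 Y G j = 0].

(* Contraction with the constant symplectic form J: [flat V = dF] says that V is the
   Hamiltonian field of F. *)
Definition flat V j := \sum_l V l * fpsC d (J l j).
Definition sharp (al : 'I_d -> A) : 'I_d -> A := fun l => \sum_j al j * fpsC d (Ji j l).

Lemma sharpK al j : flat (sharp al) j = al j.
Proof.
rewrite /flat /sharp; under eq_bigr do rewrite mulr_suml.
rewrite exchange_big /=; under eq_bigr do under eq_bigr do rewrite -mulrA -rmorphM /=.
under eq_bigr do rewrite -mulr_sumr -raddf_sum /=.
have h i : \sum_k Ji i k * J k j = (i == j)%:R.
  by have /matrixP /(_ i j) := mulVmx Junit; rewrite !mxE.
rewrite (bigD1 j) //= h eqxx fpsC1E mulr1 big1 ?addr0 // => i ij.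
by rewrite h (negbTE ij) fpsC0 mulr0.
Qed.

Lemma flatK V l : sharp (flat V) l = V l.
Proof.
rewrite /flat /sharp; under eq_bigr do rewrite mulr_suml.
rewrite exchange_big /=; under eq_bigr do under eq_bigr do rewrite -mulrA -rmorphM /=.
under eq_bigr do rewrite -mulr_sumr -raddf_sum /=.
have h i : \sum_k J i k * Ji k l = (i == l)%:R.
  by have /matrixP /(_ i l) := mulmxV Junit; rewrite !mxE.
rewrite (bigD1 l) //= h eqxx fpsC1E mulr1 big1 ?addr0 // => i ij.
by rewrite h (negbTE ij) fpsC0 mulr0.
Qed.

Lemma vanish_sharp n al l : (forall j, vanish n (al j)) -> vanish n (sharp al l).
Proof. by move=> h; apply: vanish_sum => j _; apply: vanishMl. Qed.

Lemma fderiv_flat_linvf : forall l j, fderiv l (linvf M j) - fderiv j (linvf M l) = fpsC d (J l j).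
Proof. by move=> l j; rewrite !fderiv_linvf JE !mxE raddfB. Qed.

Lemma supp_linvf_M i : supp_in (fun a => mwt w a + w i == e) (linvf M i).
Proof.
rewrite linvfE; apply: supp_in_sum => l; have [->|/Mgr h] := eqVneq (M i l) 0.
  by rewrite fpsC0 mul0r; apply: supp_in0.
by apply/supp_inCM/supp_in_fpsX; rewrite mwt_monv addrC h.
Qed.

Lemma supp_low (P : pred (mon d)) k f : supp_in P (low k f) -> forall a, (mdeg a < k)%N -> f a != 0 -> P a.
Proof. by move=> h a ha fa; apply: h; rewrite /low /pr ha. Qed.

Lemma supp_low_ext (P : pred (mon d)) k f g : vanish k (f - g) -> supp_in P (low k g) -> supp_in P (low k f).
Proof.
move=> hv h a; rewrite /low /pr; case: ifP => ha; last by rewrite eqxx.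
have /eqP := hv _ ha; rewrite fps_subE subr_eq0 => /eqP ->; exact: (supp_low h).
Qed.

Lemma supp_linvf_B i : supp_in (fun a => mwt w a == w i) (linvf B i).
Proof.
rewrite linvfE; apply: supp_in_sum => l; have [->|/Bgr h] := eqVneq (B i l) 0.
  by rewrite fpsC0 mul0r; apply: supp_in0.
by apply/supp_inCM/supp_in_fpsX; rewrite mwt_monv h.
Qed.

Lemma supp_low_sub (P : pred (mon d)) k f : supp_in P f -> supp_in P (low k f).
Proof. by move=> h a; rewrite /low /pr; case: ifP => _; [apply: h | rewrite eqxx]. Qed.

Lemma supp_low_le (P : pred (mon d)) k k' f : (k <= k')%N -> supp_in P (low k' f) -> supp_in P (low k f).
Proof.
move=> hk h a; rewrite /low /pr; case: ifP => ha; last by rewrite eqxx.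
by apply: (supp_low h); apply: leq_trans ha hk.
Qed.

Lemma normal_upto2 G Y : (forall i, vanish 2 (G i - linvf M i)) -> (forall i, vanish 2 (Y i - linvf B i)) ->
  (forall j, lie_form1 Y G j = 0) -> normal_upto 2 G Y.
Proof.
move=> h1 h2 h3; split=> // i.
  exact: supp_low_ext (h1 i) (supp_low_sub (@supp_linvf_M i)).
exact: supp_low_ext (h2 i) (supp_low_sub (@supp_linvf_B i)).
Qed.

(** One Moser step. Solving [flat V = hpart k.+2 G] cancels the whole part of degree [k.+2] of the
    form, and what comes in its place is exact; so the exterior derivative becomes constant one
    order further. Lower degrees, and with them the weights, are untouched. *)
Lemma step_closed k G Y : normal_upto k.+2 G Y -> closed_upto k.+1 G ->
  exists phi, (forall i, vanish k.+2 (phi i - fpsX C i)) /\ exists G' Y',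
    [/\ transf phi G Y G' Y', normal_upto k.+2 G' Y', closed_upto k.+2 G',
     forall i, vanish k.+2 (G' i - G i) & forall i, vanish k.+2 (Y' i - Y i)].
Proof.
move=> [h1 h2 h3 h4 h5] hc.
pose V := sharp (fun j => hpart k.+2 (G j)).
have hV i : vanish k.+2 (V i) by apply: vanish_sharp => j; apply: vanish_hpart.
pose phi i := fpsX C i + V i.
have hn : near_id phi by exact: perturb_near_id.
have hp i : vanish k.+2 (phi i - fpsX C i) by rewrite /phi addrAC subrr add0r.
exists phi; split=> //.
have [G' [Y' ht]] := transf_ex G Y (chart_near_id hn); exists G', Y'.
have gl := perturb_form_low hV h1 ht; have yl := perturb_vf_low hV h2 ht.
split=> //.
  split.
  - move=> i; rewrite -[G' i](subrK (G i)) -addrA; apply: vanishD => //.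
    by apply: vanish_le (gl i).
  - move=> i; rewrite -[Y' i](subrK (Y i)) -addrA; apply: vanishD => //.
    by apply: vanish_le (yl i).
  - by move=> i; apply: supp_low_ext (gl i) (h3 i).
  - by move=> i; apply: supp_low_ext (yl i) (h4 i).
  - exact: lie_transf0 (chart_near_id hn) ht h5.
move=> i j; pose S := \sum_l V l * linvf M l.
have E m : vanish k.+3 (G' m - (low k.+2 (G m) - fderiv m S)).
  have := perturb_form hV h1 ht m; rewrite -JE -/(flat V m) sharpK -/S => hh.
  have -> : G' m - (low k.+2 (G m) - fderiv m S) = (G' m - (G m - fderiv m S - hpart k.+2 (G m)))
     + (G m - (low k.+2 (G m) + hpart k.+2 (G m))) by ring.
  by apply: vanishD => //; apply: vanish_low_hpart.
(* This difference has degree at most [k], where it vanishes by the closedness already achieved. *)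
have E0 : fderiv i (low k.+2 (G j)) - fderiv j (low k.+2 (G i)) - fpsC d (J i j) = 0.
  apply: (@supp_vanish _ _ k.+1).
    apply: supp_inD; first (apply: supp_inD; last apply: supp_inN).
    - by apply: supp_in_fderiv (@supp_pr _ _ _ _) => a; rewrite mdeg_madd mdeg_monv addn1.
    - by apply: supp_in_fderiv (@supp_pr _ _ _ _) => a; rewrite mdeg_madd mdeg_monv addn1.
    apply: supp_inN => a; rewrite /fpsC; case: (a =P mon0 d) => [->|_]; last by rewrite eqxx.
    by rewrite mdeg_mon0.
  have -> : fderiv i (low k.+2 (G j)) - fderiv j (low k.+2 (G i)) - fpsC d (J i j) =
    (fderiv i (G j) - fderiv j (G i) - fpsC d (J i j)) - fderiv i (G j - low k.+2 (G j))
    + fderiv j (G i - low k.+2 (G i)) by rewrite !raddfB /=; ring.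
  apply: vanishD; first apply: vanishB => //.
  - by apply: vanish_fderiv; apply: vanish_low.
  - by apply: vanish_fderiv; apply: vanish_low.
have -> : fderiv i (G' j) - fderiv j (G' i) - fpsC d (J i j) =
  fderiv i (G' j - (low k.+2 (G j) - fderiv j S)) - fderiv j (G' i - (low k.+2 (G i) - fderiv i S))
  + (fderiv i (low k.+2 (G j)) - fderiv j (low k.+2 (G i)) - fpsC d (J i j)).
  by rewrite !raddfB /= (fderiv_comm i j S); ring.
rewrite E0 addr0; apply: vanishB; exact: vanish_fderiv.
Qed.

Lemma linop_ZB f : linop Z (linop B f) = linop B (linop Z f).
Proof. exact: linop_commute. Qed.

Lemma flat_vanish n V j : (forall i, vanish n (V i)) -> vanish n (flat V j).
Proof. by move=> h; apply: vanish_sum => l _; apply: vanishMl. Qed.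

Lemma contract_linvf V F : (forall j, flat V j = fderiv j F) ->
  \sum_l V l * linvf M l = - linop Z F.
Proof.
move=> h; have ME l : linvf M l = - \sum_m fpsC d (J l m) * linvf Z m.
  rewrite MJZ; have -> : linvf (- (J *m Z)) l = - linvf (J *m Z) l.
    by rewrite !linvfE -sumrN; apply: eq_bigr => m _; rewrite mxE raddfN mulNr.
  congr (- _); rewrite linvfE; under [in RHS]eq_bigr do rewrite linvfE mulr_sumr.
  rewrite exchange_big; apply: eq_bigr => m _; rewrite mxE raddf_sum mulr_suml.
  by apply: eq_bigr => p _; rewrite mulrA -fpsCM.
under eq_bigr do rewrite ME mulrN mulr_sumr.
rewrite sumrN exchange_big /=; congr (- _); rewrite /linop vapplyE; apply: eq_bigr => m _.
by rewrite -h /flat mulr_sumr; apply: eq_bigr => l _; ring.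
Qed.

(** [B] is infinitesimally symplectic by [BJ]; hence bracketing the linear field of [B] with a
    Hamiltonian field stays Hamiltonian. *)
Lemma bracket_hamiltonian V F : (forall j, flat V j = fderiv j F) -> forall j,
  flat (fun i => linop B (V i) - \sum_l fpsC d (B i l) * V l) j = fderiv j (linop B F).
Proof.
move=> h j; rewrite /flat; under eq_bigr do rewrite mulrBl.
rewrite sumrB.
have -> : \sum_i linop B (V i) * fpsC d (J i j) = linop B (fderiv j F).
  rewrite -h /flat /linop vapply_sum; apply: eq_bigr => i _.
  by rewrite mulrC [in RHS]mulrC vapplyCM.
have -> : \sum_i (\sum_l fpsC d (B i l) * V l) * fpsC d (J i j) =
   - \sum_m fpsC d (B m j) * fderiv m F.
  under [in RHS]eq_bigr do rewrite -h /flat mulr_sumr.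
  under [LHS]eq_bigr do rewrite mulr_suml.
  rewrite exchange_big [in RHS]exchange_big -sumrN; apply: eq_bigr => l _ /=.
  have E : \sum_i B i l * J i j = - \sum_i J l i * B i j.
    have /matrixP /(_ l j) := BJ; rewrite !mxE => <-.
    by apply: eq_bigr => i _; rewrite mxE.
  transitivity (V l * fpsC d (\sum_i B i l * J i j)).
    by rewrite raddf_sum mulr_sumr; apply: eq_bigr => i _ /=; rewrite fpsCM; ring.
  rewrite E raddfN raddf_sum mulrN mulr_sumr /=; congr (- _).
  by apply: eq_bigr => i _; rewrite fpsCM; ring.
rewrite opprK /linop !vapplyE raddf_sum -big_split; apply: eq_bigr => l _ /=.
by rewrite fderivM fderiv_linvf (fderiv_comm j l); ring.
Qed.

Let wadd (V W : zmodType) (u : 'I_d -> V * W) a : mwt u a = (mwt (fun i => (u i).1) a, mwt (fun i => (u i).2) a).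
Proof.
rewrite /mwt [LHS]surjective_pairing !raddf_sum /=; congr pair.
  by apply: eq_bigr => i _; elim: (a i) => [|p IH]; rewrite ?mulr0n // !mulrS /= IH.
by apply: eq_bigr => i _; elim: (a i) => [|p IH]; rewrite ?mulr0n // !mulrS /= IH.
Qed.

(** Each nonresonant monomial of degree [n] excludes at most one [t], and there are finitely many.
    If the second weight is zero, the first one differs from 1 and no [t] is excluded. *)
Lemma generic_time n : exists t : C, forall a, mdeg a = n -> mwt w a != e ->
  mwt (fun i => (w i).1 + t * (w i).2) a != 1.
Proof.
have [t ht] := exists_avoiding [seq (1 - (mwt w a).1) / (mwt w a).2 | a <- mons d n].
exists t => a ha nz.
have -> : mwt (fun i => (w i).1 + t * (w i).2) a = (mwt w a).1 + t * (mwt w a).2.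
  rewrite wadd /mwt /= mulr_sumr -big_split; apply: eq_bigr => i _ /=.
  by rewrite mulrnDl mulrnAr.
apply: contraNneq ht => E; apply/mapP; exists a; first by rewrite mem_mons ha.
have nz2 : (mwt w a).2 != 0.
  apply: contraNneq nz => h0; rewrite [mwt w a]surjective_pairing h0.
  by move: E; rewrite h0 mulr0 addr0 => ->.
by rewrite -E addrC addKr mulfK.
Qed.

Lemma vanish_of_supp n f : supp_in (fun a => mdeg a == n) f -> vanish n f.
Proof.
move=> h a ha; apply/eqP; apply: contraT => /h /eqP E; by rewrite E ltnn in ha.
Qed.

Lemma flatD V W j : flat (fun i => V i + W i) j = flat V j + flat W j.
Proof. by rewrite /flat -big_split; apply: eq_bigr => l _; rewrite mulrDl. Qed.

Lemma hpart_flat n V j : hpart n (flat V j) = flat (fun i => hpart n (V i)) j.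
Proof. by rewrite /flat /hpart raddf_sum; apply: eq_bigr => l _; apply: hpartMC. Qed.

Lemma hpart_linop n (T : 'M[C]_d) f : hpart n (linop T f) = linop T (hpart n f).
Proof. by apply: pr_linop => l m a _; rewrite !mdeg_madd !mdeg_monv. Qed.

Lemma lie_linvf_exact S j : lie_form1 (linvf B) (fun i => fderiv i S) j = fderiv j (linop B S).
Proof.
rewrite lie_form1E /linop !vapplyE raddf_sum -big_split; apply: eq_bigr => l _ /=.
by rewrite fderivM (fderiv_comm j l); ring.
Qed.

Lemma lie_hamiltonian_linvf V h j : (forall i, flat V i = fderiv i h) ->
  lie_form1 V (linvf M) j = fderiv j (h - linop Z h).
Proof.
move=> hv; rewrite lie_cartan (contract_linvf hv) raddfB raddfN /= -hv addrC; congr (_ + _).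
by apply: eq_bigr => l _; rewrite fderiv_flat_linvf.
Qed.

Lemma lie_supp Y G j : (forall i, supp_in (fun a => mwt w a == w i) (Y i)) ->
  (forall i, supp_in (fun a => mwt w a + w i == e) (G i)) ->
  supp_in (fun a => mwt w a + w j == e) (lie_form1 Y G j).
Proof.
move=> hY hG; rewrite lie_form1E vapplyE.
apply: supp_inD; apply: supp_in_sum => l.
  apply: (supp_inM _ (hY l) (supp_in_fderiv (Q := fun a => mwt w a + w l + w j == e) _ (hG j))).
    by move=> a b /eqP ha /eqP hb; rewrite mwt_madd ha -hb; apply/eqP; rewrite [w l + _]addrC.
  by move=> a; rewrite mwt_madd mwt_monv.
apply: (supp_inM _ (hG l) (supp_in_fderiv (Q := fun a => mwt w a + w j == w l) _ (hY l))).
  by move=> a b /eqP ha /eqP hb; rewrite mwt_madd -addrA hb ha.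
by move=> a; rewrite mwt_madd mwt_monv.
Qed.

(** This is the invariance of the form in degree [k.+2]. The lower-degree parts only produce
    resonant terms; off the resonant weight there remain the linear parts paired with the parts of
    degree [k.+2], and these are differentials. *)
Lemma resonance_relation k G Y S h : normal_upto k.+2 G Y ->
  (forall j, fderiv j S = hpart k.+2 (G j)) -> (forall j, flat (fun i => hpart k.+2 (Y i)) j = fderiv j h) ->
  pr (fun a => (mdeg a == k.+3) && (mwt w a != e)) (linop B S - (linop Z h - h)) = 0.
Proof.
move=> [h1 h2 h3 h4 h5] dS dh; set Q := fun a => _; set X := _ - _.
apply: fderiv_inj0 => [|j]; first by rewrite /cst /pr /Q mdeg_mon0.
rewrite -(@pr_fderiv _ _ (fun a => (mdeg a == k.+2) && (mwt w a + w j != e))); last first.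
  by move=> a; rewrite /Q mdeg_madd mdeg_monv addn1 eqSS mwt_madd mwt_monv.
pose Yl i := low k.+2 (Y i); pose Gl i := low k.+2 (G i).
pose Yk i := hpart k.+2 (Y i); pose Gk i := hpart k.+2 (G i).
pose RY i := Y i - (Yl i + Yk i); pose RG i := G i - (Gl i + Gk i).
pose Y1 i := Yl i - linvf B i; pose G1 i := Gl i - linvf M i.
have XE : fderiv j X = lie_form1 (linvf B) Gk j + lie_form1 Yk (linvf M) j.
  rewrite (lie_hamiltonian_linvf _ dh).
  have -> : Gk = fun i => fderiv i S by apply: funext => i; rewrite dS.
  by rewrite lie_linvf_exact -raddfD /X; congr fderiv; ring.
have vYl' i : vanish 2 (Y1 i).
  have -> : Y1 i = (Y i - linvf B i) - (Y i - low k.+2 (Y i)) by rewrite /Y1 /Yl; ring.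
  by apply: vanishB => //; apply: vanish_le (vanish_low _).
have vGl' i : vanish 2 (G1 i).
  have -> : G1 i = (G i - linvf M i) - (G i - low k.+2 (G i)) by rewrite /G1 /Gl; ring.
  by apply: vanishB => //; apply: vanish_le (vanish_low _).
have vYl i : vanish 1 (Yl i).
  by rewrite -(subrK (linvf B i) (Yl i)); apply: vanishD (vanish_linvf _ _); apply: vanish_le (vYl' i).
have vG i : vanish 1 (G i).
  by rewrite -(subrK (linvf M i) (G i)); apply: vanishD (vanish_linvf _ _); apply: vanish_le (h1 i).
have vYk i : vanish k.+2 (Yk i) by apply: vanish_hpart.
have vGk i : vanish k.+2 (Gk i) by apply: vanish_hpart.
have vRY i : vanish k.+3 (RY i) by apply: vanish_low_hpart.
have vRG i : vanish k.+3 (RG i) by apply: vanish_low_hpart.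
have YE : Y = fun i => Yl i + Yk i + RY i by apply: funext => i; rewrite /RY; ring.
have GE : G = fun i => Gl i + Gk i + RG i by apply: funext => i; rewrite /RG; ring.
have YlE : Yl = fun i => linvf B i + Y1 i by apply: funext => i; rewrite /Y1; ring.
have GlE : Gl = fun i => linvf M i + G1 i by apply: funext => i; rewrite /G1; ring.
have E1 : lie_form1 Y G j = lie_form1 (fun i => Yl i + Yk i) G j + lie_form1 RY G j.
  by rewrite {1}YE lie_form1Dl.
have E2 : lie_form1 (fun i => Yl i + Yk i) G j = lie_form1 (fun i => Yl i + Yk i) (fun i => Gl i + Gk i) j
   + lie_form1 (fun i => Yl i + Yk i) RG j by rewrite {1}GE lie_form1Dr.
have E3 : lie_form1 (fun i => Yl i + Yk i) (fun i => Gl i + Gk i) j =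
  lie_form1 Yl Gl j + lie_form1 Yl Gk j + (lie_form1 Yk Gl j + lie_form1 Yk Gk j).
  by rewrite lie_form1Dl !lie_form1Dr.
have E4 : lie_form1 Yl Gk j = lie_form1 (linvf B) Gk j + lie_form1 Y1 Gk j by rewrite YlE lie_form1Dl.
have E5 : lie_form1 Yk Gl j = lie_form1 Yk (linvf M) j + lie_form1 Yk G1 j by rewrite GlE lie_form1Dr.
(* Every summand here has order at least [k.+3]. *)
pose rem := lie_form1 RY G j + lie_form1 (fun i => Yl i + Yk i) RG j + lie_form1 Y1 Gk j
  + lie_form1 Yk G1 j + lie_form1 Yk Gk j.
have -> : fderiv j X = - lie_form1 Yl Gl j - rem.
  rewrite XE; apply/eqP; rewrite -subr_eq0 -[X in _ == X](h5 j) E1 E2 E3 E4 E5 /rem; apply/eqP; ring.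
have vrem : vanish k.+3 rem.
  rewrite /rem; apply: vanishD; [apply: vanishD; [apply: vanishD; [apply: vanishD|]|]|].
  - by rewrite -[k.+3]addn0; apply: lie_form1_vanish.
  - rewrite -[k.+3]add1n; apply: lie_form1_vanish => // i; apply: vanishD => //.
    exact: vanish_le (vYk i).
  - by rewrite -[k.+3]add2n; apply: lie_form1_vanish.
  - by rewrite -[k.+3]addn1; apply: lie_form1_vanish.
  - rewrite -[k.+3]addn1; apply: lie_form1_vanish => // i; exact: vanish_le (vGk i).
have : supp_in (fun a => mwt w a + w j == e) (lie_form1 Yl Gl j) by apply: lie_supp.
move=> hs; apply: fps_ext => a; rewrite /pr; case: ifP => // /andP [/eqP ha ne].
rewrite fps_subE fps_oppE vrem ?ha // subr0.
by apply/eqP; rewrite oppr_eq0; apply: contraNT ne => /hs.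
Qed.

(** A single Hamiltonian field removes the nonresonant terms of degree [k.+2] from the form and from
    the field. It changes the form by a differential at that order, so closedness is kept. *)
Lemma step_resonant k G Y : normal_upto k.+2 G Y -> closed_upto k.+2 G ->
  exists phi, (forall i, vanish k.+2 (phi i - fpsX C i)) /\ exists G' Y',
    [/\ transf phi G Y G' Y', normal_upto k.+3 G' Y', closed_upto k.+2 G',
     forall i, vanish k.+2 (G' i - G i) & forall i, vanish k.+2 (Y' i - Y i)].
Proof.
move=> hn hc; have [h1 h2 h3 h4 h5] := hn.
have vY i : vanish 1 (Y i).
  by rewrite -(subrK (linvf B i) (Y i)); apply: vanishD (vanish_linvf _ _); apply: vanish_le (h2 i).
have [S S0 dS] : exists2 S, cst S = 0 & forall j, fderiv j S = hpart k.+2 (G j).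
  apply: poincare => i j; rewrite -!hpart_fderiv; apply/eqP; rewrite -subr_eq0 -raddfB /=.
  rewrite -[X in hpart _ X](subrK (fpsC d (J i j))) raddfD /=.
  rewrite [X in X + _](hpart_vanish (hc i j)) add0r; apply/eqP/fps_ext => a.
  by rewrite /hpart /pr; case: eqP => // ha; rewrite /fpsC -mdeg_eq0 ha.
have hS : supp_in (fun a => mdeg a == k.+3) S.
  by apply: supp_fderiv_deg => // j; rewrite dS; apply: supp_pr.
(* With [d G] equal to [J] to the order at hand, Cartan's formula makes minus the contraction of [G]
   with [Y] a Hamiltonian of [Y]. *)
pose h := - hpart k.+3 (\sum_l Y l * G l).
have dh j : flat (fun i => hpart k.+2 (Y i)) j = fderiv j h.
  rewrite -hpart_flat /h raddfN /= -hpart_fderiv.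
  apply/eqP; rewrite -subr_eq0 opprK -raddfD /=; apply/eqP/hpart_vanish.
  set s := \sum_l Y l * G l.
  have -> : flat Y j + fderiv j s = \sum_l - (Y l * (fderiv l (G j) - fderiv j (G l) - fpsC d (J l j))).
    have -> : flat Y j + fderiv j s = flat Y j - \sum_l Y l * (fderiv l (G j) - fderiv j (G l)).
      by have /eqP := h5 j; rewrite lie_cartan -/s addr_eq0 => /eqP ->.
    rewrite -sumrN -big_split.
    by apply: eq_bigr => l _ /=; ring.
  apply: vanish_sum => l _; apply: vanishN; rewrite -[k.+3]add1n; exact: vanishM (vY l) (hc l j).
pose Q (a : mon d) := (mdeg a == k.+3) && (mwt w a != e).
have [t ht] := generic_time k.+3.
pose T := Z + t *: B; pose u i := (w i).1 + t * (w i).2.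
have linT f : linop T f = linop Z f + fpsC d t * linop B f by rewrite linop_add linop_scale.
have Tgr l m : (T - \matrix_(i, j) (u i *+ (i == j))) l m != 0 -> w l = w m.
  rewrite !mxE; have [->//|lm] := eqVneq l m; rewrite mulr0n subr0 => nz.
  have [Z0|/Zgr //] := eqVneq (Z l m) 0; apply: Bgr; apply: contraNneq nz => ->.
  by rewrite Z0 mulr0 addr0.
have Qgr (D : 'M[C]_d) l m a : (D l m != 0 -> w l = w m) -> D l m != 0 ->
    Q (madd a (monv d m)) = Q (madd a (monv d l)).
  by move=> hD /hD E; rewrite /Q !mdeg_madd !mdeg_monv !mwt_madd !mwt_monv E.
have Qdeg a : Q a -> (mdeg a <= k.+3)%N by move=> /andP [/eqP ->].
have Qu a : Q a -> mwt u a != 1 by move=> /andP [/eqP ha ne]; apply: ht.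
have Tu l m : (T - \matrix_(i, j) (u i *+ (i == j))) l m != 0 -> u l = u m.
  by move=> /Tgr E; rewrite /u E.
have TQ l m a : (T - \matrix_(i, j) (u i *+ (i == j))) l m != 0 ->
    Q (madd a (monv d m)) = Q (madd a (monv d l)).
  by apply: Qgr; apply: Tgr.
(* [F] is chosen to kill only the combination [S + t h]; the separate vanishing of both functions
   then follows from [resonance_relation]. *)
pose g := - pr Q (S + fpsC d t * h).
have gQ : supp_in Q g by apply/supp_inN/supp_pr.
have [F FQ FE] := linop_solve (nilp t) Tu TQ Qdeg Qu gQ.
have Fdeg : supp_in (fun a => mdeg a == k.+3) F by move=> a /FQ /andP [].
pose V := sharp (fun j => fderiv j F).
have dV j : flat V j = fderiv j F by rewrite /V sharpK.
have hV i : vanish k.+2 (V i) by apply: vanish_sharp => j; apply/vanish_fderiv/vanish_of_supp.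
pose phi i := fpsX C i + V i.
have hnear : near_id phi by exact: perturb_near_id.
have hp i : vanish k.+2 (phi i - fpsX C i) by rewrite /phi addrAC subrr add0r.
exists phi; split=> //.
have [G' [Y' ht']] := transf_ex G Y (chart_near_id hnear); exists G', Y'.
have gl := perturb_form_low hV h1 ht'; have yl := perturb_vf_low hV h2 ht'.
have G'E j : vanish k.+3 (G' j - (G j + fderiv j (linop Z F - F))).
  have := perturb_form hV h1 ht' j; rewrite -JE -/(flat V j) dV (contract_linvf dV).
  by congr vanish; rewrite raddfN raddfB /=; ring.
pose S2 := S + (linop Z F - F); pose h2' := h + linop B F.
have dS2 j : hpart k.+2 (G' j) = fderiv j S2.
  have := hpart_vanish (G'E j); rewrite raddfB raddfD /= hpart_fderiv.
  move/eqP; rewrite subr_eq0 => /eqP ->; rewrite -dS -raddfD /S2; congr fderiv; congr (_ + _).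
  by rewrite raddfB /= hpart_linop /hpart pr_id.
have dh2 j : flat (fun i => hpart k.+2 (Y' i)) j = fderiv j h2'.
  rewrite -hpart_flat.
  pose W i := linop B (V i) - \sum_l fpsC d (B i l) * V l.
  have -> : flat Y' j = flat Y j + flat W j + flat (fun i => Y' i - (Y i + linop B (V i) - \sum_l fpsC d (B i l) * V l)) j.
    by rewrite -!flatD; congr flat; apply: funext => i; rewrite /W; ring.
  rewrite !raddfD /= [X in _ + X]hpart_vanish ?addr0; last first.
    by apply: flat_vanish => i; apply: perturb_vf hV h2 ht' i.
  rewrite hpart_flat dh /W (bracket_hamiltonian dV) hpart_fderiv hpart_linop.
  by rewrite /hpart pr_id // raddfD.
have commB f : pr Q (linop B f) = linop B (pr Q f).
  by apply: pr_linop => l m a; apply: Qgr; apply: Bgr.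
have commZ f : pr Q (linop Z f) = linop Z (pr Q f).
  by apply: pr_linop => l m a; apply: Qgr; apply: Zgr.
have R1 : pr Q S2 = - (fpsC d t * pr Q h2').
  apply/eqP; rewrite -subr_eq0 opprK -prCM -raddfD /= /S2 /h2'.
  have -> : S + (linop Z F - F) + fpsC d t * (h + linop B F) =
     (S + fpsC d t * h) + (linop T F - F) by rewrite linT; ring.
  by rewrite raddfD /= FE (pr_id gQ) /g subrr.
have R2 : pr Q (linop B S2 - (linop Z h2' - h2')) = 0.
  have -> : linop B S2 - (linop Z h2' - h2') = linop B S - (linop Z h - h).
    by rewrite /S2 /h2' !linopD linopN linop_ZB; ring.
  exact: resonance_relation hn dS dh.
(* After substituting [- t h] for [S], the relation says that [h] is fixed by [linop T], and on
   these monomials [linop T] has no nonzero fixed vector. *)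
have eta0 : pr Q h2' = 0.
  apply: (linop_inj (nilp t) Tu TQ Qdeg Qu); first exact: supp_pr.
  move: R2; rewrite raddfB raddfB /= commB commZ R1 linopN linopCM => /eqP.
  rewrite subr_eq0 => /eqP E; rewrite -/T linT.
  by apply/eqP; rewrite -subr_eq0; apply/eqP; rewrite addrAC -E; ring.
have sig0 : pr Q S2 = 0 by rewrite R1 eta0 mulr0 oppr0.
have res f a j : pr Q f = 0 -> mdeg a = k.+2 -> fderiv j f a != 0 -> mwt w a + w j = e.
  move=> hf ha; rewrite fderivE mulf_eq0 negb_or => /andP [_ /(pr_eq0 hf)].
  by rewrite /Q mdeg_madd mdeg_monv addn1 ha eqxx mwt_madd mwt_monv /= negbK => /eqP.
split=> //; last first.
  move=> i j; have -> : fderiv i (G' j) - fderiv j (G' i) - fpsC d (J i j) =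
    (fderiv i (G j) - fderiv j (G i) - fpsC d (J i j))
    + fderiv i (G' j - (G j + fderiv j (linop Z F - F)))
    - fderiv j (G' i - (G i + fderiv i (linop Z F - F))).
    pose v := linop Z F - F; rewrite -/v; have cv := fderiv_comm i j v; clearbody v.
    by rewrite !raddfB /= !raddfD /= cv; ring.
  by apply: vanishB; [apply: vanishD => //|]; apply: vanish_fderiv.
split.
- move=> i; rewrite -[G' i](subrK (G i)) -addrA; apply: vanishD => //.
  by apply: vanish_le (gl i).
- move=> i; rewrite -[Y' i](subrK (Y i)) -addrA; apply: vanishD => //.
  by apply: vanish_le (yl i).
- move=> i a; rewrite {1}/low {1}/pr; case: ifP => [ha fa|]; last by rewrite eqxx.
  move: ha; rewrite ltnS leq_eqVlt => /orP [/eqP ha|ha].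
    apply/eqP; apply: (res _ _ _ sig0 ha); rewrite -dS2 /hpart /pr ha eqxx //.
  by apply: (supp_low (supp_low_ext (gl i) (h3 i))).
- move=> i a; rewrite {1}/low {1}/pr; case: ifP => [ha fa|]; last by rewrite eqxx.
  move: ha; rewrite ltnS leq_eqVlt => /orP [/eqP ha|ha]; last first.
    by apply: (supp_low (supp_low_ext (yl i) (h4 i))).
  have YE : hpart k.+2 (Y' i) = sharp (fun j => fderiv j h2') i.
    by rewrite -(flatK (fun i => hpart k.+2 (Y' i))) /sharp; apply: eq_bigr => j _; rewrite dh2.
  have : hpart k.+2 (Y' i) a != 0 by rewrite /hpart /pr ha eqxx.
  rewrite YE /sharp; apply: contraNT => ne; rewrite fps_sumE big1 // => j _.
  rewrite mulrC mulCE; have [->|/Jigr hJ] := eqVneq (Ji j i) 0; first by rewrite mul0r.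
  have [->|/(res _ _ _ eta0 ha) hh] := eqVneq (fderiv j h2' a) 0; first by rewrite mulr0.
  by case/eqP: ne; apply: (addIr (w j)); rewrite hh addrC.
exact: lie_transf0 (chart_near_id hnear) ht' h5.
Qed.

(** The derivative of the chart costs one order, hence [n.+1] for the charts. *)
Lemma vanish_pull_congr n phi psi G G' k : based phi -> based psi ->
  (forall i, vanish n.+1 (phi i - psi i)) -> (forall i, vanish n (G i - G' i)) ->
  vanish n (pull phi G k - pull psi G' k).
Proof.
move=> b1 b2 h1 h2; rewrite /pull -sumrB; apply: vanish_sum => i _.
have -> : fpscomp (G i) phi * fderiv k (phi i) - fpscomp (G' i) psi * fderiv k (psi i) =
  (fpscomp (G i) phi - fpscomp (G i) psi) * fderiv k (phi i) +
  fpscomp (G i - G' i) psi * fderiv k (phi i) + fpscomp (G' i) psi * fderiv k (phi i - psi i).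
  by rewrite fpscompD fpscompN raddfB /=; ring.
apply: vanishD; first apply: vanishD.
- by apply: vanishMl; apply: (vanish_le (leqnSn n)); apply: vanish_comp_congr.
- by apply: vanishMl; apply: vanish_fpscomp.
- by apply: vanishMr; apply: vanish_fderiv.
Qed.

(** * The limit of the successive coordinate changes *)

Section Limit.
Variables G0 Y0 : 'I_d -> A.
Hypothesis hG0 : forall i, vanish 2 (G0 i - linvf M i).
Hypothesis hY0 : forall i, vanish 2 (Y0 i - linvf B i).
Hypothesis hL0 : forall j, lie_form1 Y0 G0 j = 0.

Let state := (('I_d -> A) * ('I_d -> A) * ('I_d -> A))%type.
(** Order 2 is reached by the linear parts alone; [maxn 2 m] makes stages 0 and 1 idle, so that
    stage [m] always agrees with its successor to order [m]. Closedness lags one order behind, being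
    a condition on derivatives. *)
Let Inv m (x : state) := [/\ near_id x.1.1, transf x.1.1 G0 Y0 x.1.2 x.2,
  normal_upto (maxn 2 m) x.1.2 x.2 & closed_upto (maxn 2 m).-1 x.1.2].
Let close m (x y : state) := [/\ forall i, vanish m (y.1.1 i - x.1.1 i),
  forall i, vanish m (y.1.2 i - x.1.2 i) & forall i, vanish m (y.2 i - x.2 i)].

Let inv0 : Inv 0 ((fun i => fpsX C i), G0, Y0).
Proof.
split=> /=; first by move=> i; rewrite subrr.
- exact: transf_id.
- exact: normal_upto2.
- move=> i j; apply/vanish1P; rewrite !cstD !cstN cstC.
  have lG (u v : 'I_d) : cst (fderiv u (G0 v)) = M v u.
    rewrite -[G0 v](subrK (linvf M v)) raddfD /= cstD fderiv_linvf cstC.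
    have /vanish1P -> : vanish 1 (fderiv u (G0 v - linvf M v)) by exact: vanish_fderiv.
    by rewrite add0r.
  by rewrite !lG JE !mxE subrr.
Qed.

Let comp_near phi psi k : near_id phi -> (forall i, vanish k.+2 (psi i - fpsX C i)) ->
  near_id (fun i => fpscomp (psi i) phi) /\ forall i, vanish k.+2 (fpscomp (psi i) phi - phi i).
Proof.
move=> h1 h2; have b1 := near_id_based h1.
have H i : vanish k.+2 (fpscomp (psi i) phi - phi i).
  by rewrite -[phi i in X in _ - X](fpscompX b1) -fpscompN -fpscompD; apply: vanish_fpscomp.
split=> // i; rewrite -[fpscomp (psi i) phi](subrK (phi i)) -addrA; apply: vanishD => //.
by apply: vanish_le (H i).
Qed.

Let next m x : exists y, Inv m x -> Inv m.+1 y /\ close m x y.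
Proof.
case: (pselect (Inv m x)) => [|h]; last by exists x.
case: x => [[phi G] Y] [/= hn ht hu hc]; case: (ltnP m 2) => hm.
  exists (phi, G, Y) => _; split; first by split=> //=; case: m hm hu hc => [|[|m]].
  by split=> i /=; rewrite subrr.
have [k km] : exists k, m = k.+2 by exists (m - 2)%N; lia.
have mE : maxn 2 m = k.+2 by rewrite km; lia.
rewrite mE /= in hu hc.
have [p1 [hp1 [G1 [Y1 [t1 n1 c1 g1 y1]]]]] := step_closed hu hc.
have [p2 [hp2 [G2 [Y2 [t2 n2 c2 g2 y2]]]]] := step_resonant n1 c1.
have hh1 : near_id p1 by move=> i; apply: vanish_le (hp1 i).
have hh2 : near_id p2 by move=> i; apply: vanish_le (hp2 i).
have [q1 q1'] := comp_near hn hp1.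
have [q2 q2'] := comp_near q1 hp2.
exists ((fun i => fpscomp (p2 i) (fun i => fpscomp (p1 i) phi)), G2, Y2) => _.
have mE' : maxn 2 m.+1 = k.+3 by rewrite km; lia.
split.
  split=> //=; rewrite ?mE' //.
  apply: transf_comp t2; try exact: near_id_based.
  by apply: transf_comp t1 => //; apply: near_id_based.
rewrite km; split=> i /=.
- rewrite -[X in vanish _ X](subrK (fpscomp (p1 i) phi)).
  have -> : fpscomp (p2 i) (fun i => fpscomp (p1 i) phi) - phi i - fpscomp (p1 i) phi + fpscomp (p1 i) phi =
   (fpscomp (p2 i) (fun i => fpscomp (p1 i) phi) - fpscomp (p1 i) phi) + (fpscomp (p1 i) phi - phi i) by ring.
  exact: vanishD (q2' i) (q1' i).
- by rewrite -[G2 i](subrK (G1 i)) -addrA; apply: vanishD.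
- by rewrite -[Y2 i](subrK (Y1 i)) -addrA; apply: vanishD.
Qed.

Lemma normalize : exists phi G Y, [/\ chart phi, transf phi G0 Y0 G Y,
   (forall i, vanish 2 (G i - linvf M i)) /\ (forall i, vanish 2 (Y i - linvf B i)),
   (forall i, supp_in (fun a => mwt w a + w i == e) (G i)) /\
   (forall i, supp_in (fun a => mwt w a == w i) (Y i)) &
   forall i j, fderiv i (G j) - fderiv j (G i) = fpsC d (J i j)].
Proof.
(* The invariant is a premise inside the existential, so that [choice] yields a step function
   defined on all states. *)
have /choice [nx hnx] : forall mx : nat * state, exists y, Inv mx.1 mx.2 -> Inv mx.1.+1 y /\ close mx.1 mx.2 y.
  by move=> [m x]; apply: next.
pose F := fix F m := if m is m'.+1 then nx (m', F m') else ((fun i => fpsX C i), G0, Y0).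
have FI m : Inv m (F m) by elim: m => [|m IH] /=; [exact: inv0 | exact: (hnx (m, F m) IH).1].
have Fc m : close m (F m) (F m.+1) by exact: (hnx (m, F m) (FI m)).2.
pose phi i := fpslim (fun m => (F m).1.1 i).
pose G i := fpslim (fun m => (F m).1.2 i).
pose Y i := fpslim (fun m => (F m).2 i).
have lphi m i : vanish m (phi i - (F m).1.1 i) by apply: vanish_fpslim => q; have [] := Fc q.
have lG m i : vanish m (G i - (F m).1.2 i) by apply: vanish_fpslim => q; have [] := Fc q.
have lY m i : vanish m (Y i - (F m).2 i) by apply: vanish_fpslim => q; have [] := Fc q.
have hn : near_id phi.
  move=> i; rewrite -[phi i](subrK ((F 2).1.1 i)) -addrA; apply: vanishD => //.
  by have [h _ _ _] := FI 2; apply: h.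
have bphi := near_id_based hn.
have bF m : based (F m).1.1 by have [h _ _ _] := FI m; apply: near_id_based.
exists phi, G, Y; split.
- exact: chart_near_id.
(* Each stage satisfies the relation exactly and agrees with the limit to growing order, so the
   relation passes to the limit; stage [n.+1] makes up for the order lost by a derivative. *)
- split=> [k|i]; apply/eqP; rewrite -subr_eq0; apply/eqP/vanish_all => n.
    have [_ [tG _] _ _] := FI n.+1; rewrite tG -opprB; apply: vanishN.
    apply: vanish_pull_congr => // i; exact: vanish_le (lG n.+1 i).
  have [_ [_ tY] _ _] := FI n.+1.
  have -> : vapply Y0 (phi i) - fpscomp (Y i) phi = vapply Y0 (phi i - (F n.+1).1.1 i)
    - (fpscomp (Y i) phi - fpscomp (Y i) (F n.+1).1.1) - fpscomp (Y i - (F n.+1).2 i) (F n.+1).1.1.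
    by rewrite vapplyB tY fpscompD fpscompN; ring.
  apply: vanishB; first apply: vanishB.
  + by rewrite vapplyE; apply: vanish_sum => l _; apply: vanishMr; apply: vanish_fderiv.
  + by apply: (vanish_le (leqnSn n)); apply: vanish_comp_congr bphi (bF _) (lphi n.+1).
  + by apply: (vanish_le (leqnSn n)); apply: (vanish_fpscomp (bF n.+1)); apply: lY.
- have [_ _ [h1 h2 _ _ _] _] := FI 2; split=> i.
    by rewrite -[G i](subrK ((F 2).1.2 i)) -addrA; apply: vanishD.
  by rewrite -[Y i](subrK ((F 2).2 i)) -addrA; apply: vanishD.
- split=> i a fa; have [_ _ [_ _ h3 h4 _] _] := FI (mdeg a).+1.
    have hs := supp_low_ext (lG (mdeg a).+1 i) (supp_low_le (leq_maxr _ _) (h3 i)).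
    exact: (supp_low hs (ltnSn _) fa).
  have hs := supp_low_ext (lY (mdeg a).+1 i) (supp_low_le (leq_maxr _ _) (h4 i)).
  exact: (supp_low hs (ltnSn _) fa).
- move=> i j; apply/eqP; rewrite -subr_eq0; apply/eqP/vanish_all => n.
  have [_ _ _ hc] := FI n.+2.
  have -> : fderiv i (G j) - fderiv j (G i) - fpsC d (J i j) =
    (fderiv i ((F n.+2).1.2 j) - fderiv j ((F n.+2).1.2 i) - fpsC d (J i j))
    + fderiv i (G j - (F n.+2).1.2 j) - fderiv j (G i - (F n.+2).1.2 i) by rewrite !raddfB /=; ring.
  apply: vanishB; first apply: vanishD.
  + by apply: vanish_le (hc i j); lia.
  + by apply: (vanish_le (leqnSn n)); apply: vanish_fderiv.
  + by apply: (vanish_le (leqnSn n)); apply: vanish_fderiv.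
Qed.

End Limit.

End Normalization.

(** * Jordan-Chevalley decomposition compatible with the symplectic form *)

Section JordanChevalley.
Variable C : numClosedFieldType.

Lemma dvdp_prod_coprime (s : seq C) K (q : {poly C}) : uniq s ->
  (forall a, a \in s -> ('X - a%:P) ^+ K %| q) -> \prod_(a <- s) ('X - a%:P) ^+ K %| q.
Proof.
elim: s => [|a s IH] /=; first by rewrite big_nil dvd1p.
move=> /andP [as_ us] h; rewrite big_cons Gauss_dvdp ?h ?mem_head ?IH //.
  by move=> b bs; apply: h; rewrite inE bs orbT.
rewrite coprimep_expl // coprimep_sym big_seq; elim/big_ind: _ => [|p1 p2 h1 h2|b bs].
- exact: coprime1p.
- by rewrite coprimepMl h1.
- by rewrite coprimep_expl // coprimep_XsubC2 // subr_eq0; apply: contraNneq as_ => ->.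
Qed.

Lemma poly_crt (s : seq C) K : uniq s ->
  exists p : {poly C}, forall a, a \in s -> ('X - a%:P) ^+ K %| p - a%:P.
Proof.
elim: s => [|a s IH] /=; first by exists 0.
move=> /andP [as_ us]; have [p hp] := IH us.
pose m := \prod_(b <- s) ('X - b%:P) ^+ K : {poly C}.
have co : coprimep m (('X - a%:P) ^+ K).
  rewrite coprimep_expr // /m big_seq; elim/big_ind: _ => [|p1 p2 h1 h2|b bs].
  - exact: coprime1p.
  - by rewrite coprimepMl h1.
  - by rewrite coprimep_expl // coprimep_XsubC2 // subr_eq0; apply: contraNneq as_ => ->.
have [[u v] /= uv] := Bezout_eq1_coprimepP _ _ co.
exists (p + (a%:P - p) * (u * m)) => b; rewrite inE => /orP [/eqP ->|bs].
  have -> : p + (a%:P - p) * (u * m) - a%:P = (p - a%:P) * (v * ('X - a%:P) ^+ K).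
    have -> : v * ('X - a%:P) ^+ K = 1 - u * m by apply/eqP; rewrite -uv; apply/eqP; ring.
    ring.
  by rewrite mulrA dvdp_mulIr.
have -> : p + (a%:P - p) * (u * m) - b%:P = (p - b%:P) + (a%:P - p) * u * m by ring.
rewrite dvdp_add ?hp // dvdp_mull // /m (big_rem b) //= dvdp_mulIl //.
Qed.

Variable d : nat.
Implicit Types (A Z J D : 'M[C]_d.+1).

(** Every root gets the exponent [d.+1], which bounds its multiplicity, so that Cayley-Hamilton
    applies without keeping track of multiplicities. *)
Lemma annihilating_roots A : exists (s : seq C),
  forall q : {poly C}, (forall a, a \in s -> ('X - a%:P) ^+ d.+1 %| q) -> horner_mx A q = 0.
Proof.
have [r hr] := closed_field_poly_normal (char_poly A); exists (undup r) => q hq.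
have /dvdpP [v ->] : char_poly A %| q.
  rewrite hr (monicP (char_poly_monic A)) scale1r.
  have sz : (size r).-1.+1 = (size r).-1.+1 by [].
  apply: dvdp_trans (dvdp_prod_coprime (undup_uniq r) hq).
  have szr : size r = d.+1.
    have := size_char_poly A; rewrite hr (monicP (char_poly_monic A)) scale1r size_prod_XsubC.
    by case.
  rewrite -prodr_undup_exp_count; elim: (undup r) => [|a t IH]; first by rewrite !big_nil.
  rewrite !big_cons dvdp_mul // dvdp_exp2l //.
  by rewrite -szr count_size.
by rewrite rmorphM /= Cayley_Hamilton mulr0.
Qed.

Lemma horner_mx_twist Z Z' J p : Z^T *m J = J *m Z' ->
  (horner_mx Z p)^T *m J = J *m horner_mx Z' p.
Proof.
move=> h; elim/poly_ind: p => [|p c IH]; first by rewrite !rmorph0 trmx0 mul0mx mulmx0.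
rewrite !rmorphD !rmorphM /= !horner_mx_X !horner_mx_C linearD /= tr_scalar_mx mulmxDl mulmxDr.
rewrite scalar_mxC; congr (_ + _).
by rewrite -!mulmxE trmx_mul -mulmxA IH mulmxA h -!mulmxA; congr (_ *m _); rewrite !mulmxE -{1}(horner_mx_X Z') -rmorphM mulrC rmorphM /= horner_mx_X.
Qed.

Lemma horner_mx_comp Z (p q : {poly C}) : horner_mx Z (p \Po q) = horner_mx (horner_mx Z q) p.
Proof.
elim/poly_ind: p => [|p c IH]; first by rewrite comp_poly0 !rmorph0.
by rewrite comp_poly_MXaddC !rmorphD !rmorphM /= IH horner_mx_X !horner_mx_C.
Qed.

(* The same polynomial gives the semisimple parts of Z and c - Z, provided its
   nodes are stable under a |-> c - a. *)
Lemma jordan_chevalley_twisted Z J (c : C) : Z^T *m J = J *m (c%:M - Z) ->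
  exists p : {poly C}, let D := horner_mx Z p in
  [/\ diagonalizable D, exists k, (Z - D) ^+ k = 0 & D^T *m J = J *m (c%:M - D)].
Proof.
move=> h; have [s0 hs0] := annihilating_roots Z.
pose s := undup (s0 ++ map (fun a => c - a) s0).
have su : uniq s by apply: undup_uniq.
have hs q : (forall a, a \in s -> ('X - a%:P) ^+ d.+1 %| q) -> horner_mx Z q = 0.
  by move=> hq; apply: hs0 => a ha; apply: hq; rewrite mem_undup mem_cat ha.
have sc a : a \in s -> c - a \in s.
  rewrite !mem_undup !mem_cat => /orP [ha|/mapP [b hb ->]].
    by rewrite (map_f (fun a => c - a) ha) orbT.
  by rewrite opprB addrC subrK hb.
have [p hp] := poly_crt d.+1 su; exists p; split.
(* The product of the [p - a] over the distinct nodes annihilates [Z]: at each node one factor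
   already supplies the full power. *)
- apply/diagonalizableP; exists s => //; apply: mxminpoly_min.
  rewrite rmorph_prod /=; under eq_bigr do rewrite rmorphB /= horner_mx_X horner_mx_C.
  under eq_bigr => a _ do rewrite -(horner_mx_C Z) -rmorphB.
  rewrite -rmorph_prod; apply: hs => a ha; rewrite (big_rem a) //= dvdp_mulr //; exact: hp.
- exists d.+1; rewrite -{1}(horner_mx_X Z) -rmorphB -rmorphXn; apply: hs => a ha.
  apply: dvdp_exp2r; have -> : 'X - p = ('X - a%:P) - (p - a%:P) by ring.
  by rewrite dvdp_sub //; apply: dvdp_trans (hp _ ha); rewrite exprS dvdp_mulIl.
- rewrite (horner_mx_twist _ h); congr (_ *m _).
  have -> : c%:M - Z = horner_mx Z (c%:P - 'X) by rewrite rmorphB /= horner_mx_X horner_mx_C.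
  rewrite -horner_mx_comp; apply/eqP; rewrite -subr_eq0 -(horner_mx_C Z c) -!rmorphB; apply/eqP/hs.
  (* At the node [a], the polynomial [p] evaluated at [c - X] takes the value prescribed for [p] at
     [c - a], which is [c - a]; so does [c - p]. Hence both agree to order [d.+1] there. *)
  move=> a ha; have -> : p \Po (c%:P - 'X) - (c%:P - p) =
     ((p - (c - a)%:P) \Po (c%:P - 'X)) + (p - a%:P) by rewrite comp_polyB comp_polyC polyCB; ring.
  rewrite dvdp_add ?hp //; have := dvdp_comp_poly (c%:P - 'X) (hp _ (sc _ ha)).
  apply: dvdp_trans; rewrite rmorphXn /= comp_polyB comp_polyX comp_polyC.
  have -> : c%:P - 'X - (c - a)%:P = - ('X - a%:P) by rewrite polyCB; ring.
  by rewrite exprNn dvdp_mulIr.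
Qed.

End JordanChevalley.

Lemma nilpotent_add (R : nzRingType) (x y : R) a b : GRing.comm x y -> x ^+ a = 0 -> y ^+ b = 0 ->
  (x + y) ^+ (a + b) = 0.
Proof.
move=> cxy xa yb; rewrite exprDn_comm // big1 // => i _.
have [h|h] := leqP b i.
  by rewrite -[nat_of_ord i](subnK h) exprD yb !mulr0 mul0rn.
have -> : (a + b - i = (b - i) + a)%N by have := ltn_ord i; lia.
by rewrite exprD xa mulr0 mul0r mul0rn.
Qed.

(** * Common eigencoordinates of the two linear parts *)

Section EigenCoordinates.
Variables (C : numClosedFieldType) (d : nat).
Implicit Types (A Z B J D W : 'M[C]_d.+1).

Lemma conj_exp W A k : W \in unitmx -> (W *m A *m invmx W) ^+ k = W *m (A ^+ k) *m invmx W.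
Proof.
move=> hW; elim: k => [|k IH]; first by rewrite !expr0 mulmx1 mulmxV.
by rewrite !exprS IH -!mulmxE !mulmxA mulmxKV.
Qed.

(** The semisimple parts are polynomials in the commuting matrices [Z] and [B], so one [W]
    diagonalizes both; the adjoint relations they inherit from [hZ] and [hB] turn into the pairing
    rule for [w]. *)
Lemma eigen_coordinates Z B J : Z^T *m J = J *m (1%:M - Z) -> B^T *m J = J *m (0%:M - B) ->
  Z *m B = B *m Z ->
  exists W (w : 'I_d.+1 -> C * C), let Z' := W *m Z *m invmx W in let B' := W *m B *m invmx W in
    let J' := (invmx W)^T *m J *m invmx W in
  [/\ W \in unitmx,
      (forall i j, Z' i j != 0 -> w i = w j) /\ (forall i j, B' i j != 0 -> w i = w j),
      forall i j, J' i j != 0 -> w i + w j = (1, 0),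
      forall t, exists k, (Z' + t *: B' - \matrix_(i, j) (((w i).1 + t * (w i).2) *+ (i == j))) ^+ k = 0
    & exists k, (B' - \matrix_(i, j) ((w i).2 *+ (i == j))) ^+ k = 0].
Proof.
move=> hZ hB ZB; have [p [/= dp [k1 np] tp]] := jordan_chevalley_twisted hZ.
have [q [/= dq [k2 nq] tq]] := jordan_chevalley_twisted hB.
set D1 := horner_mx Z p in dp np tp; set D2 := horner_mx B q in dq nq tq.
have cZB : comm_mx Z B by [].
have cZD2 : Z *m D2 = D2 *m Z by apply: comm_mx_horner.
have cD1 (X : 'M_d.+1) : Z *m X = X *m Z -> D1 *m X = X *m D1.
  by move=> h; apply/esym; apply: comm_mx_horner.
have cZD1 : Z *m D1 = D1 *m Z by apply: comm_mx_horner.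
have cBD2 : B *m D2 = D2 *m B by apply: comm_mx_horner.
have [] := (codiagonalizableP [:: D1; D2]).1.
  split=> [X Y|X]; rewrite !inE; last by move=> /orP [] /eqP ->.
  by move=> /orP [] /eqP -> /orP [] /eqP -> //; [apply: cD1 | apply/esym/cD1].
move=> W hW /= /andP [/diagonalizable_forPex [u /(simmxP hW) hu] /andP [/diagonalizable_forPex [v /(simmxP hW) hv] _]].
have {}hu : W *m D1 *m invmx W = diag_mx u by rewrite hu mulmxK.
have {}hv : W *m D2 *m invmx W = diag_mx v by rewrite hv mulmxK.
exists W, (fun i => (u 0 i, v 0 i)) => /=.
set Z' := W *m Z *m _; set B' := W *m B *m _; set J' := _ *m J *m _.
have cj X Y : X *m Y = Y *m X -> (W *m X *m invmx W) *m (W *m Y *m invmx W) = (W *m Y *m invmx W) *m (W *m X *m invmx W).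
  by move=> h; rewrite !mulmxA !mulmxKV // -![W *m _ *m _]mulmxA h.
(* A matrix commuting with a diagonal one links only indices with equal eigenvalues. *)
have graded (x : 'rV[C]_d.+1) (X : 'M[C]_d.+1) i j : X *m diag_mx x = diag_mx x *m X -> X i j != 0 -> x 0 i = x 0 j.
  move=> /matrixP /(_ i j); rewrite mul_mx_diag mul_diag_mx !mxE mulrC => /eqP.
  rewrite -subr_eq0 -mulrBl mulf_eq0 => /orP [|/eqP -> /eqP //].
  by rewrite subr_eq0 => /eqP.
have g1 i j : Z' i j != 0 -> (u 0 i, v 0 i) = (u 0 j, v 0 j).
  by move=> h; rewrite (graded u Z' i j _ h) ?(graded v Z' i j _ h) // -?hu -?hv cj.
have g2 i j : B' i j != 0 -> (u 0 i, v 0 i) = (u 0 j, v 0 j).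
  move=> h; rewrite (graded u B' i j _ h) ?(graded v B' i j _ h) // -?hu -?hv cj //.
  by apply/esym/cD1.
have tw (D : 'M_d.+1) (x : 'rV[C]_d.+1) (c : C) i j : D^T *m J = J *m (c%:M - D) -> W *m D *m invmx W = diag_mx x ->
    J' i j != 0 -> x 0 i + x 0 j = c.
  move=> hD hx nz.
  have e1 : (c%:M - D) *m invmx W = invmx W *m (c%:M - W *m D *m invmx W).
    by rewrite mulmxBl mulmxBr scalar_mxC !mulmxA mulVmx // mul1mx.
  have E : (W *m D *m invmx W)^T *m J' = J' *m (c%:M - W *m D *m invmx W).
    rewrite /J' -[RHS]mulmxA -e1 !trmx_mul !mulmxA.
    rewrite -[_ *m W^T *m (invmx W)^T]mulmxA -(trmx_mul (invmx W) W) mulVmx // trmx1 mulmx1.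
    by rewrite -[_ *m D^T *m J]mulmxA hD !mulmxA.
  rewrite hx tr_diag_mx in E.
  move: nz E; generalize J' => J2 nz E.
  have /matrixP /(_ i j) := E; rewrite mul_diag_mx mulmxBr mul_mx_diag mul_mx_scalar !mxE.
  move=> /eqP; rewrite -subr_eq0.
  have -> : x 0 i * J2 i j - (c * J2 i j - J2 i j * x 0 j) = (x 0 i + x 0 j - c) * J2 i j by ring.
  by rewrite mulf_eq0 (negbTE nz) orbF subr_eq0 => /eqP.
have mdiag (x : 'rV[C]_d.+1) : \matrix_(i, j) (x 0 i *+ (i == j)) = diag_mx x.
  by apply/matrixP => i j; rewrite !mxE.
split=> //.
- by move=> i j h; congr pair; [apply: tw tp hu h | apply: tw tq hv h].
- move=> t; exists (k1 + k2)%N.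
  have -> : \matrix_(i, j) ((u 0 i + t * v 0 i) *+ (i == j)) = diag_mx u + t *: diag_mx v.
    by apply/matrixP => i j; rewrite !mxE mulrnDl mulrnAr.
  have -> : Z' + t *: B' - (diag_mx u + t *: diag_mx v) = W *m ((Z - D1) + t *: (B - D2)) *m invmx W.
    rewrite -hu -hv /Z' /B' !(mulmxBr, mulmxDr, mulmxDl, mulmxBl, scalerBr, mulmxN, mulNmx) -!scalemxAr -!scalemxAl.
    by rewrite opprD addrACA.
  rewrite conj_exp // nilpotent_add ?mulmx0 ?mul0mx //.
    rewrite /GRing.comm -!scalerAl -!scalerAr; congr (_ *: _).
    have : GRing.comm (Z - D1) (B - D2).
      apply: commrB; apply: commr_sym; apply: commrB; rewrite /GRing.comm -!mulmxE //.
      - by rewrite (cD1 _ ZB).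
      - by rewrite (cD1 _ cZD2).
    by [].
  by rewrite exprZn nq scaler0.
- exists k2; rewrite (mdiag v) -hv /B' -mulmxBl -mulmxBr conj_exp // nq.
  by rewrite mulmx0 mul0mx.
Qed.

End EigenCoordinates.

(** * Normal form of a nilpotent infinitesimally symplectic operator *)

Section SymplecticBlocks.
Variables (C : numClosedFieldType) (d : nat).
Variables (J N : 'M[C]_d) (lam : 'I_d -> C).
Implicit Types (u v x y z : 'rV[C]_d).
Hypothesis Junit : J \in unitmx.
Hypothesis Jskew : J^T = - J.
Hypothesis NJ : N *m J = - (J *m N^T).
Hypothesis Nnil : exists k, N ^+ k = 0.
Hypothesis Jgr : forall i j, J i j != 0 -> lam i + lam j = 1.
Hypothesis Ngr : forall i j, N i j != 0 -> lam i = lam j.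

Definition om u v : C := (u *m J *m v^T) 0 0.
(** Symmetric, because [N] is skew for [om]; in a Darboux basis it becomes the Hessian of the
    quadratic part Q. *)
Definition be u v := om (u *m N) v.
Definition homv (c : C) u := forall j, u 0 j != 0 -> lam j = c.

Lemma omDl u v x : om (u + v) x = om u x + om v x.
Proof. by rewrite /om !mulmxDl mxE. Qed.
Lemma omDr u v x : om x (u + v) = om x u + om x v.
Proof. by rewrite /om linearD mulmxDr mxE. Qed.
Lemma omZl a u v : om (a *: u) v = a * om u v.
Proof. by rewrite /om -!scalemxAl mxE. Qed.
Lemma omZr a u v : om u (a *: v) = a * om u v.
Proof. by rewrite /om linearZ -scalemxAr mxE. Qed.
Lemma om_skew u v : om v u = - om u v.
Proof.
rewrite /om; have -> : u *m J *m v^T = - (v *m J *m u^T)^T.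
  by rewrite !trmx_mul trmxK Jskew mulNmx mulmxN opprK mulmxA.
by rewrite [in RHS]mxE opprK [in RHS]mxE.
Qed.
Lemma om0l v : om 0 v = 0. Proof. by rewrite -(scale0r (0 : 'rV_d)) omZl mul0r. Qed.
Lemma om_adj u v : om (u *m N) v = - om u (v *m N).
Proof.
by rewrite /om trmx_mul -[u *m N *m J]mulmxA NJ mulmxN mulNmx mxE !mulmxA.
Qed.

Definition act u k := u *m N ^+ k.
Lemma act0 u : act u 0 = u. Proof. by rewrite /act expr0 mulmx1. Qed.
Lemma actS u k : act u k *m N = act u k.+1.
Proof. by rewrite /act exprSr -mulmxE mulmxA. Qed.
Lemma actA u a b : act (act u a) b = act u (a + b).
Proof. by rewrite /act exprD -mulmxE mulmxA. Qed.
Lemma actD u v k : act (u + v) k = act u k + act v k.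
Proof. by rewrite /act mulmxDl. Qed.
Lemma actZ a u k : act (a *: u) k = a *: act u k.
Proof. by rewrite /act scalemxAl. Qed.
Lemma act_big u k l : act u k = 0 -> (k <= l)%N -> act u l = 0.
Proof. by move=> h /subnKC <-; rewrite -actA h /act mul0mx. Qed.
Lemma om_act u v k : om (act u k) v = (-1) ^+ k * om u (act v k).
Proof.
elim: k u v => [|k IH] u v; first by rewrite !act0 expr0 mul1r.
by rewrite -actS om_adj IH exprS mulN1r mulNr -{1}[v *m N]/(v *m N) /act -mulmxA [in RHS]exprS -mulmxE.
Qed.
Lemma om_act2 u v a b : om (act u a) (act v b) = (-1) ^+ b * om (act u (a + b)) v.
Proof. by rewrite -actA [in RHS]om_act mulrA -exprMn mulrNN mulr1 expr1n mul1r. Qed.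
Lemma om_act_swap u v k : om (act v k) u = - (-1) ^+ k * om (act u k) v.
Proof. by rewrite om_skew (om_act u) mulrA mulNr -exprMn mulrNN mulr1 expr1n mulN1r. Qed.
Lemma be_sym u v : be v u = be u v.
Proof. by rewrite /be om_adj om_skew opprK. Qed.

Lemma homv_act c u k : homv c u -> homv c (act u k).
Proof.
move=> h; elim: k => [|k IH]; first by rewrite act0.
rewrite -actS => j; rewrite mxE => nz.
have /existsP [l] : [exists l, act u k 0 l * N l j != 0].
  apply: contraNT nz; rewrite negb_exists => /forallP h0; rewrite big1 // => l _.
  by apply/eqP; rewrite -[_ == _]negbK h0.
by rewrite mulf_eq0 negb_or => /andP [/IH h1 /Ngr <-].
Qed.
Lemma homvD c u v : homv c u -> homv c v -> homv c (u + v).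
Proof.
move=> hu hv j; rewrite mxE; have [->|/hu //] := eqVneq (u 0 j) 0.
by rewrite add0r => /hv.
Qed.
Lemma homvZ c a u : homv c u -> homv c (a *: u).
Proof. by move=> hu j; rewrite mxE mulf_eq0 negb_or => /andP [_ /hu]. Qed.

Lemma om_hom0 c c' u v : homv c u -> homv c' v -> c + c' != 1 -> om u v = 0.
Proof.
move=> hu hv ne; rewrite /om mxE big1 // => l _; rewrite !mxE mulr_suml big1 // => k _.
have [->|/hu hk] := eqVneq (u 0 k) 0; first by rewrite !mul0r.
have [->|/hv hl] := eqVneq (v 0 l) 0; first by rewrite mulr0.
have [->|/Jgr hJ] := eqVneq (J k l) 0; first by rewrite mulr0 mul0r.
by rewrite -hk -hl hJ eqxx in ne.
Qed.

Lemma om_nondeg u : u != 0 -> exists v, om u v != 0.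
Proof.
move=> nz; have : u *m J != 0.
  by apply: contraNneq nz => h; rewrite -[u](mulmxK Junit) h mul0mx.
move=> /rV0Pn [j hj]; exists (delta_mx 0 j).
by rewrite /om trmx_delta -colE mxE.
Qed.

Definition omst (s1 s2 : bool) : C := match s1, s2 with false, true => 1 | true, false => -1 | _, _ => 0 end.
(* Hessian, in the symplectic basis, of the quadratic form Q_s of a block [a, b): the
   Booleans select the e half (first n coordinates) or the f half (last n).  The kind [kd]
   is 1 for \sum x_(j+1) x_(n+j), 2 for 2 \sum x_j x_(n+j+1), and 3 for the latter plus
   (-1)^(b-a) x_(b-1)^2. *)
Definition Hef (kd a b i j : nat) : C :=
  if [&& (a <= i)%N, (i < b)%N, (a <= j)%N & (j < b)%N] then
    (if kd == 1%N then (i == j.+1)%:R else 2 * (j == i.+1)%:R) else 0.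
Definition Hee (kd a b i j : nat) : C :=
  if [&& kd == 3%N, i == j, i == b.-1, (a <= i)%N & (i < b)%N] then 2 * (-1) ^+ (b - a) else 0.
Definition Hb kd a b (s1 s2 : bool) i j : C := match s1, s2 with
  false, true => Hef kd a b i j | true, false => Hef kd a b j i
  | false, false => Hee kd a b i j | true, true => 0 end.
(** For [l = 1], kinds 1 and 2 have an empty sum and stand for the zero form, and kind 3 stands for
    minus a square. *)
Definition kind_ok (c : C) (l kd : nat) : Prop :=
  if c != 2^-1 then kd = 1%N else kd = 3%N \/ kd = 2%N /\ odd l.

(** * One block inside an invariant symplectic subspace *)

Section Subspace.
(** The subspace is the row space of a projector: [PJ] makes image and kernel orthogonal, so the
    image is symplectic, [PN] makes it [N]-stable, and [Pgr] makes it graded. *)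
Variable P : 'M[C]_d.
Hypothesis PP : P *m P = P.
Hypothesis PN : P *m N = N *m P.
Hypothesis PJ : P *m J = J *m P^T.
Hypothesis Pgr : forall i j, P i j != 0 -> lam i = lam j.

Definition inP u := u *m P = u.
Lemma inP_act u k : inP u -> inP (act u k).
Proof.
move=> h; elim: k => [|k IH]; first by rewrite act0.
by rewrite -actS /inP -mulmxA -PN mulmxA IH.
Qed.
Lemma inPD u v : inP u -> inP v -> inP (u + v).
Proof. by rewrite /inP mulmxDl => -> ->. Qed.
Lemma inPZ a u : inP u -> inP (a *: u).
Proof. by rewrite /inP -scalemxAl => ->. Qed.
Lemma om_P u v : om (u *m P) v = om u (v *m P).
Proof. by rewrite /om trmx_mul -[u *m P *m J]mulmxA PJ !mulmxA. Qed.

Variable L : nat.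
Hypothesis NL : forall u, inP u -> act u L.+1 = 0.

Lemma act_over u k : inP u -> (L < k)%N -> act u k = 0.
Proof. by move=> h hk; apply: act_big (NL h) hk. Qed.

(** Nondegeneracy gives a vector paired with the end of the chain of [y]; its projection to the
    eigenvalue [1 - c] and to the image of [P] keeps this pairing. The unwanted pairings are then
    removed one by one, from high powers to low ones. *)
Lemma dual_chain c y : inP y -> homv c y -> act y L != 0 ->
  exists z, [/\ inP z, homv (1 - c) z & forall r, om (act y r) z = (r == L)%:R].
Proof.
move=> yP yc yL; have [v0 hv0] := om_nondeg yL.
pose D := diag_mx (\row_j ((lam j == 1 - c)%:R : C)).
pose z0 := (om (act y L) v0)^-1 *: (v0 *m D *m P).
have z0c : homv (1 - c) z0.
  apply: homvZ => j; rewrite mxE => nz.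
  have /existsP [l] : [exists l, (v0 *m D) 0 l * P l j != 0].
    apply: contraNT nz; rewrite negb_exists => /forallP h0; rewrite big1 // => l _.
    by apply/eqP; rewrite -[_ == _]negbK h0.
  rewrite mulf_eq0 negb_or => /andP [h1 /Pgr <-]; move: h1.
  by rewrite mul_mx_diag !mxE; case: (lam l =P 1 - c) => // _; rewrite mulr0 eqxx.
have z0P : inP z0 by apply: inPZ; rewrite /inP -mulmxA PP.
have z0L : om (act y L) z0 = 1.
  have -> : om (act y L) z0 = (om (act y L) v0)^-1 * om (act y L) (v0 *m D).
    by rewrite omZr -om_P (inP_act L yP).
  suff -> : om (act y L) (v0 *m D) = om (act y L) v0 by rewrite mulVf.
  have -> : v0 = v0 *m D + (v0 - v0 *m D) by rewrite addrC subrK.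
  rewrite [in RHS]omDr -[LHS]addr0; congr (om _ _ + _).
    by rewrite mulmxDl mulmxBl -!mulmxA (_ : D *m D = D) ?subrr ?addr0 // mulmx_diag; congr diag_mx; apply/rowP => j; rewrite !mxE; case: eqP => _; rewrite ?mulr1 ?mulr0.
  apply/esym; rewrite -[v0 in v0 - _]mulmx1 -mulmxBr /om mxE big1 // => l _; rewrite !mxE.
  have [|ne] := eqVneq (lam l) (1 - c).
    move=> e; rewrite [X in _ * X]big1 ?mulr0 // => k _; rewrite !mxE.
    by case: (k =P l) => [->|_]; rewrite ?e ?eqxx ?subrr ?mulr0 // !mulr0n subr0 mulr0.
  rewrite big1 ?mul0r // => k _; have [->|/(homv_act (k := L) yc) hk] := eqVneq (act y L 0 k) 0; first by rewrite mul0r.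
  have [->|/Jgr hJ] := eqVneq (J k l) 0; first by rewrite mulr0.
  by case/eqP: ne; rewrite -hJ hk addrC addKr.
suff H k : exists z, [/\ inP z, homv (1 - c) z, om (act y L) z = 1 & forall r, (L <= r + k)%N -> (r != L)%N -> om (act y r) z = 0].
  have [z [zP zc zL hz]] := H L; exists z; split=> // r.
  have [->|ne] := eqVneq r L; first by rewrite zL.
  by rewrite hz // leq_addl.
elim: k => [|k [z [zP zc zL hz]]].
  exists z0; split=> // r; rewrite addn0 leq_eqVlt => /orP [/eqP ->|h _]; first by rewrite eqxx.
  by rewrite act_over // om0l.
have [hk|hk] := ltnP L k.+1.
  by exists z; split=> // r _ ne; apply: hz => //; lia.
(* This changes only the pairings with [r <= L - k.+1], since for larger [r] the chain of [y] has
   run out; the sign comes from moving [N ^+ k.+1] across [om]. *)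
exists (z - (om (act y (L - k.+1)) z * (-1) ^+ k.+1) *: act z k.+1); split.
- by rewrite -scaleNr; apply: inPD => //; apply: inPZ; apply: inP_act.
- by rewrite -scaleNr; apply: homvD => //; apply: homvZ; apply: homv_act.
- by rewrite -scaleNr omDr omZr om_act2 [act y (L + _)]act_over ?om0l ?mulr0 ?addr0 //; lia.
move=> r hr ne; rewrite -scaleNr omDr omZr om_act2.
have sg : (-1) ^+ k.+1 * (-1) ^+ k.+1 = 1 :> C by rewrite -exprMn mulrNN mulr1 expr1n.
have [e|ne2] := eqVneq (r + k.+1)%N L.
  by rewrite e zL mulr1 mulNr -mulrA sg mulr1 (_ : r = (L - k.+1)%N) ?subrr //; lia.
by rewrite [act y (r + _)]act_over ?om0l ?mulr0 ?addr0 ?hz //; lia.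
Qed.

(** [g false] and [g true] are the two halves of a Darboux basis; the last clause records
    [N]-stability in the form used by [span_proj_stable]. *)
Definition block l c kd (g : bool -> nat -> 'rV[C]_d) := [/\ (0 < l)%N, kind_ok c l kd,
  forall s i, (i < l)%N -> inP (g s i) /\ homv (if s then 1 - c else c) (g s i),
  forall s1 s2 i j, (i < l)%N -> (j < l)%N ->
    om (g s1 i) (g s2 j) = omst s1 s2 * (i == j)%:R /\
    be (g s1 i) (g s2 j) = Hb kd 0 l s1 s2 i j &
  forall s i, (i < l)%N -> g s i *m N = 0 \/ exists a s' j, (j < l)%N /\ g s i *m N = a *: g s' j].

Lemma sgn_sq k : (-1) ^+ k * (-1) ^+ k = 1 :> C.
Proof. by rewrite -exprMn mulrNN mulr1 expr1n. Qed.

(** As [c + c != 1], the eigenspaces of [c] and [1 - c] are isotropic, so the chain of [y] and its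
    dual chain form a block at once. *)
Lemma block_nonhalf c y : c != 2^-1 -> inP y -> homv c y -> act y L != 0 ->
  exists g, block L.+1 c 1 g.
Proof.
move=> hc yP yc yL; have [z [zP zc hz]] := dual_chain yP yc yL.
have c2 : c + c != 1.
  apply: contraNneq hc => e; have e2 : c * 2 = 1 by rewrite mulr_natr mulr2n.
  by apply/eqP/(mulIf (x := 2)); rewrite ?pnatr_eq0 // e2 mulVf // pnatr_eq0.
have c2' : (1 - c) + (1 - c) != 1.
  apply: contraNneq c2 => e; have -> : c + c = 2 - ((1 - c) + (1 - c)) by ring.
  by rewrite e; apply/eqP; ring.
(* The first chain is listed from its end, so that [N] lowers its index as kind 1 requires; the sign
   in the second half makes up for the adjoint of [N] being [- N]. *)
pose g (s : bool) i := if s then (-1) ^+ i *: act z i else act y (L - i).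
have gN0 i : (i < L)%N -> g false i.+1 *m N = g false i.
  by move=> hi; rewrite /g actS; congr act; lia.
have gN00 : g false 0%N *m N = 0 by rewrite /g actS subn0 NL.
have gN1 i : g true i *m N = - g true i.+1.
  by rewrite /g -scalemxAl actS exprS mulN1r scaleNr opprK.
have gN1L : g true L.+1 = 0 by rewrite /g NL ?scaler0.
have gh s i : (i < L.+1)%N -> inP (g s i) /\ homv (if s then 1 - c else c) (g s i).
  move=> hi; case: s; rewrite /g; split.
  - exact/inPZ/inP_act.
  - exact/homvZ/homv_act.
  - exact/inP_act.
  - exact/homv_act.
have g_ef i j : (i < L.+1)%N -> om (g false i) (g true j) = (i == j)%:R.
  move=> hi; rewrite /g omZr om_act2 mulrA sgn_sq mul1r hz; congr (_ %:R); congr nat_of_bool.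
  by apply/eqP/eqP; lia.
have g_om s1 s2 i j : (i < L.+1)%N -> (j < L.+1)%N -> om (g s1 i) (g s2 j) = omst s1 s2 * (i == j)%:R.
  move=> hi hj; case: s1; case: s2; rewrite /omst ?mul0r ?mul1r.
  - by apply: om_hom0 (gh true i hi).2 (gh true j hj).2 c2'.
  - by rewrite om_skew g_ef // mulN1r eq_sym.
  - exact: g_ef.
  - by apply: om_hom0 (gh false i hi).2 (gh false j hj).2 c2.
have be_ef i j : (i < L.+1)%N -> (j < L.+1)%N -> be (g false i) (g true j) = Hef 1 0 L.+1 i j.
  rewrite /be /Hef => hi hj; rewrite hi hj /=; case: i hi => [|i] hi; first by rewrite gN00 om0l.
  by rewrite gN0 // g_ef ?eqSS //; apply: ltnW.
exists g; split=> //.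
- by rewrite /kind_ok hc.
- move=> s1 s2 i j hi hj; split; first exact: g_om.
  case: s1; case: s2; rewrite /Hb.
  + rewrite /be gN1 -scaleN1r omZl; have [e|ne] := eqVneq i L.
      by rewrite e gN1L om0l mulr0.
    by rewrite g_om ?mul0r ?mulr0 //; lia.
  + by rewrite be_sym be_ef.
  + exact: be_ef.
  + have -> : Hee 1 0 L.+1 i j = 0 by []. rewrite /be; case: i hi => [|i] hi; first by rewrite gN00 om0l.
    by rewrite gN0 // g_om ?mul0r //; apply: ltnW.
- move=> [] i hi.
    have [e|ne] := eqVneq i L; first by left; rewrite gN1 e gN1L oppr0.
    right; exists (-1), true, i.+1; split; first lia.
    by rewrite gN1 scaleN1r.
  case: i hi => [|i] hi; first by left.
  by right; exists 1, false, i; rewrite scale1r gN0 //; split=> //; apply: ltnW.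
Qed.

Lemma HefE kd m i j : (i < m)%N -> (j < m)%N -> Hef kd 0 m i j =
  if kd == 1%N then (i == j.+1)%:R else 2 * (j == i.+1)%:R.
Proof. by rewrite /Hef => -> ->. Qed.

Lemma HeeE kd m i j : (i < m)%N -> Hee kd 0 m i j =
  if [&& kd == 3%N, i == j & i == m.-1] then 2 * (-1) ^+ m else 0.
Proof. by rewrite /Hee => ->; rewrite leq0n !andbT subn0. Qed.

Lemma half2 : 1 - 2^-1 = 2^-1 :> C.
Proof. by field. Qed.

Lemma om_self_even u r : ~~ odd r -> om (act u r) u = 0.
Proof.
move=> hr; have := om_act_swap u u r; rewrite -signr_odd (negbTE hr) expr0 mulN1r => /eqP.
by rewrite -addr_eq0 -mulr2n mulrn_eq0 /= => /eqP.
Qed.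

(** For odd [L] the pairing of [act u L] with [v] is symmetric, so some vector does not annihilate
    itself. A single chain of length [L.+1] is then its own dual and carries the block, half of it
    for each half of the basis. *)
Lemma block_half_odd y : odd L -> inP y -> homv 2^-1 y -> act y L != 0 ->
  exists g, block L./2.+1 2^-1 3 g.
Proof.
move=> Lo yP yc yL; have [z [zP zc hz]] := dual_chain yP yc yL; rewrite half2 in zc.
(* Polarization: if [y] and its dual [z] are both null for this symmetric pairing, then [y + z] has
   value 2. *)
have [u0 [u0P u0c u0L]] : exists u, [/\ inP u, homv 2^-1 u & om (act u L) u != 0].
  have [h|h] := eqVneq (om (act y L) y) 0; last by exists y.
  have [h'|h'] := eqVneq (om (act z L) z) 0; last by exists z.
  exists (y + z); split; [exact: inPD | exact: homvD |].
  rewrite actD omDl !omDr h h' add0r addr0 hz eqxx (om_act_swap y) hz eqxx.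
  by rewrite -signr_odd Lo mulr1 expr1 opprK -mulr2n pnatr_eq0.
have H k : exists u, [/\ inP u, homv 2^-1 u, om (act u L) u != 0 &
   forall r, (L <= r + k)%N -> (r != L)%N -> om (act u r) u = 0].
  elim: k => [|k [u [uP uc uL hu]]].
    exists u0; split=> // r; rewrite addn0 leq_eqVlt => /orP [/eqP ->|h _]; first by rewrite eqxx.
    by rewrite act_over // om0l.
  (* If [L - r = k.+1] is odd then [r] is even and the value vanishes by skewness; only even [k.+1]
     calls for a correction. *)
  have [hk|hk] := boolP ((L < k.+1)%N || odd k.+1).
    exists u; split=> // r hr ne; case: (leqP L (r + k)) => h; first exact: hu.
    apply: om_self_even; have eL : L = (r + k.+1)%N by lia.
    have ok : odd k.+1 by case/orP: hk => //; lia.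
    by move: Lo; rewrite eL oddD ok; case: (odd r).
  move: hk; rewrite negb_or -leqNgt => /andP [hk ek].
  pose s := om (act u (L - k.+1)) u / (2 * om (act u L) u).
  pose v := u - s *: act u k.+1.
  have E r : om (act v r) v = om (act u r) u - s * (om (act u r) (act u k.+1) + om (act u (k.+1 + r)) u)
     + s ^+ 2 * om (act u (k.+1 + r)) (act u k.+1).
    rewrite /v -scaleNr actD actZ actA omDl !omDr !omZl !omZr; ring.
  have sgk : (-1) ^+ k.+1 = 1 :> C by rewrite -signr_odd (negbTE ek).
  have E2 r : om (act v r) v = om (act u r) u - 2 * s * om (act u (r + k.+1)) u
     + s ^+ 2 * om (act u (r + k.+1 + k.+1)) u.
    by rewrite E !om_act2 sgk (addnC k.+1 r); ring.
  exists v; split.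
  - by rewrite /v -scaleNr; apply: inPD => //; apply/inPZ/inP_act.
  - by rewrite /v -scaleNr; apply: homvD => //; apply/homvZ/homv_act.
  - by rewrite E2 [act u (L + k.+1)]act_over ?[act u (L + k.+1 + k.+1)]act_over ?om0l ?mulr0 ?subr0 ?addr0 //; lia.
  move=> r hr ne; rewrite E2 [act u (r + k.+1 + k.+1)]act_over ?om0l ?mulr0 ?addr0 //; last lia.
  have [e|ne2] := eqVneq (r + k.+1)%N L.
    rewrite e (_ : r = (L - k.+1)%N); last lia.
    by rewrite /s; field; rewrite uL.
  by rewrite [act u (r + k.+1)]act_over ?om0l ?mulr0 ?subr0 ?hu //; lia.
have [u1 [u1P u1c u1L hu1]] := H L.
(* The rescaling makes the top value [- 2 ^+ L]: as the forms of kind 3 ask for a factor 2 at each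
   application of [N], this is the value for which the basis below is symplectic. *)
pose a := sqrtC (- 2 ^+ L / om (act u1 L) u1).
pose u := a *: u1.
have uP : inP u by apply: inPZ.
have uc : homv 2^-1 u by apply: homvZ.
have hu r : om (act u r) u = if (r == L)%N then - 2 ^+ L else 0.
  rewrite /u actZ omZl omZr mulrA -expr2 sqrtCK; case: eqP => [->|/eqP ne]; first by rewrite mulfVK.
  by rewrite (hu1 r (leq_addl _ _) ne) mulr0.
have two0 : (2 : C) != 0 by rewrite pnatr_eq0.
set m := L./2.+1; have Lm : L = (m + m).-1 by rewrite /m -[L in LHS]odd_double_half Lo -addnn; lia.
(* The beginning of the chain gives one half of the basis and its end, read backwards, the other.
   The passage between the halves at [m.-1] produces the square term of kind 3. *)
pose g (s : bool) i := if s then ((-1) ^+ i / 2 ^+ (L - i)) *: act u (L - i) else (2 ^+ i)^-1 *: act u i.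
have gh s i : (i < m)%N -> inP (g s i) /\ homv (if s then 1 - 2^-1 else 2^-1) (g s i).
  by rewrite half2 => hi; case: s; rewrite /g; split; by [apply/inPZ/inP_act | apply/homvZ/homv_act].
have g_ef i j : (i < m)%N -> (j < m)%N -> om (g false i) (g true j) = (i == j)%:R.
  move=> hi hj; rewrite /g omZl omZr om_act2 hu.
  have [->|ne] := eqVneq i j.
    rewrite subnKC ?eqxx; last lia.
    have -> : (-1) ^+ (L - j) = - (-1) ^+ j :> C.
      by rewrite -signr_odd -[(-1) ^+ j]signr_odd oddB ?Lo //; [case: (odd j); rewrite ?expr0 ?expr1 ?opprK | lia].
    have -> : 2 ^+ L = 2 ^+ (L - j) * 2 ^+ j :> C by rewrite -exprD subnK //; lia.
    have := sgn_sq j; set e := (-1) ^+ j => ee.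
    have -> : (2 ^+ j)^-1 * (e / 2 ^+ (L - j) * (- e * - (2 ^+ (L - j) * 2 ^+ j))) = e * e :> C.
      by field; rewrite !expf_neq0.
    by rewrite ee.
  by rewrite (_ : (i + (L - j) == L)%N = false) ?mulr0 //; apply/eqP; lia.
have g_om s1 s2 i j : (i < m)%N -> (j < m)%N -> om (g s1 i) (g s2 j) = omst s1 s2 * (i == j)%:R.
  move=> hi hj; case: s1; case: s2; rewrite /omst ?mul0r ?mul1r.
  - rewrite /g omZl omZr om_act2; case: (ltnP L (L - i + (L - j))) => h; first by rewrite act_over // om0l !mulr0.
    lia.
  - by rewrite om_skew g_ef // mulN1r eq_sym.
  - exact: g_ef.
  - by rewrite /g omZl omZr om_act2 hu (_ : (i + j == L)%N = false) ?mulr0 //; apply/eqP; lia.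
have gN0 i : (i.+1 < m)%N -> g false i *m N = 2 *: g false i.+1.
  by move=> hi; rewrite /g -scalemxAl actS scalerA; congr (_ *: _); rewrite exprS; field; rewrite !expf_neq0.
have gNm : g false m.-1 *m N = (- 2 * (-1) ^+ m) *: g true m.-1.
  rewrite /g -scalemxAl actS scalerA; have -> : (L - m.-1 = m.-1.+1)%N by lia.
  congr (_ *: _); rewrite (_ : m = m.-1.+1) //= !exprS.
  have := sgn_sq L./2; set e := (-1) ^+ L./2 => ee.
  have -> : -2 * (-1 * e) * (e / (2 * 2 ^+ L./2)) = (e * e) * (2 ^+ L./2)^-1 :> C by field; rewrite !expf_neq0.
  by rewrite ee mul1r.
have gN1 i : (i.+1 < m)%N -> g true i.+1 *m N = - 2 *: g true i.
  move=> hi; rewrite /g -scalemxAl actS scalerA; have -> : (L - i = (L - i.+1).+1)%N by lia.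
  by congr (_ *: _); rewrite !exprS; field; rewrite !expf_neq0.
have gN10 : g true 0%N *m N = 0 by rewrite /g -scalemxAl actS subn0 NL ?scaler0.
have be_ef i j : (i < m)%N -> (j < m)%N -> be (g false i) (g true j) = Hef 3 0 m i j.
  move=> hi hj; rewrite /be HefE //; case: (ltnP i.+1 m) => h.
    by rewrite gN0 // omZl g_ef // eq_sym.
  have -> : i = m.-1 by lia.
  rewrite gNm omZl g_om ?mul0r ?mulr0; [|lia|lia].
  by rewrite (_ : (j == m.-1.+1)%N = false) ?mulr0 //; apply/eqP; lia.
exists g; split=> //.
- by rewrite /kind_ok eqxx; left.
- move=> s1 s2 i j hi hj; split; first exact: g_om.
  case: s1; case: s2; rewrite /Hb.
  + case: i hi => [|i] hi; first by rewrite /be gN10 om0l.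
    by rewrite /be gN1 // omZl g_om ?mul0r ?mulr0 //; lia.
  + by rewrite be_sym be_ef.
  + exact: be_ef.
  + rewrite HeeE // /be; case: (ltnP i.+1 m) => h.
      rewrite gN0 // omZl g_om ?mul0r ?mulr0 // (_ : (i == m.-1) = false) ?andbF //; apply/eqP; lia.
    have -> : i = m.-1 by lia.
    rewrite !eqxx andbT gNm omZl g_om //.
    by rewrite /omst; case: (m.-1 =P j) => _ /=; ring.
- move=> [] i hi.
    case: i hi => [|i] hi; first by left.
    right; exists (-2), true, i; split; first lia.
    exact: gN1.
  right; case: (ltnP i.+1 m) => h; first by exists 2, false, i.+1; rewrite gN0.
  by exists (- 2 * (-1) ^+ m), true, m.-1; split; [lia | rewrite -gNm; congr (g _ _ *m _); lia].
Qed.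

(** For even [L] the top value of a vector with itself is zero by skewness, so two chains are
    needed. The values at odd [r] are removed by adding multiples of later members of a dual chain,
    computed anew at each stage. *)
Lemma isotropic_chain y : ~~ odd L -> inP y -> homv 2^-1 y -> act y L != 0 ->
  exists u, [/\ inP u, homv 2^-1 u, act u L != 0 & forall r, om (act u r) u = 0].
Proof.
move=> Le yP yc yL.
have H k : exists u, [/\ inP u, homv 2^-1 u, act u L != 0 & forall r, (L <= r + k)%N -> om (act u r) u = 0].
  elim: k => [|k [u [uP uc uL hu]]].
    exists y; split=> // r; rewrite addn0 leq_eqVlt => /orP [/eqP <-|h]; first exact: om_self_even.
    by rewrite act_over // om0l.
  have [hk|hk] := boolP ((L < k.+1)%N || ~~ odd k.+1).
    exists u; split=> // r hr; case: (leqP L (r + k)) => h; first exact: hu.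
    apply: om_self_even; have eL : L = (r + k.+1)%N by lia.
    have ok : ~~ odd k.+1 by case/orP: hk => //; lia.
    by move: Le; rewrite eL oddD (negbTE ok); case: (odd r).
  move: hk; rewrite negb_or negbK -leqNgt => /andP [hk ok].
  have [z [zP zc hz]] := dual_chain uP uc uL; rewrite half2 in zc.
  (* At [r = L - k.+1] the two cross terms coincide because [L] is even, hence the division by 2. *)
  pose s := om (act u (L - k.+1)) u / 2.
  pose v := u + s *: act z k.+1.
  have sgk : (-1) ^+ k.+1 = -1 :> C by rewrite -signr_odd ok expr1.
  have E r : om (act v r) v = om (act u r) u - s * (1 + (-1) ^+ (k.+1 + r) ) * (r + k.+1 == L)%:R
     - s ^+ 2 * om (act z (k.+1 + r + k.+1)) z.
    rewrite /v actD actZ actA omDl !omDr !omZl !omZr !om_act2 sgk hz.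
    by rewrite (om_act_swap u z) hz (addnC k.+1 r); ring.
  exists v; split.
  - by apply: inPD => //; apply/inPZ/inP_act.
  - by apply: homvD => //; apply/homvZ/homv_act.
  - by rewrite /v actD actZ actA [act z _]act_over ?scaler0 ?addr0 //; lia.
  move=> r hr; rewrite E [act z _]act_over ?om0l ?mulr0 ?subr0 //; last lia.
  have [e|ne2] := eqVneq (r + k.+1)%N L.
    rewrite (addnC k.+1 r) e -[(-1) ^+ L]signr_odd (negbTE Le) expr0 mulr1 (_ : r = (L - k.+1)%N); last lia.
    by rewrite /s; field.
  by rewrite mulr0 subr0 hu //; lia.
have [u [uP uc uL hu]] := H L; exists u; split=> // r; exact: (hu r (leq_addl _ _)).
Qed.

(** Once [u] is isotropic, adding multiples of [act u k] to its dual vector leaves their pairing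
    unchanged and can make the dual vector isotropic too. *)
Lemma hyperbolic_pair y : ~~ odd L -> inP y -> homv 2^-1 y -> act y L != 0 ->
  exists u v, [/\ inP u /\ homv 2^-1 u, inP v /\ homv 2^-1 v, forall r, om (act u r) u = 0,
    forall r, om (act v r) v = 0 & forall r, om (act u r) v = (r == L)%:R].
Proof.
move=> Le yP yc yL; have [u [uP uc uL hu]] := isotropic_chain Le yP yc yL.
have [z [zP zc hz]] := dual_chain uP uc uL; rewrite half2 in zc.
have huu a b : om (act u a) (act u b) = 0 by rewrite om_act2 hu mulr0.
have H k : exists v, [/\ inP v, homv 2^-1 v, forall r, om (act u r) v = (r == L)%:R &
    forall r, (L <= r + k)%N -> om (act v r) v = 0].
  elim: k => [|k [v [vP vc hv hvv]]].
    exists z; split=> // r; rewrite addn0 leq_eqVlt => /orP [/eqP <-|h]; first exact: om_self_even.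
    by rewrite act_over // om0l.
  have [hk|hk] := boolP ((L < k.+1)%N || ~~ odd k.+1).
    exists v; split=> // r hr; case: (leqP L (r + k)) => h; first exact: hvv.
    apply: om_self_even; have eL : L = (r + k.+1)%N by lia.
    have ok : ~~ odd k.+1 by case/orP: hk => //; lia.
    by move: Le; rewrite eL oddD (negbTE ok); case: (odd r).
  move: hk; rewrite negb_or negbK -leqNgt => /andP [hk ok].
  have sgk : (-1) ^+ k.+1 = -1 :> C by rewrite -signr_odd ok expr1.
  pose s := - om (act v (L - k.+1)) v / 2.
  exists (v + s *: act u k.+1); split.
  - by apply: inPD => //; apply/inPZ/inP_act.
  - by apply: homvD => //; apply/homvZ/homv_act.
  - by move=> r; rewrite omDr omZr huu mulr0 addr0 hv.
  move=> r hr; rewrite actD actZ actA omDl !omDr !omZl !omZr huu om_act2 sgk (om_act_swap u v) !hv !mulr0 addr0.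
  rewrite (addnC k.+1 r); have [e|ne2] := eqVneq (r + k.+1)%N L.
    rewrite e -[(-1) ^+ L]signr_odd (negbTE Le) expr0 (_ : r = (L - k.+1)%N); last lia.
    by rewrite !mulr1 /s; field.
  by rewrite hvv ?mulr0 ?addr0 ?add0r //; lia.
have [v [vP vc hv hvv]] := H L; exists u, v; split=> // r; exact: (hvv r (leq_addl _ _)).
Qed.

(** The two dual isotropic chains have length [L.+1], which is odd; this is the parity condition of
    kind 2. *)
Lemma block_half_even y : ~~ odd L -> inP y -> homv 2^-1 y -> act y L != 0 ->
  exists g, block L.+1 2^-1 2 g.
Proof.
move=> Le yP yc yL; have [u [v [[uP uc] [vP vc] huu hvv huv]]] := hyperbolic_pair Le yP yc yL.
have two0 : (2 : C) != 0 by rewrite pnatr_eq0.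
have two0' : (-2 : C) != 0 by rewrite oppr_eq0 pnatr_eq0.
(* The powers of 2 make [N] act on the first half by 2 times a step of the index; base -2 absorbs
   the sign of the adjoint, and [2 ^+ L] makes the pairing equal to 1. *)
pose g (s : bool) i := if s then (2 ^+ L / (-2) ^+ (L - i)) *: act v (L - i) else (2 ^+ i)^-1 *: act u i.
have gh s i : (i < L.+1)%N -> inP (g s i) /\ homv (if s then 1 - 2^-1 else 2^-1) (g s i).
  by rewrite half2 => hi; case: s; rewrite /g; split; by [apply/inPZ/inP_act | apply/homvZ/homv_act].
have g_ef i j : (i < L.+1)%N -> (j < L.+1)%N -> om (g false i) (g true j) = (i == j)%:R.
  move=> hi hj; rewrite /g omZl omZr om_act2 huv.
  have [->|ne] := eqVneq i j.
    rewrite subnKC // eqxx mulr1; have -> : (-2) ^+ (L - j) = (-1) ^+ (L - j) * 2 ^+ (L - j) :> C.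
      by rewrite -exprMn mulN1r.
    have -> : 2 ^+ L = 2 ^+ (L - j) * 2 ^+ j :> C by rewrite -exprD subnK.
    by rewrite /=; field; rewrite !expf_neq0 // oppr_eq0 oner_eq0.
  by rewrite (_ : (i + (L - j) == L)%N = false) ?mulr0 //; apply/eqP; lia.
have g_om s1 s2 i j : (i < L.+1)%N -> (j < L.+1)%N -> om (g s1 i) (g s2 j) = omst s1 s2 * (i == j)%:R.
  move=> hi hj; case: s1; case: s2; rewrite /omst ?mul0r ?mul1r.
  - by rewrite /g omZl omZr om_act2 hvv !mulr0.
  - by rewrite om_skew g_ef // mulN1r eq_sym.
  - exact: g_ef.
  - by rewrite /g omZl omZr om_act2 huu !mulr0.
have gN0 i : (i < L)%N -> g false i *m N = 2 *: g false i.+1.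
  by move=> hi; rewrite /g -scalemxAl actS scalerA; congr (_ *: _); rewrite exprS; field; rewrite !expf_neq0.
have gNL : g false L *m N = 0 by rewrite /g -scalemxAl actS NL ?scaler0.
have gN1 i : (i < L)%N -> g true i.+1 *m N = - 2 *: g true i.
  move=> hi; rewrite /g -scalemxAl actS scalerA; have -> : (L - i = (L - i.+1).+1)%N by lia.
  by congr (_ *: _); rewrite [(-2) ^+ (_.+1)]exprS; field; rewrite !expf_neq0.
have gN10 : g true 0%N *m N = 0 by rewrite /g -scalemxAl actS subn0 NL ?scaler0.
have be_ef i j : (i < L.+1)%N -> (j < L.+1)%N -> be (g false i) (g true j) = Hef 2 0 L.+1 i j.
  move=> hi hj; rewrite /be HefE //; case: (ltnP i L) => h.
    by rewrite gN0 // omZl g_ef // eq_sym.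
  have -> : i = L by lia.
  by rewrite gNL om0l (_ : (j == L.+1)%N = false) ?mulr0 //; apply/eqP; lia.
exists g; split=> //.
- by rewrite /kind_ok eqxx; right.
- move=> s1 s2 i j hi hj; split; first exact: g_om.
  case: s1; case: s2; rewrite /Hb.
  + case: i hi => [|i] hi; first by rewrite /be gN10 om0l.
    by rewrite /be gN1 // omZl g_om ?mul0r ?mulr0 //; lia.
  + by rewrite be_sym be_ef.
  + exact: be_ef.
  + rewrite HeeE // /be; case: (ltnP i L) => h.
      by rewrite gN0 // omZl g_om ?mul0r ?mulr0.
    have -> : i = L by lia.
    by rewrite gNL om0l.
- move=> [] i hi.
    case: i hi => [|i] hi; first by left.
    right; exists (-2), true, i; split; first lia.
    exact: gN1.
  case: (ltnP i L) => h; first by right; exists 2, false, i.+1; rewrite gN0.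
  by left; rewrite -gNL; congr (g _ _ *m _); lia.
Qed.

(** The rows of [P] are homogeneous by [Pgr], so a vector starting a chain of maximal length can be
    taken inside one eigenspace. *)
Lemma block_top : P *m N ^+ L != 0 -> exists l c kd g, block l c kd g.
Proof.
move=> nz; have [i hi] : exists i, row i (P *m N ^+ L) != 0.
  by apply/existsP; apply: contraNT nz; rewrite negb_exists => /forallP h; apply/eqP/row_matrixP => i; rewrite row0; apply/eqP; rewrite -[_ == _]negbK h.
pose y := row i P.
have yP : inP y by rewrite /inP /y -row_mul PP.
have yc : homv (lam i) y by move=> j; rewrite mxE => /Pgr.
have yL : act y L != 0 by rewrite /act /y -row_mul.
have [c2|c2] := eqVneq (lam i) 2^-1; last first.
  by have [g hg] := block_nonhalf c2 yP yc yL; exists L.+1, (lam i), 1%N, g.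
rewrite c2 in yc; have [Lo|Le] := boolP (odd L).
  by have [g hg] := block_half_odd Lo yP yc yL; exists L./2.+1, 2^-1, 3%N, g.
by have [g hg] := block_half_even Le yP yc yL; exists L.+1, 2^-1, 2%N, g.
Qed.

End Subspace.

Lemma block_exists P : P *m P = P -> P *m N = N *m P -> P *m J = J *m P^T ->
  (forall i j, P i j != 0 -> lam i = lam j) -> P != 0 -> exists l c kd g, block P l c kd g.
Proof.
move=> PP PN PJ Pgr Pnz; have [k0 hk0] := Nnil.
have ex : exists k, P *m N ^+ k == 0 by exists k0; rewrite hk0 mulmx0.
case: (ex_minnP ex) => [[|L]] /eqP hL hmin.
  by rewrite expr0 mulmx1 in hL; rewrite hL eqxx in Pnz.
apply: (@block_top P PP PN PJ Pgr L).
  by move=> u uP; rewrite /act -uP -mulmxA hL mulmx0.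
by apply/negP => h; have := hmin _ h; rewrite ltnn.
Qed.

End SymplecticBlocks.

(** * Orthogonal splitting into blocks *)

Section SymplecticNormalForm.
Variables (C : numClosedFieldType) (d : nat).
Variables (J N : 'M[C]_d) (lam : 'I_d -> C).
Hypothesis Junit : J \in unitmx.
Hypothesis Jskew : J^T = - J.
Hypothesis NJ : N *m J = - (J *m N^T).
Hypothesis Nnil : exists k, N ^+ k = 0.
Hypothesis Jgr : forall i j, J i j != 0 -> lam i + lam j = 1.
Hypothesis Ngr : forall i j, N i j != 0 -> lam i = lam j.
Implicit Types (g : bool -> nat -> 'rV[C]_d).

Definition gram n g := forall s1 s2 i j, (i < n)%N -> (j < n)%N ->
  om J (g s1 i) (g s2 j) = omst C s1 s2 * (i == j)%:R.
Definition stable n g := forall s i, (i < n)%N ->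
  g s i *m N = 0 \/ exists a s' j, (j < n)%N /\ g s i *m N = a *: g s' j.

(** The [om]-orthogonal projector onto the span of a Darboux basis, as a matrix acting on rows. *)
Definition span_proj n g : 'M[C]_d :=
  \sum_(i < n) (J *m (g true i)^T *m g false i - J *m (g false i)^T *m g true i).

Lemma mul_span_proj n g (u : 'rV[C]_d) : u *m span_proj n g =
  \sum_(i < n) (om J u (g true i) *: g false i - om J u (g false i) *: g true i).
Proof.
rewrite mulmx_sumr; apply: eq_bigr => i _; rewrite mulmxBr !mulmxA.
have h (v w : 'rV[C]_d) : u *m J *m v^T *m w = om J u v *: w.
  by rewrite {1}(mx11_scalar (u *m J *m v^T)) mul_scalar_mx.
by rewrite !h.
Qed.

Lemma gram_proj n g s i : gram n g -> (i < n)%N -> g s i *m span_proj n g = g s i.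
Proof.
move=> hg hi; rewrite mul_span_proj (bigD1 (Ordinal hi)) //= big1 ?addr0 => [|j ne].
  rewrite !hg // eqxx !mulr1; case: s => /=; rewrite ?scale0r ?scale1r ?subr0 // sub0r.
  by rewrite scaleN1r opprK.
have {}ne : (i == j :> nat) = false by apply/negbTE; rewrite eq_sym; exact: ne.
by rewrite !hg // ne !mulr0 !scale0r subrr.
Qed.

Section Proj.
Variables (n : nat) (g : bool -> nat -> 'rV[C]_d).
Hypothesis hg : gram n g.
Let T := span_proj n g.

Lemma span_proj_idem : T *m T = T.
Proof.
rewrite {1}/T /span_proj mulmx_suml; apply: eq_bigr => i _.
by rewrite mulmxBl -!mulmxA !gram_proj.
Qed.

Lemma span_proj_adj : T *m J = J *m T^T.
Proof.
rewrite /T /span_proj mulmx_suml raddf_sum mulmx_sumr; apply: eq_bigr => i _ /=.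
rewrite raddfB /= !trmx_mul !trmxK Jskew !mulmxN mulmxBl mulmxBr !mulmxN !mulmxA opprK.
by rewrite addrC.
Qed.

(** Stability of the span gives [T N T = T N]. As [T] is self-adjoint and [N] skew for [J], taking
    adjoints gives [T N T = N T] as well. *)
Lemma span_proj_stable : stable n g -> T *m N = N *m T.
Proof.
move=> hs; have E1 : T *m N *m T = T *m N.
  rewrite {1 3}/T /span_proj !mulmx_suml; apply: eq_bigr => i _.
  rewrite !mulmxBl -!mulmxA.
  have h s : g s i *m (N *m T) = g s i *m N.
    rewrite mulmxA; case: (hs s i (ltn_ord i)) => [->|[a [s' [j [hj ->]]]]]; first by rewrite mul0mx.
    by rewrite -scalemxAl gram_proj.
  by rewrite !h.
have E2 : T *m N *m J = - (J *m (N *m T)^T).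
  by rewrite -mulmxA NJ mulmxN mulmxA span_proj_adj trmx_mul mulmxA.
have E3 : T *m N *m T *m J = - (J *m (T *m N *m T)^T).
  by rewrite -mulmxA span_proj_adj mulmxA E2 mulNmx !trmx_mul !mulmxA.
have E4 : J *m (N *m T)^T = J *m (T *m N *m T)^T by apply: oppr_inj; rewrite -E2 -E3 E1.
have E5 : N *m T = T *m N *m T.
  by apply: trmx_inj; rewrite -[LHS](mulKmx Junit) E4 mulKmx.
by rewrite E5 E1.
Qed.

Lemma span_proj_graded (c : nat -> C) :
  (forall s i, (i < n)%N -> homv lam (if s then 1 - c i else c i) (g s i)) ->
  forall a b, T a b != 0 -> lam a = lam b.
Proof.
move=> hc a b; apply: contraNeq => ne; rewrite /T /span_proj summxE big1 // => i _.
have h (u v : 'rV[C]_d) (e e' : C) : homv lam e u -> homv lam e' v -> e + e' = 1 -> (J *m u^T *m v) a b = 0.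
  move=> hu hv ee; rewrite mxE big_ord1; have [->|/hv hb] := eqVneq (v 0 b) 0; first by rewrite mulr0.
  rewrite mxE big1 ?mul0r // => k _; rewrite mxE; have [->|/hu hk] := eqVneq (u 0 k) 0; first by rewrite mulr0.
  have [->|/Jgr hJ] := eqVneq (J a k) 0; first by rewrite mul0r.
  by case/eqP: ne; rewrite hb; apply: (addIr (lam k)); rewrite hJ hk addrC ee.
rewrite mxE [X in _ + X]mxE (h _ _ _ _ (hc true i _) (hc false i _)) ?subrK //.
by rewrite (h _ _ _ _ (hc false i _) (hc true i _)) ?oppr0 ?addr0 // addrC subrK.
Qed.

End Proj.

Definition blockwise_form (bs : seq nat) (kd : nat -> nat) s1 s2 i j : C :=
  \sum_(s < nblocks bs) Hb C (kd s) (bstart bs s) (bend bs s) s1 s2 i j.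

(** The invariant of the splitting, with [n] pairs found so far. Unlike in [blocks_ok], the list
    [[:: 0]] without any block is allowed, as it is the starting point. *)
Definition partial_normal_form n bs (lamn : nat -> C) (kd : nat -> nat) g := [/\
  [/\ (0 < size bs)%N, sorted ltn bs, head 0%N bs = 0%N & last 0%N bs = n],
  forall s, (s < nblocks bs)%N -> kind_ok (lamn (bstart bs s)) (bend bs s - bstart bs s) (kd s) /\
     forall i, (bstart bs s <= i < bend bs s)%N -> lamn i = lamn (bstart bs s),
  forall s i, (i < n)%N -> homv lam (if s then 1 - lamn i else lamn i) (g s i),
  gram n g /\ stable n g &
  forall s1 s2 i j, (i < n)%N -> (j < n)%N -> be J N (g s1 i) (g s2 j) = blockwise_form bs kd s1 s2 i j].

Lemma nth_le_last bs i : sorted ltn bs -> (i < size bs)%N -> (nth 0 bs i <= last 0 bs)%N.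
Proof.
move=> hs hi; rewrite -nth_last; apply: sorted_leq_nth; rewrite ?inE //.
- exact: leq_trans.
- by apply: sub_sorted hs => x y; apply: ltnW.
- by case: (size bs) hi.
- by case: (size bs) hi.
Qed.

Lemma sorted_ltn_rcons bs x : (0 < size bs)%N -> sorted ltn bs -> (last 0 bs < x)%N -> sorted ltn (rcons bs x).
Proof. by case: bs => //= y s _; rewrite rcons_path => ->. Qed.

Lemma Hb_out kd a b s1 s2 i j : ~~ (a <= i < b)%N || ~~ (a <= j < b)%N -> Hb C kd a b s1 s2 i j = 0.
Proof.
move=> h; have ef x y : ~~ (a <= x < b)%N || ~~ (a <= y < b)%N -> Hef C kd a b x y = 0.
  by rewrite /Hef; case: (a <= x)%N; case: (x < b)%N; case: (a <= y)%N; case: (y < b)%N.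
case: s1; case: s2; rewrite /Hb ?ef //; first by rewrite orbC.
rewrite /Hee; case: eqP => //= _; case: (i =P j) h => //= <-; rewrite orbb => /negbTE ->.
by rewrite andbF.
Qed.

Lemma Hb_shift kd n l s1 s2 i j : (0 < l)%N -> Hb C kd n (n + l) s1 s2 (n + i) (n + j) = Hb C kd 0 l s1 s2 i j.
Proof.
move=> hl; have ef x y : Hef C kd n (n + l) (n + x) (n + y) = Hef C kd 0 l x y.
  by rewrite /Hef !leq_addr !ltn_add2l -!addnS !eqn_add2l.
case: s1; case: s2; rewrite /Hb ?ef // /Hee leq_addr ltn_add2l eqn_add2l addKn subn0.
have -> : ((n + l).-1 = n + l.-1)%N by lia.
by rewrite eqn_add2l.
Qed.

(** The complement of the span, the image of [1 - T], is again symplectic, graded and [N]-stable, so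
    it contains a block. That block is orthogonal to the old ones for [om] and, by stability, for
    [be]. *)
Lemma append_block n bs lamn kd g : partial_normal_form n bs lamn kd g ->
  span_proj n g != 1%:M ->
  exists l bs' lamn' kd' g', (0 < l)%N /\ partial_normal_form (n + l) bs' lamn' kd' g'.
Proof.
move=> [[b0 bsort bh bl] hk hh [hg hst] hbe] neT.
pose T := span_proj n g; pose P := 1%:M - T.
have TT := span_proj_idem hg; have TJ := @span_proj_adj n g; have TN := span_proj_stable hg hst.
have [l [c [kb [gb [l0 kok gbP gbom gbst]]]]] : exists l c kd g, block J N lam P l c kd g.
  apply: (block_exists Junit Jskew NJ Nnil Jgr Ngr).
  - by rewrite /P mulmxBl mul1mx mulmxBr mulmx1 TT subrr subr0.
  - by rewrite /P mulmxBl mulmxBr mul1mx mulmx1 TN.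
  - by rewrite /P mulmxBl TJ linearB /= trmx1 mulmxBr mul1mx mulmx1.
  - move=> i j; rewrite !mxE; have [->//|ne] := eqVneq i j.
    by rewrite sub0r oppr_eq0; exact: (span_proj_graded (c := lamn) hh).
  - by rewrite subr_eq0 eq_sym.
have inT u : inP P u -> u *m T = 0.
  by rewrite /inP /P mulmxBr mulmx1 => /eqP; rewrite -subr_eq0 addrC addKr oppr_eq0 => /eqP.
have orth u s i : inP P u -> (i < n)%N -> om J u (g s i) = 0.
  move=> hu hi; rewrite -(gram_proj s hg hi) /om trmx_mul.
  have -> : u *m J *m ((span_proj n g)^T *m (g s i)^T) = u *m T *m J *m (g s i)^T.
    by rewrite -[u *m T *m J]mulmxA TJ !mulmxA.
  by rewrite inT // !mul0mx mxE.
have PNc : P *m N = N *m P by rewrite /P mulmxBl mulmxBr mul1mx mulmx1 TN.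
have orthN u s i : inP P u -> (i < n)%N -> be J N u (g s i) = 0.
  by move=> hu hi; apply: orth => //; rewrite /inP -mulmxA -PNc mulmxA hu.
pose g' s i := if (i < n)%N then g s i else gb s (i - n)%N.
pose lamn' i := if (i < n)%N then lamn i else c.
pose kd' s := if (s < nblocks bs)%N then kd s else kb.
pose bs' := rcons bs (n + l)%N.
have nb : nblocks bs' = (nblocks bs).+1 by rewrite /nblocks size_rcons /=; lia.
have st_old s : (s <= nblocks bs)%N -> bstart bs' s = bstart bs s.
  by rewrite /bstart /nblocks nth_rcons => hs; have -> : (s < size bs)%N by lia.
have en_old s : (s < nblocks bs)%N -> bend bs' s = bend bs s.
  by rewrite /bend /nblocks nth_rcons => hs; have -> : (s.+1 < size bs)%N by lia.
have st_new : bstart bs (nblocks bs) = n by rewrite /bstart /nblocks nth_last bl.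
have en_new : bend bs' (nblocks bs) = (n + l)%N.
  by rewrite /bend /nblocks prednK // nth_rcons ltnn eqxx.
have en_le s : (s < nblocks bs)%N -> (bend bs s <= n)%N.
  by move=> hs; rewrite /bend -bl; apply: nth_le_last => //; rewrite /nblocks in hs; lia.
have st_lt s : (s < nblocks bs)%N -> (bstart bs s < bend bs s)%N.
  move=> hs; rewrite /nblocks in hs; rewrite /bstart /bend; apply: (sorted_ltn_nth ltn_trans 0%N bsort); rewrite ?inE; lia.
have old i : (i < n)%N -> forall s, g' s i = g s i by move=> hi s; rewrite /g' hi.
have new' s i : g' s (n + i)%N = gb s i by rewrite /g' ltnNge leq_addr /= addKn.
have splitn i : (i < n + l)%N -> (i < n)%N \/ exists2 k, i = (n + k)%N & (k < l)%N.
  move=> hi; case: (ltnP i n) => h; [by left | right].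
  by exists (i - n)%N; lia.
have formE s1 s2 i j : blockwise_form bs' kd' s1 s2 i j =
    blockwise_form bs kd s1 s2 i j + Hb C kb n (n + l) s1 s2 i j.
  have kn : kd' (nblocks bs) = kb by rewrite /kd' ltnn.
  rewrite /blockwise_form nb big_ord_recr; congr (_ + _); last first.
    by rewrite [nat_of_ord _]/= kn st_old // st_new en_new.
  by apply: eq_bigr => s _ /=; rewrite /kd' ltn_ord st_old ?en_old // ltnW.
have form_out s1 s2 i j : (n <= i)%N || (n <= j)%N -> blockwise_form bs kd s1 s2 i j = 0.
  move=> h; rewrite /blockwise_form big1 // => s _; apply: Hb_out.
  by have := en_le s (ltn_ord s); lia.
exists l, bs', lamn', kd', g'; split=> //; split.
- split; first by rewrite size_rcons.
  + by apply: sorted_ltn_rcons => //; rewrite bl -addn1 leq_add2l.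
  + by rewrite /bs' -bh; case: (bs) b0.
  + by rewrite last_rcons.
- rewrite nb => s; rewrite ltnS leq_eqVlt => /orP [/eqP ->|hs].
    rewrite st_old // st_new en_new /kd' ltnn /lamn' ltnn addKn; split=> // i /andP [hi _].
    by rewrite ltnNge hi.
  have h1 := en_le s hs; have h2 := st_lt s hs.
  have e1 := st_old s (ltnW hs); have e2 := en_old s hs; rewrite e1 e2.
  have e3 : kd' s = kd s by rewrite /kd' hs.
  have e4 i : (i < n)%N -> lamn' i = lamn i by move=> hi; rewrite /lamn' hi.
  have [h3 h4] := hk s hs.
  rewrite e3 e4; last exact: leq_trans h2 h1.
  split=> // i hi; rewrite e4; first exact: h4.
  by case/andP: hi => _ hi; exact: leq_trans hi h1.
- move=> s i /splitn [hi|[k -> hkl]]; rewrite /lamn'.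
    by rewrite old // hi; apply: hh.
  by rewrite new' ltnNge leq_addr /=; have [] := gbP s k hkl.
- split.
    move=> s1 s2 i j /splitn [hi|[k -> hkl]] /splitn [hj|[k' -> hkl']]; rewrite ?new' ?old //.
    + exact: hg.
    + have [h1 h2] := gbP s2 k' hkl'; rewrite om_skew // orth // oppr0.
      by rewrite (_ : (i == (n + k')%N) = false) ?mulr0 //; apply/eqP; lia.
    + have [h1 h2] := gbP s1 k hkl; rewrite orth //.
      by rewrite (_ : ((n + k)%N == j) = false) ?mulr0 //; apply/eqP; lia.
    + by rewrite eqn_add2l; have [] := gbom s1 s2 k k' hkl hkl'.
  move=> s i /splitn [hi|[k -> hkl]].
    rewrite old //; case: (hst s i hi) => [->|[a [s' [j [hj ->]]]]]; [by left | right].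
    by exists a, s', j; rewrite old //; split=> //; lia.
  rewrite new'; case: (gbst s k hkl) => [->|[a [s' [j [hj ->]]]]]; [by left | right].
  by exists a, s', (n + j)%N; rewrite new' ltn_add2l.
- move=> s1 s2 i j /splitn [hi|[k -> hkl]] /splitn [hj|[k' -> hkl']]; rewrite ?new' ?old // formE.
  + by rewrite Hb_out ?addr0 ?hbe //; lia.
  + have [h1 h2] := gbP s2 k' hkl'; rewrite (be_sym Jskew NJ) orthN // form_out ?leq_addr ?orbT // add0r Hb_out //.
    by lia.
  + have [h1 h2] := gbP s1 k hkl; rewrite orthN // form_out ?leq_addr // add0r Hb_out //.
    by lia.
  + rewrite form_out ?leq_addr // add0r Hb_shift //.
    by have [] := gbom s1 s2 k k' hkl hkl'.
Qed.

(** [E] stacks the basis and [X] is its symplectic dual: [E *m X = 1] makes the rank of [E] equal to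
    [n + n], and [X *m E] is the projector. *)
Lemma gram_dim n g : gram n g -> (n.*2 <= d)%N /\ (span_proj n g = 1%:M -> n.*2 = d).
Proof.
move=> hg; pose Ee := \matrix_(i < n) g false i; pose Ef := \matrix_(i < n) g true i.
pose E := col_mx Ee Ef; pose X := row_mx (J *m Ef^T) (- (J *m Ee^T)).
have gE (s1 s2 : bool) : (\matrix_(i < n) g s1 i) *m (J *m (\matrix_(i < n) g s2 i)^T) = (omst C s1 s2)%:M.
  apply/matrixP => i j; rewrite [RHS]mxE -mulr_natr.
  transitivity (om J (g s1 i) (g s2 j)); last exact: (hg s1 s2 i j (ltn_ord i) (ltn_ord j)).
  rewrite mulmxA /om [LHS]mxE [RHS]mxE; apply: eq_bigr => k _; rewrite [(_ *m J) i k]mxE [(_ *m J) 0 k]mxE; congr (_ * _).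
    by apply: eq_bigr => m _; rewrite mxE.
  by rewrite [LHS]mxE [RHS]mxE mxE.
have outer (u : nat -> 'rV[C]_d) (v : nat -> 'rV[C]_d) :
    J *m (\matrix_(i < n) u i)^T *m (\matrix_(i < n) v i) = \sum_(i < n) J *m (u i)^T *m v i.
  apply/matrixP => a b; rewrite summxE [LHS]mxE; apply: eq_bigr => i _.
  rewrite [RHS]mxE big_ord1; congr (_ * _); last by rewrite mxE.
  by rewrite [LHS]mxE [RHS]mxE; apply: eq_bigr => k _; congr (_ * _); rewrite [LHS]mxE [RHS]mxE mxE.
have EX : E *m X = 1%:M.
  rewrite /E /X mul_col_row !mulmxN /Ee /Ef (gE false true) (gE false false) (gE true true) (gE true false).
  rewrite scalar_mx_block; congr block_mx.
  - by apply/matrixP => i j; rewrite !mxE mul0rn oppr0.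
  - by apply/matrixP => i j; rewrite !mxE mul0rn.
  - by apply/matrixP => i j; rewrite !mxE mulNrn opprK.
have XE : X *m E = span_proj n g.
  by rewrite mul_row_col mulNmx !outer /span_proj sumrB.
have rE : \rank E = (n + n)%N by apply/eqP/row_freeP; exists X.
split; first by rewrite -addnn -rE rank_leq_col.
move=> h1; rewrite -addnn -rE; apply/eqP/row_fullP; exists X; by rewrite XE.
Qed.

Lemma symplectic_normal_form : exists n bs lamn kd g, n.*2 = d /\ partial_normal_form n bs lamn kd g.
Proof.
(* [k] bounds what is left to cover; each new block adds at least one pair. *)
have H k n bs lamn kd g : (d - n <= k)%N -> partial_normal_form n bs lamn kd g ->
  exists n bs lamn kd g, n.*2 = d /\ partial_normal_form n bs lamn kd g.
  elim: k n bs lamn kd g => [|k IH] n bs lamn kd g hk hp; have [_ _ _ [hg _] _] := hp;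
    have [h1 h2] := gram_dim hg; have [e|ne] := eqVneq (span_proj n g) 1%:M;
    try by exists n, bs, lamn, kd, g; split=> //; apply: h2.
  - have [l [bs' [lamn' [kd' [g' [l0 hp']]]]]] := append_block hp ne.
    have [_ _ _ [hg' _] _] := hp'; have [h1' _] := gram_dim hg'; lia.
  - have [l [bs' [lamn' [kd' [g' [l0 hp']]]]]] := append_block hp ne.
    by apply: IH hp'; lia.
apply: (H d 0%N [:: 0%N] (fun _ => 0) (fun _ => 0%N) (fun _ _ => 0)); first lia.
split=> //; by move=> s1 s2 i j.
Qed.

End SymplecticNormalForm.

(** * Elimination of theta *)

Section ThetaElimination.
Variables (C : numClosedFieldType) (d : nat).
Local Notation A := (fps C d).
Local Notation B := (fps C d.+1).

Definition xs (i : 'I_d) : B := fpsX C (lift ord0 i).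
(** Restriction to theta = 0, a retraction for the inclusion [xs] of series in the x alone. *)
Definition zs (k : 'I_d.+1) : A := match unlift ord0 k with None => 0 | Some i => fpsX C i end.
Definition lft (f : A) : B := fpscomp f xs.
Definition res (f : B) : A := fpscomp f zs.
Definition emb (a : mon d) : mon d.+1 :=
  [ffun k => match unlift ord0 k with None => 0%N | Some i => a i end].

Lemma lift0_neq (i : 'I_d) : (lift ord0 i == ord0) = false.
Proof. by rewrite eq_sym; apply/negbTE/neq_lift. Qed.

Lemma based_xs : based xs. Proof. by move=> i; apply: cst_fpsX. Qed.
Lemma based_zs : based zs.
Proof. by move=> k; rewrite /zs; case: unliftP => [i _|_] //; apply: cst_fpsX. Qed.

Lemma zs_lift i : zs (lift ord0 i) = fpsX C i. Proof. by rewrite /zs liftK. Qed.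
Lemma lftK f : res (lft f) = f.
Proof.
rewrite /res /lft fpscompA; [|exact: based_xs|exact: based_zs]; rewrite -[RHS]fpscomp_id; congr fpscomp.
apply: funext => i; rewrite /xs fpscompX ?zs_lift //; exact: based_zs.
Qed.

Lemma lftD f g : lft (f + g) = lft f + lft g. Proof. exact: fpscompD. Qed.
Lemma lftN f : lft (- f) = - lft f. Proof. exact: fpscompN. Qed.
Lemma lftM f g : lft (f * g) = lft f * lft g. Proof. exact/fpscompM/based_xs. Qed.
Lemma lft0 : lft 0 = 0.
Proof. by rewrite -(fpsC0 C d) /lft fpscompC ?fpsC0 //; exact: based_xs. Qed.
Lemma lft_sum (I : finType) (F : I -> A) : lft (\sum_i F i) = \sum_i lft (F i).
Proof. exact/fpscomp_sum/based_xs. Qed.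

Lemma fderiv0_lft f : fderiv ord0 (lft f) = 0.
Proof.
rewrite /lft fderiv_fpscomp; last exact: based_xs.
by rewrite big1 // => i _; rewrite fderiv_fpsX (negbTE (neq_lift _ _)) mulr0.
Qed.

Lemma fderiv_lift_lft j f : fderiv (lift ord0 j) (lft f) = lft (fderiv j f).
Proof.
rewrite /lft fderiv_fpscomp; last exact: based_xs.
rewrite (bigD1 j) //= fderiv_fpsX eqxx mulr1 big1 ?addr0 // => i ij.
by rewrite fderiv_fpsX (inj_eq lift_inj) eq_sym (negbTE ij) mulr0.
Qed.

Lemma fderiv0_coef (f : B) (a : mon d.+1) : fderiv ord0 f = 0 -> (0 < a ord0)%N -> f a = 0.
Proof.
move=> h ha; have := congr1 (fun g : B => g (msub a (monv d.+1 (ord0 : 'I_d.+1)))) h.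
rewrite fderivE msubK ?mle_monv // => /eqP; rewrite mulf_eq0 pnatr_eq0 /=; exact: eqP.
Qed.

Lemma res_coef f a : res f a = f (emb a).
Proof.
pose E (f : B) : A := res f - ((fun a => f (emb a)) : A).
suff /(congr1 (fun g : A => g a)) : E f = 0 by move=> /= /eqP; rewrite subr_eq0 => /eqP.
apply: (@hadamard_ind _ _ _ E zs based_zs) => [f1 f2|c|k f1].
- by rewrite /E /res fpscompD; apply: fps_ext => b; rewrite !(fps_subE, fps_addE); ring.
- rewrite /E /res fpscompC; last exact: based_zs.
  apply: fps_ext => b; rewrite fps_subE /fpsC.
  have -> : (emb b == mon0 d.+1) = (b == mon0 d).
    apply/eqP/eqP => [h|->]; apply/ffunP => i; rewrite !ffunE.
      by move/ffunP: h => /(_ (lift ord0 i)); rewrite !ffunE liftK.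
    by case: unliftP => // j _; rewrite ffunE.
  by rewrite subrr.
rewrite /E /res fpscompXM; last exact: based_zs.
rewrite mulrBr; congr (_ - _); apply: fps_ext => b; rewrite XmulE.
rewrite /zs; case: unliftP => [i ->|->]; last by rewrite ffunE unlift_none mul0r.
rewrite XmulE ffunE liftK; case: ifP => // bi; congr (f1 _).
have me e (x y : mon e) k0 : msub x y k0 = (x k0 - y k0)%N by rewrite ffunE.
apply/ffunP => j; rewrite [LHS]me [RHS]ffunE monvE ffunE; case: unliftP => [l ->|->] //.
by rewrite me monvE (inj_eq lift_inj).
Qed.

(** In characteristic zero a vanishing theta-derivative excludes every monomial containing theta,
    and by [res_coef] the other monomials survive restriction. *)
Lemma lft_res f : fderiv ord0 f = 0 -> lft (res f) = f.
Proof.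
move=> h; apply/eqP; rewrite eq_sym -subr_eq0; apply/eqP.
have h0 : fderiv ord0 (f - lft (res f)) = 0 by rewrite raddfB /= h fderiv0_lft subrr.
have hr : res (f - lft (res f)) = 0.
  by rewrite /res fpscompD fpscompN -!/(res _) lftK subrr.
apply: fps_ext => a; case: (posnP (a ord0)) => a0; last exact: fderiv0_coef.
pose b : mon d := [ffun i => a (lift ord0 i)].
have -> : a = emb b by apply/ffunP => k; rewrite ffunE; case: unliftP => [i ->|->] //; rewrite ffunE.
by rewrite -res_coef hr.
Qed.

Lemma lft_inj f g : lft f = lft g -> f = g.
Proof. by move=> h; rewrite -[f]lftK h lftK. Qed.

(** Only the constant part [J] of [Om] has to be inverted: solving with it expresses [y] through
    [Om - J], which raises the order of [y] by one. *)
Lemma nondeg_cancel (I : finType) e (J : 'M[C]_d) (y : 'I_d -> fps C e) (Om : 'I_d -> 'I_d -> fps C e) :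
  J \in unitmx -> (forall i j, cst (Om i j) = J i j) ->
  (forall j, \sum_i y i * Om i j = 0) -> forall i, y i = 0.
Proof.
move=> hJ hO hy; suff H n : forall i, vanish n (y i) by move=> i; apply: vanish_all.
elim: n => // n IH i.
have yE : y i = - \sum_j (\sum_k y k * (Om k j - fpsC e (J k j))) * fpsC e (invmx J j i).
  have -> : \sum_j (\sum_k y k * (Om k j - fpsC e (J k j))) * fpsC e (invmx J j i) =
     - \sum_j \sum_k y k * (fpsC e (J k j) * fpsC e (invmx J j i)).
    rewrite -sumrN; apply: eq_bigr => j _.
    have -> : \sum_k y k * (Om k j - fpsC e (J k j)) = - \sum_k y k * fpsC e (J k j).
      by under eq_bigr do rewrite mulrBr; rewrite sumrB hy sub0r.
    by rewrite mulNr mulr_suml; congr (- _); apply: eq_bigr => k _; rewrite mulrA.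
  rewrite opprK exchange_big /= (bigD1 i) //= [X in _ = _ + X]big1 ?addr0 => [|k ki].
    rewrite -mulr_sumr; have -> : \sum_j fpsC e (J i j) * fpsC e (invmx J j i) = 1.
      under eq_bigr do rewrite -fpsCM.
      rewrite -raddf_sum /=; have /matrixP /(_ i i) := mulmxV hJ; rewrite !mxE eqxx => ->.
      by rewrite fpsC1E.
    by rewrite mulr1.
  rewrite -mulr_sumr; have -> : \sum_j fpsC e (J k j) * fpsC e (invmx J j i) = 0.
    under eq_bigr do rewrite -fpsCM.
    rewrite -raddf_sum /=; have /matrixP /(_ k i) := mulmxV hJ; rewrite !mxE (negbTE ki) => ->.
    by rewrite fpsC0.
  by rewrite mulr0.
rewrite yE; apply: vanishN; apply: vanish_sum => j _; apply: vanishMl; apply: vanish_sum => k _.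
rewrite -addn1; apply: vanishM (IH k) _; apply/vanish1P.
by rewrite cstD cstN cstC hO subrr.
Qed.

Let th : B := fpsX C ord0.

(** The exponent of the monomial [b] times the [k]-th power of theta. *)
Definition mtheta k (b : mon d.+1) : mon d.+1 := [ffun i => (b i + k * (i == ord0))%N].

Lemma exp_theta_coef k (f : B) b : (th ^+ k * f) (mtheta k b) = f b.
Proof.
elim: k f b => [|k IH] f b.
  by rewrite expr0 mul1r; congr f; apply/ffunP => i; rewrite ffunE mul0n addn0.
rewrite exprS -mulrA XmulE ffunE eqxx muln1 addnS -[RHS](IH f b); congr ((_ : B) _).
apply/ffunP => i; rewrite !ffunE (inj_eq val_inj); case: eqP => _; lia.
Qed.

(* Weierstrass-type uniqueness: as m - 1 >= 2, the coefficients of F are pushed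
   to ever lower powers of x_1. *)
Lemma weierstrass_zero m i1 (F : B) (p v : A) : (2 < m)%N ->
  F * (m%:R * th ^+ m.-1 - xs i1) = lft p * th + lft v -> [/\ F = 0, p = 0 & v = 0].
Proof.
move=> hm E.
(* The right-hand side has degree at most 1 in theta, and the monomial [a] at least [m.-1], which is
   at least 2; so its coefficient there is zero. *)
have rec b : m%:R * F b = (xs i1 * F) (mtheta m.-1 b).
  set a := mtheta _ _.
  have := congr1 (fun g : B => g a) E => /=.
  have -> : F * (m%:R * th ^+ m.-1 - xs i1) = fpsC d.+1 m%:R * (th ^+ m.-1 * F) - xs i1 * F.
    by rewrite raddfMn /= fpsC1E; ring.
  rewrite fps_subE mulCE exp_theta_coef fps_addE [lft p * th]mulrC.
  have ha : (1 < a ord0)%N by rewrite ffunE eqxx; lia.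
  rewrite (fderiv0_coef (fderiv0_lft v)) ?(ltnW ha) // addr0.
  have -> : (th * lft p) a = 0.
    rewrite XmulE (fderiv0_coef (fderiv0_lft p)) ?if_same //.
    by move: ha; rewrite !ffunE !eqxx; lia.
  by move=> /eqP; rewrite subr_eq0 => /eqP.
have F0 : F = 0.
  apply: fps_ext => b; move: {2}(b (lift ord0 i1)) (leqnn (b (lift ord0 i1))) => s.
  elim: s b => [|s IH] b hb; have := rec b; rewrite XmulE ffunE lift0_neq muln0 addn0.
    have -> : (0 < b (lift ord0 i1))%N = false by lia.
    by move/eqP; rewrite mulf_eq0 pnatr_eq0; case: (m) hm => //= ? _ /eqP.
  case: ifP => [h|_]; last by move/eqP; rewrite mulf_eq0 pnatr_eq0; case: (m) hm => //= ? _ /eqP.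
  rewrite (IH (msub _ _)); first by move/eqP; rewrite mulf_eq0 pnatr_eq0; case: (m) hm => //= ? _ /eqP.
  rewrite !ffunE eqxx lift0_neq muln0; lia.
move: E; rewrite F0 mul0r => /esym E.
have p0 : p = 0.
  have := congr1 (fderiv ord0) E; rewrite !raddfD /= fderivM !fderiv0_lft mul0r add0r addr0 raddf0.
  by rewrite /th fderiv_fpsX eqxx mulr1 -lft0 => /lft_inj.
split=> //; move: E; rewrite p0 lft0 mul0r add0r -lft0; exact: lft_inj.
Qed.

(** Let [u] be [al] contracted with X. By Cartan's formula the theta component says that [u] is
    independent of theta, and nondegeneracy in the x components then makes the x components of X
    independent of theta. The definition of [u] becomes an identity in powers of theta, to which
    [weierstrass_zero] applies. *)
Lemma theta_elimination m i1 (G : 'I_d -> A) (X : vf C d.+1) (al : form1 C d.+1) :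
  (2 < m)%N -> let h := th ^+ m - xs i1 * th in
  al ord0 = fderiv ord0 h -> (forall j, al (lift ord0 j) = fderiv (lift ord0 j) h + lft (G j)) ->
  \matrix_(i, j) cst (fderiv i (G j) - fderiv j (G i)) \in unitmx ->
  (forall k, lie_form1 X al k = 0) ->
  exists X' : vf C d, [/\ X ord0 = 0, forall i, X (lift ord0 i) = lft (X' i), X' i1 = 0
    & forall j, lie_form1 X' G j = 0].
Proof.
move=> hm h al0 alj hJ hL.
have d0 : fderiv ord0 h = m%:R * th ^+ m.-1 - xs i1.
  rewrite /h raddfB /= fderivM /xs !fderiv_fpsX eqxx (negbTE (neq_lift _ _)) mul0r add0r mulr1; congr (_ - _).
  elim: (m) => [|k IH]; first by rewrite expr0 -fpsC1E fderivC mul0r.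
  rewrite exprS fderivM /th fderiv_fpsX eqxx mul1r IH /=; case: (k) => [|q]; first by rewrite expr0 mul0r mulr0 addr0 mulr1.
  by rewrite /= exprS -[q.+2%:R]natr1; ring.
have dj i : fderiv (lift ord0 i) h = - ((i == i1)%:R * th).
  rewrite /h raddfB /= fderivM /xs !fderiv_fpsX (inj_eq lift_inj) (eq_sym _ ord0) (negbTE (neq_lift _ _)) mulr0 addr0.
  have -> : fderiv (lift ord0 i) (th ^+ m) = 0; last by rewrite sub0r.
  elim: (m) => [|k IH]; first by rewrite expr0 -fpsC1E fderivC.
  by rewrite exprS fderivM IH /th fderiv_fpsX eq_sym (negbTE (neq_lift _ _)) mul0r mulr0 addr0.
clearbody h; pose u := \sum_l X l * al l.
have hL0 : fderiv ord0 u = 0.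
  rewrite -(hL ord0) lie_cartan -/u big1 ?addr0 // => l _.
  case: (unliftP ord0 l) => [i ->|->]; last by rewrite subrr mulr0.
  by rewrite alj al0 raddfD /= fderiv0_lft addr0 fderiv_comm subrr mulr0.
have hLj j : fderiv (lift ord0 j) u + \sum_i X (lift ord0 i) * lft (fderiv i (G j) - fderiv j (G i)) = 0.
  apply: etrans (hL (lift ord0 j)); rewrite lie_cartan -/u big_ord_recl; congr (_ + _).
  rewrite al0 alj raddfD /= fderiv0_lft addr0 fderiv_comm subrr mulr0 add0r.
  apply: eq_bigr => i _; rewrite !alj !raddfD /= !fderiv_lift_lft lftD lftN.
  by rewrite (fderiv_comm (lift ord0 i)); congr (_ * _); ring.
have dX i : fderiv ord0 (X (lift ord0 i)) = 0.
  move: i; apply: (nondeg_cancel 'I_d hJ (Om := fun i j => lft (fderiv i (G j) - fderiv j (G i)))).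
    by move=> i j; rewrite /lft cst_fpscomp ?mxE //; exact: based_xs.
  move=> j; have := congr1 (fderiv ord0) (hLj j); rewrite raddf0 raddfD /= fderiv_comm hL0 raddf0 add0r.
  rewrite raddf_sum /= => E; rewrite -[RHS]E; apply: eq_bigr => i _.
  by rewrite fderivM fderiv0_lft mulr0 addr0.
pose X' i := res (X (lift ord0 i)); pose u' := res u.
have XE i : X (lift ord0 i) = lft (X' i) by rewrite /X' lft_res.
have uE : u = lft u' by rewrite /u' lft_res.
have W : X ord0 * (m%:R * th ^+ m.-1 - xs i1) = lft (X' i1) * th + lft (u' - \sum_i X' i * G i).
  have : u = X ord0 * (m%:R * th ^+ m.-1 - xs i1) - lft (X' i1) * th + \sum_i lft (X' i * G i).
    rewrite /u big_ord_recl al0 d0 -addrA; congr (_ + _).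
    under eq_bigr do rewrite alj dj mulrDr XE -lftM.
    rewrite big_split /=; congr (_ + _); rewrite (bigD1 i1) //= eqxx big1 ?addr0 => [|i ne].
      by rewrite mul1r mulrN.
    by rewrite (negbTE ne) mul0r oppr0 mulr0.
  by rewrite uE lftD lftN lft_sum => ->; ring.
have [X00 X10 v0] := weierstrass_zero hm W.
exists X'; split=> // j; apply: lft_inj; rewrite lft0 -[RHS](hLj j) lie_cartan lftD; congr (_ + _).
  rewrite -fderiv_lift_lft uE; congr fderiv; congr lft.
  by move/eqP: v0; rewrite subr_eq0 => /eqP ->.
by rewrite lft_sum; apply: eq_bigr => i _; rewrite XE lftM.
Qed.

End ThetaElimination.

(** * The quadratic forms of the blocks *)

Section QuadraticForms.
Variables (C : numClosedFieldType) (n : nat).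
Local Notation A := (fps C n.*2).
Local Notation x p := (fpsXn n.*2 p : A).
Local Notation cc c := (fpsC n.*2 c : A).

Lemma sum_halves (V : nmodType) (F : nat -> V) :
  \sum_(k < n.*2) F k = \sum_(0 <= i < n) F i + \sum_(0 <= i < n) F (n + i)%N.
Proof.
rewrite -(big_mkord xpredT F) -addnn (@big_cat_nat _ _ _ n) //= ?leq_addr //; congr (_ + _).
by rewrite -{1}[n]add0n big_addn addnK; apply: eq_bigr => i _; rewrite addnC.
Qed.

Lemma sum_restrict (V : nmodType) (F : nat -> V) a c : (c <= n)%N ->
  \sum_(0 <= j < n) (if (a <= j < c)%N then F j else 0) = \sum_(a <= j < c) F j.
Proof.
move=> hc; rewrite (big_nat_widenl a 0) // (big_nat_widen 0 c n) //= -big_mkcond /=.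
by apply: eq_bigl => j.
Qed.

(** A coordinate is addressed by its half and its position there, to match the indexing of the
    blocks. *)
Definition upper (k : nat) : bool := (n <= k)%N.
Definition hidx (k : nat) : nat := if (k < n)%N then k else (k - n)%N.
Definition ext_form (H : bool -> bool -> nat -> nat -> C) (k l : nat) : C :=
  H (upper k) (upper l) (hidx k) (hidx l).

Lemma upper_lt i : (i < n)%N -> upper i = false. Proof. by rewrite /upper; lia. Qed.
Lemma upper_add i : upper (n + i) = true. Proof. by rewrite /upper leq_addr. Qed.
Lemma hidx_lt i : (i < n)%N -> hidx i = i. Proof. by rewrite /hidx => ->. Qed.
Lemma hidx_add i : hidx (n + i) = i. Proof. by rewrite /hidx ltnNge leq_addr addKn. Qed.

Definition Qof (kd a b : nat) : A :=
  (if kd == 1%N then \sum_(a <= j < b.-1) x j.+1 * x (n + j)%N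
   else cc 2 * \sum_(a <= j < b.-1) x j * x (n + j.+1)%N)
  + (if kd == 3%N then cc ((-1) ^+ (b - a)) * (x b.-1 * x b.-1) else 0).

Lemma Hef_sum kd a b : (a < b)%N -> (b <= n)%N ->
  \sum_(0 <= i < n) \sum_(0 <= j < n) cc (Hef C kd a b i j) * (x i * x (n + j)%N) =
  if kd == 1%N then \sum_(a <= j < b.-1) x j.+1 * x (n + j)%N
   else cc 2 * \sum_(a <= j < b.-1) x j * x (n + j.+1)%N.
Proof.
move=> ab bn; have b1n : (b.-1 <= n)%N by lia.
case: ifP => kd1.
  rewrite exchange_big_nat /= -(sum_restrict _ _ b1n); apply: eq_bigr => j _.
  transitivity (\sum_(0 <= i < n) if i == j.+1 then
      (if (a <= j < b.-1)%N then x j.+1 * x (n + j)%N else 0) else 0).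
    apply: eq_bigr => i _; rewrite /Hef kd1; case: eqP => [->|_].
      have -> : [&& a <= j.+1, j.+1 < b, a <= j & j < b]%N = (a <= j < b.-1)%N by lia.
      by case: ifP => _; rewrite ?fpsC1E ?mul1r // fpsC0 mul0r.
    by rewrite if_same fpsC0 mul0r.
  by rewrite -big_mkcond big_nat1_eq /=; case: ifP => // h; case: ifP => //; lia.
rewrite -(sum_restrict _ _ b1n) mulr_sumr; apply: eq_bigr => i _.
transitivity (\sum_(0 <= j < n) if j == i.+1 then
    (if (a <= i < b.-1)%N then cc 2 * (x i * x (n + i.+1)%N) else 0) else 0).
  apply: eq_bigr => j _; rewrite /Hef kd1; case: eqP => [->|_].
    have -> : [&& a <= i, i < b, a <= i.+1 & i.+1 < b]%N = (a <= i < b.-1)%N by lia.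
    by case: ifP => _; rewrite ?mulr1 // fpsC0 mul0r.
  by rewrite mulr0 if_same fpsC0 mul0r.
rewrite -big_mkcond big_nat1_eq /= (fun_if ( *%R (cc 2))) mulr0; case: ifP => // h; case: ifP => //; lia.
Qed.

Lemma Hee_sum kd a b : (a < b)%N -> (b <= n)%N ->
  \sum_(0 <= i < n) \sum_(0 <= j < n) cc (Hee C kd a b i j) * (x i * x j) =
  cc 2 * if kd == 3%N then cc ((-1) ^+ (b - a)) * (x b.-1 * x b.-1) else 0.
Proof.
move=> ab bn.
transitivity (\sum_(0 <= i < n) if i == b.-1 then
   (if kd == 3%N then cc (2 * (-1) ^+ (b - a)) * (x b.-1 * x b.-1) else 0) else 0).
  apply: eq_big_nat => i /andP [_ hi].
  transitivity (\sum_(0 <= j < n) if j == i then cc (Hee C kd a b i i) * (x i * x i) else 0).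
    apply: eq_bigr => j _; case: eqP => [->//|/eqP ne]; rewrite /Hee (eq_sym i j) (negbTE ne) andbF.
    by rewrite fpsC0 mul0r.
  rewrite -big_mkcond big_nat1_eq /= hi /Hee eqxx; case: (kd == 3%N) => /=; last by rewrite fpsC0 mul0r if_same.
  case: (i =P b.-1) => [->|_] /=; last by rewrite fpsC0 mul0r.
  by have -> : ((a <= b.-1) && (b.-1 < b))%N by lia.
rewrite -big_mkcond big_nat1_eq /=; have -> : (b.-1 < n)%N by lia.
by case: (kd == 3%N); rewrite ?mulr0 // fpsCM -mulrA.
Qed.

(** Mixed entries occur on both sides of the diagonal and the square entry carries its own factor 2;
    hence twice [Qof]. *)
Lemma Qof_quad kd a b : (a < b)%N -> (b <= n)%N ->
  \sum_(k < n.*2) \sum_(l < n.*2) cc (ext_form (Hb C kd a b) k l) * (x k * x l) = cc 2 * Qof kd a b.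
Proof.
move=> ab bn; rewrite (sum_halves (fun k => \sum_(l < n.*2) cc (ext_form (Hb C kd a b) k l) * (x k * x l))).
under eq_bigr do rewrite (sum_halves (fun l => cc (ext_form (Hb C kd a b) _ l) * (x _ * x l))).
under [X in _ + X]eq_bigr do rewrite (sum_halves (fun l => cc (ext_form (Hb C kd a b) _ l) * (x _ * x l))).
rewrite !big_split /=.
have -> : \sum_(0 <= i < n) \sum_(0 <= j < n) cc (ext_form (Hb C kd a b) i j) * (x i * x j) =
    \sum_(0 <= i < n) \sum_(0 <= j < n) cc (Hee C kd a b i j) * (x i * x j).
  apply: eq_big_nat => i /andP [_ hi]; apply: eq_big_nat => j /andP [_ hj].
  by rewrite /ext_form !upper_lt // !hidx_lt.
have -> : \sum_(0 <= i < n) \sum_(0 <= j < n) cc (ext_form (Hb C kd a b) i (n + j)) * (x i * x (n + j)%N) =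
    \sum_(0 <= i < n) \sum_(0 <= j < n) cc (Hef C kd a b i j) * (x i * x (n + j)%N).
  apply: eq_big_nat => i /andP [_ hi]; apply: eq_bigr => j _.
  by rewrite /ext_form upper_lt // upper_add hidx_lt // hidx_add.
have -> : \sum_(0 <= i < n) \sum_(0 <= j < n) cc (ext_form (Hb C kd a b) (n + i) j) * (x (n + i)%N * x j) =
    \sum_(0 <= i < n) \sum_(0 <= j < n) cc (Hef C kd a b i j) * (x i * x (n + j)%N).
  rewrite exchange_big_nat; apply: eq_big_nat => j /andP [_ hj]; apply: eq_bigr => i _.
  by rewrite /ext_form upper_add (upper_lt hj) hidx_add (hidx_lt hj) /= [x (n + i)%N * _]mulrC.
have -> : \sum_(0 <= i < n) \sum_(0 <= j < n) cc (ext_form (Hb C kd a b) (n + i) (n + j)) * (x (n + i)%N * x (n + j)%N) = 0.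
  by rewrite big1 // => i _; rewrite big1 // => j _; rewrite /ext_form !upper_add fpsC0 mul0r.
rewrite Hee_sum // Hef_sum // /Qof rmorphD rmorph1; ring.
Qed.

Lemma two_neq0 : (2 : C) != 0. Proof. by rewrite pnatr_eq0. Qed.

Lemma fpsC_cancel c (f g : A) : c != 0 -> cc c * f = cc c * g -> f = g.
Proof.
move=> hc e; apply: fps_ext => a; have := congr1 (fun h : A => h a) e.
by rewrite !mulCE; apply: mulfI.
Qed.

Lemma fderiv_quad (H : 'I_(n.*2) -> 'I_(n.*2) -> C) (q : A) k : (forall i j, H i j = H j i) ->
  \sum_i \sum_j cc (H i j) * (fpsX C i * fpsX C j) = cc 2 * q ->
  fderiv k q = \sum_l cc (H k l) * fpsX C l.
Proof.
move=> hs e; apply: (fpsC_cancel two_neq0); rewrite -fderivCM -e raddf_sum /=.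
under eq_bigr do rewrite raddf_sum /=.
transitivity (\sum_i \sum_j ((k == i)%:R * (cc (H i j) * fpsX C j) + (k == j)%:R * (cc (H i j) * fpsX C i))).
  apply: eq_bigr => i _; apply: eq_bigr => j _; rewrite fderivCM fderivM !fderiv_fpsX; ring.
have D (F : 'I_(n.*2) -> A) : \sum_i (k == i)%:R * F i = F k.
  rewrite (bigD1 k) //= eqxx mul1r big1 ?addr0 // => i ne.
  by rewrite eq_sym (negbTE ne) mul0r.
under [LHS]eq_bigr do rewrite big_split /= -mulr_sumr D.
rewrite big_split /= D rmorphD rmorph1 mulrDl mul1r; congr (_ + _).
by apply: eq_bigr => i _; rewrite hs.
Qed.

Lemma Hb_sym kd a b s1 s2 i j : Hb C kd a b s1 s2 i j = Hb C kd a b s2 s1 j i.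
Proof.
case: s1; case: s2 => //=; rewrite /Hee (eq_sym i j).
by case: (j =P i) => [->|]; rewrite ?andbF.
Qed.

Lemma fderiv_Qof kd a b (k : 'I_(n.*2)) : (a < b)%N -> (b <= n)%N ->
  fderiv k (Qof kd a b) = \sum_(l < n.*2) cc (ext_form (Hb C kd a b) k l) * fpsX C l.
Proof.
move=> ab bn; apply: (fderiv_quad (H := fun k l : 'I_(n.*2) => ext_form (Hb C kd a b) k l)).
  by move=> i j; rewrite /ext_form Hb_sym.
exact: Qof_quad.
Qed.

Lemma sum_blocks (V : nmodType) (F : nat -> V) bs : (0 < size bs)%N -> sorted ltn bs ->
  \sum_(0 <= s < nblocks bs) \sum_(bstart bs s <= j < bend bs s) F j =
  \sum_(head 0%N bs <= j < last 0%N bs) F j.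
Proof.
elim/last_ind: bs => // bs y IH _ hs; case: (posnP (size bs)) => [/size0nil ->|h0].
  by rewrite /nblocks /= !big_geq.
have hs' : sorted ltn bs by move: hs; case: bs {IH h0} => //= z t; rewrite rcons_path => /andP [].
have hl : (last 0 bs < y)%N by move: hs; case: bs {IH hs'} h0 => //= z t _; rewrite rcons_path => /andP [].
have hh : head 0%N (rcons bs y) = head 0%N bs by case: (bs) h0.
have nb : nblocks (rcons bs y) = (nblocks bs).+1 by rewrite /nblocks size_rcons /=; lia.
rewrite nb big_nat_recr //= hh last_rcons.
have -> : bend (rcons bs y) (nblocks bs) = y by rewrite /bend /nblocks prednK // nth_rcons ltnn eqxx.
have -> : bstart (rcons bs y) (nblocks bs) = last 0%N bs.
  by rewrite /bstart /nblocks nth_rcons -nth_last; have -> : ((size bs).-1 < size bs)%N by lia.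
rewrite [RHS](@big_cat_nat _ _ _ (last 0%N bs)) /=; last exact: ltnW; last first.
  by case: (bs) h0 hs' => //= z t _; elim: t z => //= z' t IHt z /andP [h1 h2]; apply: leq_trans (IHt _ h2); apply: ltnW.
congr (_ + _); rewrite -(IH h0 hs'); apply: eq_big_nat => s /andP [_ hsb].
rewrite /bstart /bend !nth_rcons; rewrite /nblocks in hsb.
have -> : (s < size bs)%N by lia.
by have -> : (s.+1 < size bs)%N by lia.
Qed.

(** This is [M = - (J *m Z)] for the standard form and diagonal [Z]; the relation between partners
    turns [lam j - 1] into [- lam (n + j)]. *)
Lemma gamma_linE bs (lam : nat -> C) (k : 'I_(n.*2)) : (0 < size bs)%N -> sorted ltn bs ->
  head 0%N bs = 0%N -> last 0%N bs = n ->
  (forall s i, (s < nblocks bs)%N -> (bstart bs s <= i < bend bs s)%N -> lam i = lam (bstart bs s)) ->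
  (forall i, (i < n)%N -> lam i + lam (n + i)%N = 1) ->
  @gamma_lin C n bs lam k = \sum_(l < n.*2) cc (- omega_std C k l * lam l) * fpsX C l.
Proof.
move=> h0 hs hh hl hlam h1; rewrite /gamma_lin fpssumnE.
pose F j : A := (if (k : nat) == (n + j)%N then cc (lam j) * x j else 0) +
   (if (k : nat) == j then cc (lam j - 1) * x (n + j)%N else 0).
transitivity (\sum_(0 <= s < nblocks bs) \sum_(bstart bs s <= j < bend bs s) F j).
  apply: eq_big_nat => s /andP [_ hsb]; rewrite fpssumnE; apply: eq_big_nat => j hj.
  by rewrite fpsaddE !fpsscaleE -(hlam s j hsb hj).
rewrite sum_blocks // hh hl.
rewrite (sum_halves (fun l => cc (- (if (k + n == l)%N then 1 else if (l + n == k)%N then -1 else 0) * lam l) * x l)).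
rewrite /F -!big_split /=; apply: eq_big_nat => j /andP [_ hj]; congr (_ + _).
  have -> : (k + n == j)%N = false by lia.
  rewrite (addnC j n) (eq_sym _ (k : nat)); case: ifP => _; first by rewrite opprK mul1r.
  by rewrite oppr0 mul0r fpsC0 mul0r.
have -> : (k + n == n + j)%N = (k == j :> nat) by rewrite addnC eqn_add2l.
have -> : (n + j + n == k)%N = false by have := ltn_ord k; lia.
case: ifP => _; last by rewrite oppr0 mul0r fpsC0 mul0r.
congr (cc _ * _); apply/eqP; rewrite -subr_eq0.
have -> : lam j - 1 - - 1 * lam (n + j)%N = lam j + lam (n + j)%N - 1 by ring.
by rewrite h1 // subrr.
Qed.

End QuadraticForms.

(** * Linear parts of the form and of the field *)

Section LinearParts.
Variables (C : numClosedFieldType) (d : nat).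
Implicit Types (G Y : 'I_d -> fps C d).

Lemma vanish2_linvf (f : fps C d) (S : 'M[C]_d) i : cst f = 0 -> (forall j, lcoef f j = S i j) ->
  vanish 2 (f - linvf S i).
Proof.
move=> f0 hS a; rewrite ltnS leq_eqVlt ltnS leqn0 => /orP [/eqP h|].
  have [|k ak _] := @mon_fst _ a; first by rewrite -mdeg_eq0 h.
  have -> : a = monv d k.
    rewrite -(@msubK _ a (monv d k)) ?mle_monv //.
    have /eqP -> : msub a (monv d k) == mon0 d by rewrite -mdeg_eq0 mdeg_msub ?mle_monv // h mdeg_monv.
    by apply/ffunP => j; rewrite !ffunE.
  have := hS k; have := lcoef_linvf S i k; rewrite /lcoef fps_subE => -> ->.
  by rewrite subrr.
by rewrite mdeg_eq0 => /eqP ->; rewrite -cstE cstD cstN f0 based_linvf subrr.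
Qed.

Lemma lie_linear_part G Y k j : (forall i, cst (G i) = 0) -> (forall i, cst (Y i) = 0) ->
  lie_form1 Y G k = 0 ->
  (linpart G *m linpart Y + (linpart Y)^T *m linpart G) k j = 0.
Proof.
move=> hG hY /(congr1 (fun f => cst (fderiv j f))); rewrite lie_form1E vapplyE !raddfD /= !raddf_sum /= cstD.
rewrite !cst_sum => E; transitivity (cst (fderiv j (0 : fps C d))); last by rewrite raddf0.
rewrite -E !mxE; congr (_ + _); apply: eq_bigr => l _.
  by rewrite fderivM cstD !cstM hY mul0r addr0 !cst_fderiv !mxE mulrC.
by rewrite fderivM cstD !cstM hG mul0r addr0 !cst_fderiv !mxE mulrC.
Qed.

Lemma transf_linear_part (phi : 'I_d -> fps C d) G Y G' Y' : chart phi -> transf phi G Y G' Y' ->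
  (forall i, cst (G i) = 0) -> (forall i, cst (Y i) = 0) ->
  [/\ forall i, cst (G' i) = 0, forall i, cst (Y' i) = 0,
      linpart G = (linpart phi)^T *m linpart G' *m linpart phi &
      linpart phi *m linpart Y = linpart Y' *m linpart phi].
Proof.
move=> hc [tG tY] hG hY; have b := chart_based hc; have hu := linpart_chart hc.
(* At the origin the components of the form are transformed by the invertible Jacobian matrix. *)
have G'0 i : cst (G' i) = 0.
  pose v := \row_i cst (G' i).
  have v0 : v *m linpart phi = 0.
    apply/rowP => k; rewrite !mxE -[RHS](hG k) tG /pull cst_sum; apply: eq_bigr => l _.
    by rewrite !mxE cstM cst_fpscomp // cst_fderiv.
  have : v 0 i = 0 by rewrite -[v](mulmxK hu) v0 mul0mx mxE.
  by rewrite mxE.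
split=> //.
- by move=> i; rewrite -(cst_fpscomp b) -tY vapplyE cst_sum big1 // => l _; rewrite cstM hY mul0r.
- apply/matrixP => k j; rewrite mxE -cst_fderiv tG /pull raddf_sum cst_sum mxE /=.
  transitivity (\sum_i \sum_l lcoef (G' i) l * lcoef (phi l) j * lcoef (phi i) k).
    apply: eq_bigr => i _; rewrite fderivM cstD !cstM cst_fpscomp // G'0 mul0r addr0.
    rewrite fderiv_fpscomp // cst_sum mulr_suml; apply: eq_bigr => l _.
    by rewrite cstM cst_fpscomp // !cst_fderiv.
  rewrite exchange_big; apply: eq_bigr => l _; rewrite mxE mulr_suml; apply: eq_bigr => i _.
  by rewrite !mxE; ring.
- apply/matrixP => i j; rewrite !mxE.
  have := congr1 (fun f => cst (fderiv j f)) (tY i); rewrite vapplyE raddf_sum cst_sum fderiv_fpscomp // cst_sum /=.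
  move=> E; transitivity (\sum_l cst (fderiv j (Y l * fderiv l (phi i)))).
    apply: eq_bigr => l _; rewrite fderivM cstD !cstM hY mul0r addr0 !cst_fderiv !mxE; exact: mulrC.
  rewrite E; apply: eq_bigr => l _; by rewrite cstM cst_fpscomp // !cst_fderiv !mxE.
Qed.

Lemma linpart_linvf (S : 'M[C]_d) : linpart (linvf S) = S.
Proof. by apply/matrixP => i j; rewrite mxE lcoef_linvf. Qed.

End LinearParts.

Lemma trmx_nilpotent (C : numClosedFieldType) d (A : 'M[C]_d) k : A ^+ k = 0 -> (A^T) ^+ k = 0.
Proof.
move=> h; have -> : (A^T) ^+ k = (A ^+ k)^T; last by rewrite h trmx0.
elim: k {h} => [|k IH]; first by rewrite !expr0 trmx1.
by rewrite exprS IH exprSr -!mulmxE trmx_mul.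
Qed.

Definition normalized (C : numClosedFieldType) d (M B Z J : 'M[C]_d) (w : 'I_d -> C * C) (G Y : 'I_d -> fps C d) :=
  [/\ [/\ J = M^T - M, J \in unitmx & M = - (J *m Z)],
      [/\ forall i j, Z i j != 0 -> w i = w j, forall i j, B i j != 0 -> w i = w j
        & forall i j, J i j != 0 -> w i + w j = (1, 0)],
      (exists k, (Z - \matrix_(i, j) ((w i).1 *+ (i == j))) ^+ k = 0) /\
      (exists k, (B - \matrix_(i, j) ((w i).2 *+ (i == j))) ^+ k = 0),
      (forall i, vanish 2 (G i - linvf M i)) /\ (forall i, vanish 2 (Y i - linvf B i)) &
      [/\ forall i, supp_in (fun a => mwt w a + w i == (1, 0)) (G i),
          forall i, supp_in (fun a => mwt w a == w i) (Y i) &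
          forall i j, fderiv i (G j) - fderiv j (G i) = fpsC d (J i j)]].

Lemma normal_coordinates (C : numClosedFieldType) d (G Y : 'I_d -> fps C d) : (0 < d)%N ->
  (forall i, cst (G i) = 0) -> (forall i, cst (Y i) = 0) ->
  \matrix_(i, j) cst (fderiv i (G j) - fderiv j (G i)) \in unitmx ->
  (forall k, lie_form1 Y G k = 0) ->
  exists phi G' Y' M B Z J w, [/\ chart phi, transf phi G Y G' Y' & normalized M B Z J w G' Y'].
Proof.
case: d G Y => // d G Y _ hG hY hJ hL.
pose M0 := linpart G; pose B0 := linpart Y; pose J0 := M0^T - M0.
have J0u : J0 \in unitmx.
  have <- // : \matrix_(i, j) cst (fderiv i (G j) - fderiv j (G i)) = J0.
  by apply/matrixP => i j; rewrite !mxE cstD cstN !cst_fderiv.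
(* Linear part of the dual field: its contraction with the exterior derivative reads
   [J0^T *m Z0 = M0], and [J0^T = - J0] gives the sign. *)
pose Z0 := - (invmx J0 *m M0).
have JZ : J0 *m Z0 = - M0 by rewrite /Z0 mulmxN mulKVmx.
have J0T : J0^T = - J0 by rewrite /J0 linearB /= trmxK opprB.
have MB : M0 *m B0 = - (B0^T *m M0).
  by apply/eqP; rewrite -addr_eq0; apply/eqP/matrixP => k j; rewrite [RHS]mxE; apply: lie_linear_part.
have hZ : Z0^T *m J0 = J0 *m (1%:M - Z0).
  have -> : Z0^T *m J0 = M0^T by apply: oppr_inj; rewrite -mulmxN -J0T -trmx_mul JZ raddfN.
  by rewrite mulmxBr mulmx1 JZ opprK /J0 subrK.
have hB : B0^T *m J0 = J0 *m (0%:M - B0).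
  rewrite raddf0 sub0r mulmxN /J0 mulmxBl mulmxBr.
  have e : B0^T *m M0^T = - (M0^T *m B0) by rewrite -trmx_mul MB linearN /= trmx_mul trmxK.
  by rewrite e MB opprK opprD.
(* [Z0] is determined by [M0] and [J0], both of which are preserved by [B0]. *)
have ZB : Z0 *m B0 = B0 *m Z0.
  apply: (can_inj (mulKmx J0u)); rewrite !mulmxA JZ mulNmx MB opprK.
  have -> : J0 *m B0 = - (B0^T *m J0) by rewrite hB raddf0 sub0r mulmxN opprK.
  by rewrite mulNmx -mulmxA JZ mulmxN opprK.
have [W [w [hW [Zgr Bgr] Jgr nilt [k2 nil2]]]] := eigen_coordinates hZ hB ZB.
set Z := W *m Z0 *m invmx W in Zgr nilt; set B := W *m B0 *m invmx W in Bgr nilt nil2.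
set J := (invmx W)^T *m J0 *m invmx W in Jgr.
have hc1 := chart_linvf hW.
have [G1 [Y1 t1]] := transf_ex G Y hc1.
have [G10 Y10 lG lY] := transf_linear_part hc1 t1 hG hY.
rewrite linpart_linvf -/M0 in lG; rewrite linpart_linvf -/B0 in lY.
pose M := linpart G1.
have WT : (invmx W)^T *m W^T = 1%:M by rewrite -trmx_mul mulmxV // trmx1.
have ME : M = (invmx W)^T *m M0 *m invmx W.
  by rewrite lG !mulmxA WT mul1mx mulmxK.
have BE : linpart Y1 = B by rewrite /B lY mulmxK.
have JE : J = M^T - M.
  by rewrite ME !trmx_mul trmxK /J /J0 mulmxBr mulmxBl !mulmxA.
have Ju : J \in unitmx by rewrite /J !unitmx_mul unitmx_tr unitmx_inv hW J0u.
have MJZ : M = - (J *m Z).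
  rewrite ME /J /Z !mulmxA mulmxKV // -[_ *m J0 *m Z0]mulmxA JZ mulmxN mulNmx opprK.
  by [].
have BJ : B^T *m J = - (J *m B).
  rewrite /B /J !trmx_mul !mulmxA -[_ *m W^T *m (invmx W)^T]mulmxA -(trmx_mul (invmx W) W) mulVmx // trmx1 mulmx1.
  rewrite -[_ *m B0^T *m J0]mulmxA hB raddf0 sub0r mulmxN mulmxN mulNmx mulmxKV // !mulmxA.
  by [].
have ZBc : Z *m B = B *m Z.
  by rewrite /Z /B !mulmxA !mulmxKV // -!(mulmxA W) ZB.
have hL1 := lie_transf0 hc1 t1 hL.
have vG1 i : vanish 2 (G1 i - linvf M i) by apply: vanish2_linvf => // j; rewrite mxE.
have vY1 i : vanish 2 (Y1 i - linvf B i) by apply: vanish2_linvf => // j; rewrite -BE mxE.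
have [phi [G2 [Y2 [hc2 t2 vv ss cl]]]] := normalize JE Ju MJZ BJ ZBc Zgr Bgr Jgr nilt vG1 vY1 hL1.
exists (fun i => fpscomp (phi i) (linvf W)), G2, Y2, M, B, Z, J, w; split.
- exact: chart_comp.
- by apply: transf_comp t1 t2; apply: chart_based.
split=> //; last by case: ss.
split; last by exists k2.
have [k hk] := nilt 0; exists k; rewrite -[RHS]hk scale0r addr0; congr ((_ - _) ^+ _).
by apply/matrixP => i j; rewrite !mxE mul0r addr0.
Qed.
(** * Primitive coordinates *)

Section PrimitiveCoordinates.
Variables (C : numClosedFieldType).

Lemma sandwich_entry d m (E : 'M[C]_(m, d)) (A : 'M[C]_d) k l :
  (E *m A *m E^T) k l = (row k E *m A *m (row l E)^T) 0 0.
Proof.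
rewrite [LHS]mxE [RHS]mxE; apply: eq_bigr => i _; rewrite [(_ *m A) k i]mxE [(_ *m A) 0 i]mxE; congr (_ * _).
  by apply: eq_bigr => j _; rewrite mxE.
by rewrite [LHS]mxE [RHS]mxE mxE.
Qed.

Lemma vapply_linvf d (Y : vf C d) (A : 'M[C]_d) k : vapply Y (linvf A k) = \sum_l fpsC d (A k l) * Y l.
Proof. by rewrite linvfE vapply_sum; apply: eq_bigr => l _; rewrite vapplyCM vapplyX. Qed.

Variable n : nat.
Local Notation d := n.*2.

Definition omega_mx : 'M[C]_d := \matrix_(j, k) omega_std C j k.

Lemma hidx_ord (k : 'I_d) : (hidx n k < n)%N.
Proof. by rewrite /hidx; case: (ltnP k n) => // h; have := ltn_ord k; lia. Qed.

Lemma omega_half (k l : 'I_d) : omst C (upper n k) (upper n l) * (hidx n k == hidx n l)%:R = omega_std C k l.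
Proof.
rewrite /omst /upper /hidx /omega_std; have := ltn_ord k; have := ltn_ord l.
case: (leqP n k) => hk; case: (leqP n l) => hl h1 h2.
- have -> : (k + n == l)%N = false by lia.
  have -> : (l + n == k)%N = false by lia.
  by rewrite mul0r.
- have -> : (k + n == l)%N = false by lia.
  have -> : (k - n == l)%N = (l + n == k)%N by lia.
  by case: ifP => _; rewrite ?mulr1 ?mulr0.
- have -> : (k == l - n :> nat)%N = (k + n == l)%N by lia.
  have -> : (l + n == k)%N = false by lia.
  by case: ifP => _; rewrite ?mulr1 ?mulr0.
- have -> : (k + n == l)%N = false by lia.
  have -> : (l + n == k)%N = false by lia.
  by rewrite mul0r.
Qed.

Lemma omega_mx_unit : omega_mx \in unitmx.
Proof.
suff h : omega_mx *m omega_mx = - 1%:M.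
  have e : omega_mx *m (- omega_mx) = 1%:M by rewrite mulmxN h opprK.
  by have [] := mulmx1_unit e.
apply/matrixP => k m; rewrite !mxE.
have hp : ((if (k < n)%N then k + n else k - n) < d)%N by have := ltn_ord k; case: ifP; lia.
rewrite (bigD1 (Ordinal hp)) //= big1 ?addr0 => [|l ne].
  rewrite !mxE /omega_std /= -(inj_eq val_inj) /=; have := ltn_ord k; have := ltn_ord m; case: (ltnP k n) => hk hm h2.
    rewrite eqxx mul1r; have -> : (k + n + n == m)%N = false by lia.
    have -> : (m + n == k + n)%N = (k == m :> nat) by lia.
    by case: eqP => _; rewrite ?mulr1n ?mulr0n ?oppr0.
  have -> : (k + n == k - n)%N = false by lia.
  have -> : (k - n + n == k)%N by lia.
  have -> : (k - n + n == m)%N = (k == m :> nat) by lia.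
  have -> : (m + n == k - n)%N = false by lia.
  by case: eqP => _; rewrite ?mulr1n ?mulr0n ?oppr0 ?mulr1 ?mulr0.
rewrite !mxE /omega_std; have {}ne : (l : nat) != (if (k < n)%N then k + n else k - n)%N := ne.
have := ltn_ord l; have := ltn_ord k; move: ne; case: ifP => hk ne h1 h2.
  have -> : (k + n == l)%N = false by lia.
  have -> : (l + n == k)%N = false by lia.
  by rewrite mul0r.
have -> : (k + n == l)%N = false by lia.
have -> : (l + n == k)%N = false by lia.
by rewrite mul0r.
Qed.

Lemma Qof_admissible (lam : nat -> C) kd a b : (a < b)%N -> kind_ok (lam a) (b - a) kd ->
  @Q_admissible C n lam a b (@Qof C n kd a b).
Proof.
move=> ab; rewrite /kind_ok /Q_admissible; case: ifP => _.
  move=> ->; right; rewrite /Qof /= addr0 fpssumnE //.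
case=> [->|[-> ho]]; rewrite /Qof /=.
  apply: Or43; rewrite fpsaddE !fpsscaleE fpssumnE //.
(* A block of kind 2 and length one has an empty sum and counts as [Q = 0]; any other odd length is
   at least 3. *)
rewrite addr0; have [L1|L1] := eqVneq (b - a)%N 1%N.
  apply: Or41; rewrite big_geq; last lia.
  by rewrite mulr0.
apply: Or44; split=> //; last by rewrite fpsscaleE fpssumnE.
by move: ho L1; case: (b - a)%N => [|[|[|]]].
Qed.

(** The diagonalizing matrix is explicit so that the theta direction can be added to it. *)
Definition semisimple_data (A S : 'M[C]_d) := [/\ exists P v, P \in unitmx /\ P *m S = diag_mx v *m P,
  S *m (A - S) = (A - S) *m S & exists k, (A - S) ^+ k = 0].

(** Only a linear change is left: a Darboux basis adapted to the nilpotent part of [Z] brings the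
    quadratic part to the listed forms, and the weight conditions are carried along by
    conjugation. *)
Lemma primitive_coordinates M B Z J w (G Y : 'I_d -> fps C d) : (0 < n)%N -> normalized M B Z J w G Y ->
  exists phi G' Y' bs lam Q R S, [/\ chart phi, transf phi G Y G' Y', primitive_normal_form G' bs lam Q R,
    semisimple_data (linpart Y') S /\ (forall k, linop S (Y' k) = vapply Y' (linvf S k)) &
    linop S (Qtotal bs Q) = 0 /\ linop S R = 0].
Proof.
move=> n0 [[JE Ju MJZ] [Zgr Bgr Jgr] [[k1 nil1] [k2 nil2]] [vG vY] [sG sY cl]].
have mdiag (u : 'I_d -> C) : \matrix_(i, j) (u i *+ (i == j)) = diag_mx (\row_i u i).
  by apply/matrixP => i j; rewrite !mxE.
pose D1 := diag_mx (\row_i (w i).1); pose D2 := diag_mx (\row_i (w i).2).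
rewrite (mdiag (fun i => (w i).1)) -/D1 in nil1; rewrite (mdiag (fun i => (w i).2)) -/D2 in nil2.
(* The block construction acts on row vectors, so the nilpotent part enters through its
   transpose. *)
pose N := Z - D1; pose K := N^T.
have JT : J^T = - J by rewrite JE linearB /= trmxK opprB.
have D1J : D1 *m J = J *m (1%:M - D1).
  apply/matrixP => i j; rewrite mulmxBr mulmx1 mul_diag_mx mul_mx_diag !mxE.
  have [->|/Jgr h] := eqVneq (J i j) 0; first by rewrite mulr0 mul0r subr0.
  have -> : (w i).1 = 1 - (w j).1 by have := congr1 fst h => /= <-; rewrite addrK.
  by ring.
have D2J : D2 *m J = - (J *m D2).
  apply/matrixP => i j; rewrite mul_diag_mx mul_mx_diag !mxE.
  have [->|/Jgr h] := eqVneq (J i j) 0; first by rewrite mulr0 mul0r oppr0.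
  have -> : (w i).2 = - (w j).2 by apply/eqP; rewrite -addr_eq0; have := congr1 snd h => /= ->.
  by ring.
have ZJ : Z^T *m J = J *m (1%:M - Z).
  have MT : M^T = Z^T *m J by rewrite MJZ linearN /= trmx_mul JT mulmxN opprK.
  by rewrite mulmxBr mulmx1 -MT {1}JE MJZ; rewrite opprK addrK.
have NJ : K *m J = - (J *m K^T).
  rewrite trmxK /K /N linearB /= tr_diag_mx mulmxBl ZJ D1J -mulmxBr -mulmxN; congr (_ *m _).
  by rewrite !opprB addrC addrA subrK.
have Kgr i j : K i j != 0 -> (w i).1 = (w j).1.
  rewrite !mxE; have [->//|ne] := eqVneq i j; rewrite mulr0n subr0 => /Zgr h.
  by rewrite h.
have [n1 [bs [lamn [kd [gg [dn]]]]]] := symplectic_normal_form (lam := fun i => (w i).1) Ju JT NJ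
  (ex_intro _ _ (trmx_nilpotent nil1)) (fun i j h => congr1 fst (Jgr i j h)) Kgr.
have {dn}-> : n1 = n by apply: double_inj.
move=> [[b0 bsrt bh bl] hk hh [hg _] hbe].
pose E := \matrix_(k < d) gg (upper n k) (hidx n k).
have rowE k : row k E = gg (upper n k) (hidx n k) by apply/rowP => j; rewrite !mxE.
have EJE : E *m J *m E^T = omega_mx.
  apply/matrixP => k l; rewrite sandwich_entry !rowE [RHS]mxE -omega_half.
  exact: hg (hidx_ord k) (hidx_ord l).
have Eu : E \in unitmx.
  have := omega_mx_unit; rewrite -EJE !unitmx_mul => /andP [/andP [] //].
pose lam (i : nat) := if (i < n)%N then lamn i else 1 - lamn (i - n)%N.
have Egr k a : E k a != 0 -> (w a).1 = lam k.
  rewrite mxE => /(hh _ _ (hidx_ord k)) ->; rewrite /lam /upper /hidx.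
  by case: (leqP n k) => h.
pose D3 := diag_mx (\row_(i < d) lam i).
have ED : D1 *m E^T = E^T *m D3.
  apply/matrixP => a k; rewrite mul_diag_mx mul_mx_diag !mxE.
  have [h|h] := eqVneq (E k a) 0; first by move: h; rewrite mxE => ->; rewrite mulr0 mul0r.
  by rewrite (Egr k a h) mulrC.
(* The rows of [E] are the new basis vectors, so the new coordinates are obtained from the old ones
   by the inverse of [E^T]. *)
pose U := E^T; pose W := invmx U.
have Uu : U \in unitmx by rewrite unitmx_tr.
have UW : U *m W = 1%:M by apply: mulmxV.
have WU : W *m U = 1%:M by apply: mulVmx.
have hc : chart (linvf W) by apply: chart_linvf; rewrite unitmx_inv.
have hb := chart_based hc.
pose bt := - (E *m J *m N *m E^T).
have JN_sym : (J *m N)^T = J *m N by rewrite trmx_mul JT mulmxN -/K NJ opprK trmxK.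
have btE k l : bt k l = blockwise_form C bs kd (upper n k) (upper n l) (hidx n k) (hidx n l).
  rewrite -hbe ?hidx_ord // -!rowE /be /om -[_ *m K *m J]mulmxA NJ trmxK mulmxN mulNmx [RHS]mxE mulmxA.
  by rewrite mxE -[E *m J *m N]mulmxA sandwich_entry mulmxA.
have bt_sym : bt^T = bt.
  by rewrite /bt linearN /= trmx_mul trmxK -[E *m J *m N]mulmxA trmx_mul JN_sym !mulmxA.
pose M3 := E *m M *m E^T.
have M3E : M3 = - (omega_mx *m D3) + bt.
  rewrite /M3 MJZ mulmxN mulNmx -EJE /bt -opprD; congr (- _).
  rewrite -[E *m J *m E^T *m D3]mulmxA -ED -(mulmxA E J) -[E *m (J *m Z) *m _]mulmxA -[_ *m J *m N *m _]mulmxA.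
  rewrite -!(mulmxA E) -mulmxDr; congr (_ *m _); rewrite -!mulmxA -mulmxDr; congr (_ *m _).
  by rewrite -mulmxDl /N addrC subrK.
have WM : W^T *m M3 *m W = M.
  rewrite /M3 !mulmxA; have -> : W^T *m E = 1%:M by rewrite -[E]trmxK -trmx_mul UW trmx1.
  by rewrite mul1mx -mulmxA UW mulmx1.
have vanM i : vanish 2 (G i - linvf M i) := vG i.
(* The linear part has the same constant exterior derivative as the whole form, so the difference is
   closed. *)
have [R R0 dR] : exists2 R, cst R = 0 & forall j, fderiv j R = G j - linvf M j.
  apply: poincare => i j; rewrite !raddfB /= !fderiv_linvf; apply/eqP; rewrite -subr_eq0.
  have -> : fderiv i (G j) - fpsC d (M j i) - (fderiv j (G i) - fpsC d (M i j)) =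
    (fderiv i (G j) - fderiv j (G i)) - (fpsC d (M j i) - fpsC d (M i j)) by ring.
  by rewrite cl -raddfB JE !mxE subrr.
have Rsupp : supp_in (fun a => (mwt w a == (1, 0)) && (3 <= mdeg a)%N) R.
  apply: supp_of_fderiv => // k a; rewrite dR => nz; apply/andP; split.
    rewrite mwt_madd mwt_monv; have := @supp_inD _ _ (fun a => mwt w a + w k == (1, 0)) _ _ (sG k) _ _ nz.
    apply; apply: supp_inN; rewrite linvfE; apply: supp_in_sum => l.
    have [->|nzM] := eqVneq (M k l) 0; first by rewrite fpsC0 mul0r; apply: supp_in0.
    apply/supp_inCM/supp_in_fpsX; rewrite mwt_monv.
    have /existsP [p] : [exists p, J k p * Z p l != 0].
      move: nzM; rewrite MJZ !mxE oppr_eq0; apply: contraNT; rewrite negb_exists => /forallP h.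
      by rewrite big1 // => p _; apply/eqP; rewrite -[_ == _]negbK h.
    by rewrite mulf_eq0 negb_or => /andP [/Jgr h1 /Zgr h2]; rewrite -h2 addrC h1.
  rewrite mdeg_madd mdeg_monv addn1 ltnS leqNgt; apply: contraNN nz => h.
  by apply/eqP/vanM.
have wsplit a : mwt w a = (1, 0) -> mwt (fun i => (w i).1) a = 1 /\ mwt (fun i => (w i).2) a = 0.
  move=> h; have := congr1 fst h; have := congr1 snd h; rewrite /mwt !raddf_sum /= => h2 h1.
  by split; [apply: etrans h1 | apply: etrans h2]; apply: eq_bigr => i _;
    elim: (a i) => [|p IH]; rewrite ?mulr0n // !mulrS /= IH.
have D1R : linop D1 R = R.
  rewrite /D1 -mdiag; apply: fps_ext => a; rewrite linop_diag; have [->|/Rsupp] := eqVneq (R a) 0; first by rewrite mulr0.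
  by move=> /andP [/eqP /wsplit [-> _] _]; rewrite mul1r.
have D2R : linop D2 R = 0.
  rewrite /D2 -mdiag; apply: fps_ext => a; rewrite linop_diag; have [->|/Rsupp] := eqVneq (R a) 0; first by rewrite mulr0.
  by move=> /andP [/eqP /wsplit [_ ->] _]; rewrite mul0r.
pose R3 := fpscomp R (linvf U).
have R3K : fpscomp R3 (linvf W) = R.
  have h := inv_chart_linvf Uu; exact: (inv_chartK R h).
pose G3 k := linvf M3 k + fderiv k R3.
have [G3' [Y3 [_ tY]]] := transf_ex G Y hc.
have t3 : transf (linvf W) G Y G3 Y3.
  split=> // k; rewrite /pull /G3; under eq_bigr do rewrite fpscompD mulrDl.
  rewrite big_split /= -fderiv_fpscomp // R3K dR.
  suff -> : \sum_i fpscomp (linvf M3 i) (linvf W) * fderiv k (linvf W i) = linvf M k by rewrite addrC subrK.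
  under eq_bigr do rewrite linvf_comp fderiv_linvf linvfE mulr_suml.
  rewrite exchange_big linvfE -WM -mulmxA; apply: eq_bigr => l _; rewrite [in RHS]mxE raddf_sum mulr_suml /=.
  by apply: eq_bigr => i _; rewrite [W^T _ _]mxE fpsCM; ring.
(* The new basis is homogeneous for the first weights only, so the semisimple part of the field need
   not stay diagonal. *)
pose S3 := W *m D2 *m U.
have S3W : S3 *m W = W *m D2 by rewrite /S3 -mulmxA UW mulmx1.
have D3W : D3 *m W = W *m D1.
  by rewrite -[D3]mul1mx -WU -[W *m U *m D3]mulmxA -ED -/U !mulmxA -[_ *m U *m W]mulmxA UW mulmx1.
have nat_op A A' f : A' *m W = W *m A -> fpscomp (linop A' f) (linvf W) = linop A (fpscomp f (linvf W)).
  move=> h; rewrite [in RHS]/linop (@vapply_fpscomp _ _ _ (linvf W) (linvf A) (linvf A')) // => i.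
  by rewrite -/(linop A _) linop_linvf linvf_comp h.
pose Q s := @Qof C n (kd s) (bstart bs s) (bend bs s).
have en_le s : (s < nblocks bs)%N -> (bend bs s <= n)%N.
  by move=> hs; rewrite /bend -bl; apply: nth_le_last => //; rewrite /nblocks in hs; lia.
have st_lt s : (s < nblocks bs)%N -> (bstart bs s < bend bs s)%N.
  move=> hs; rewrite /nblocks in hs; rewrite /bstart /bend.
  by apply: (sorted_ltn_nth ltn_trans 0%N bsrt); rewrite ?inE; lia.
have dQ k : \sum_(0 <= s < nblocks bs) fderiv k (Q s) = linvf bt k.
  transitivity (\sum_(0 <= s < nblocks bs) \sum_(l < d) fpsC d (ext_form n (Hb C (kd s) (bstart bs s) (bend bs s)) k l) * fpsX C l).
    by apply: eq_big_nat => s /andP [_ hs]; apply: fderiv_Qof; [apply: st_lt | apply: en_le].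
  rewrite exchange_big linvfE; apply: eq_bigr => l _; rewrite btE /blockwise_form big_mkord raddf_sum mulr_suml.
  by [].
have lam_lt i : (i < n)%N -> lam i = lamn i by rewrite /lam => ->.
have lam_st s : (s < nblocks bs)%N -> lam (bstart bs s) = lamn (bstart bs s).
  by move=> hs; apply: lam_lt; apply: leq_trans (st_lt s hs) (en_le s hs).
have lam_blk s i : (s < nblocks bs)%N -> (bstart bs s <= i < bend bs s)%N -> lam i = lam (bstart bs s).
  move=> hs hi; rewrite lam_st // lam_lt; first by have [_] := hk s hs; apply.
  by case/andP: hi => _ hi; apply: leq_trans hi (en_le s hs).
have lam_sum i : (i < n)%N -> lam i + lam (n + i)%N = 1.
  by move=> hi; rewrite /lam hi ltnNge leq_addr /= addKn addrC subrK.
have D3R : linop D3 R3 = R3.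
  by apply: (chart_inj hc); rewrite (nat_op D1) // R3K.
have Y0 i : cst (Y i) = 0.
  apply/vanish1P; rewrite -(subrK (linvf B i) (Y i)); apply: vanishD (vanish_linvf _ _).
  exact: vanish_le (vY i).
have G0 i : cst (G i) = 0.
  apply/vanish1P; rewrite -(subrK (linvf M i) (G i)); apply: vanishD (vanish_linvf _ _).
  exact: vanish_le (vG i).
have [_ _ _ lY] := transf_linear_part hc t3 G0 Y0; rewrite linpart_linvf in lY.
have LY : linpart Y = B.
  apply/matrixP => i j; rewrite mxE; have := vY i (monv d j); rewrite mdeg_monv => /(_ isT).
  by rewrite fps_subE => /eqP; rewrite subr_eq0 => /eqP; rewrite /lcoef => ->; apply: lcoef_linvf.
have LY3 : linpart Y3 = W *m B *m U.
  by rewrite -LY lY -mulmxA WU mulmx1.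
have conjM (A A' : 'M[C]_d) : (W *m A *m U) *m (W *m A' *m U) = W *m (A *m A') *m U.
  by rewrite !mulmxA -[_ *m U *m W]mulmxA UW mulmx1.
have BD : linpart Y3 - S3 = W *m (B - D2) *m U by rewrite LY3 /S3 -mulmxBl -mulmxBr.
have D2B : D2 *m B = B *m D2.
  apply/matrixP => i j; rewrite mul_diag_mx mul_mx_diag !mxE.
  by have [->|/Bgr ->] := eqVneq (B i j) 0; [rewrite mulr0 mul0r | rewrite mulrC].
have D2N : D2 *m N = N *m D2.
  apply/matrixP => i j; rewrite mul_diag_mx mul_mx_diag [LHS]mxE [RHS]mxE.
  have [->|nz] := eqVneq (N i j) 0; first by rewrite mulr0 mul0r.
  suff wE : w i = w j by rewrite !(mxE _ _ 0) wE mulrC.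
  move: nz; rewrite !mxE; have [->//|ne] := eqVneq i j; rewrite subr0; exact: Zgr.
exists (linvf W), G3, Y3, bs, lam, Q, R3, S3; split=> //.
- split.
  + move=> j k; rewrite fpssubE /G3 !raddfD /= !fderiv_linvf (fderiv_comm j k).
    have -> : fpsC d (omega_std C j k) = fpsC d (M3 k j) - fpsC d (M3 j k).
      rewrite -raddfB; congr (fpsC d _); have <- : omega_mx j k = omega_std C j k by rewrite mxE.
      rewrite -EJE JE mulmxBr mulmxBl; have -> : E *m M^T *m E^T = M3^T.
        by rewrite /M3 !trmx_mul trmxK !mulmxA.
        rewrite -/M3 [LHS]mxE; congr (_ + _); first by rewrite mxE.
        by rewrite mxE.
    ring.
  (* A list with a single entry would force [n = 0]. *)
  + split=> //; case: bs b0 {bsrt hk hbe lam_blk lam_st st_lt en_le dQ btE Q} bh bl => [|y [|]] //= _ -> e.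
    by rewrite -e in n0.
  + exact: lam_sum.
  + move=> s i j hs hi ij hj; rewrite (lam_blk s i) ?(lam_blk s j) //; first by rewrite hj andbT (leq_trans hi) // ltnW.
    by rewrite hi (ltn_trans ij).
  + split; [|split].
    * move=> s hs; apply: Qof_admissible; first exact: st_lt.
      by rewrite lam_st //; have [] := hk s hs.
    (* Being fixed by the diagonal operator with entries [lam] puts each monomial of [R3] on weight
       1; the order 3 is that of [R], kept by a linear substitution. *)
    * move=> a nz; split.
        have := congr1 (fun f : fps C d => f a) D3R; rewrite /D3 -(mdiag (fun i : 'I_d => lam i)) linop_diag.
        rewrite -{2}[R3 a]mul1r => /(mulIf nz) e; apply: etrans e; apply: eq_bigr => i _; exact: mulr_natl.
      rewrite leqNgt; apply: contraNN nz => h; apply/eqP.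
      apply: (vanish_fpscomp (based_linvf U) (n := 3)) => // b lt_b; apply/eqP; apply: contraT.
      by move=> /Rsupp /andP [_]; rewrite leqNgt lt_b.
    * move=> k; rewrite !fpsaddE fpssumnE dQ /G3 addrA; congr (_ + _).
      rewrite (gamma_linE (lam := lam) k b0 bsrt bh bl lam_blk lam_sum) M3E !linvfE -big_split.
      apply: eq_bigr => l _ /=; rewrite [in LHS]mxE raddfD /= mulrDl; congr (fpsC d _ * _ + _).
      by rewrite mxE mul_mx_diag !mxE mulNr.
- split.
    split.
    + by exists U, (\row_i (w i).2); rewrite -/D2 /S3 !mulmxA UW mul1mx.
    + by rewrite BD /S3 !conjM mulmxBr mulmxBl D2B.
    + exists k2; rewrite BD.
      have -> k : (W *m (B - D2) *m U) ^+ k = W *m ((B - D2) ^+ k) *m U.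
        elim: k => [|k IH]; first by rewrite !expr0 mulmx1 WU.
        by rewrite !exprS IH -!mulmxE conjM.
      by rewrite nil2 mulmx0 mul0mx.
  move=> k; apply: (chart_inj hc); rewrite (nat_op D2) // -tY.
  rewrite -(vapply_fpscomp _ hb tY) linvf_comp S3W !vapply_linvf /linop vapply_sum.
  apply: eq_bigr => l _; rewrite vapplyCM -/(linop D2 _) mul_mx_diag !mxE fpsCM -mulrA; congr (_ * _).
  rewrite /D2 -mdiag; apply: fps_ext => a; rewrite linop_diag mulCE.
  have [->|/sY /eqP h] := eqVneq (Y l a) 0; first by rewrite !mulr0.
  congr (_ * _); have := congr1 snd h; rewrite /mwt raddf_sum /= => <-.
  by apply: eq_bigr => i _; elim: (a i) => [|p IH]; rewrite ?mulr0n // !mulrS /= IH.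
- split; last by apply: (chart_inj hc); rewrite (nat_op D2) // R3K D2R -(fpsC0 C d) fpscompC // fpsC0.
  rewrite /linop vapplyE /Qtotal fpssumnE.
  under eq_bigr do rewrite raddf_sum dQ.
  apply: fderiv_inj0 => [|j]; first by rewrite cst_sum big1 // => k _; rewrite cstM based_linvf mul0r.
  rewrite raddf_sum /=.
  (* The derivative of a quadratic form along a linear field is again quadratic, with this Hessian;
     it vanishes since [D2] is skew for [J] and commutes with [N]. *)
  transitivity (linvf (S3^T *m bt + bt^T *m S3) j).
    rewrite linvfE; under eq_bigr do rewrite fderivM !fderiv_linvf.
    rewrite big_split /=; under [in RHS]eq_bigr do rewrite mxE raddfD mulrDl /=.
    rewrite [in RHS]big_split /=; congr (_ + _).
      under eq_bigr do rewrite linvfE mulr_sumr.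
      rewrite exchange_big; apply: eq_bigr => l _; rewrite mxE raddf_sum mulr_suml.
      by apply: eq_bigr => k _; rewrite [S3^T _ _]mxE /= fpsCM; ring.
    under eq_bigr do rewrite linvfE mulr_suml.
    rewrite exchange_big; apply: eq_bigr => l _; rewrite mxE raddf_sum mulr_suml.
    by apply: eq_bigr => k _; rewrite [bt^T _ _]mxE /= fpsCM; ring.
  suff -> : S3^T *m bt + bt^T *m S3 = 0.
    by rewrite linvfE big1 // => l _; rewrite mxE fpsC0 mul0r.
  rewrite bt_sym /S3 /bt mulmxN mulNmx -opprD.
  have -> : (W *m D2 *m U)^T *m (E *m J *m N *m E^T) = E *m (D2 *m J *m N) *m E^T.
    have WE : W^T *m E = 1%:M by rewrite -[E]trmxK -trmx_mul UW trmx1.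
    rewrite !trmx_mul trmxK tr_diag_mx !mulmxA -[_ *m W^T *m E]mulmxA WE mulmx1 //.
  have -> : E *m J *m N *m E^T *m (W *m D2 *m U) = E *m (J *m N *m D2) *m E^T.
    by rewrite !mulmxA -[_ *m E^T *m W]mulmxA UW mulmx1.
  rewrite -mulmxDl -mulmxDr D2J mulNmx -[J *m D2 *m N]mulmxA D2N mulmxA addNr.
  by rewrite mulmx0 mul0mx oppr0.
Qed.

End PrimitiveCoordinates.

(** * Reinstating theta *)

Section CornerMatrices.
Variables (C : numClosedFieldType) (d : nat).

(** Block-diagonal matrix with [c] in the theta slot, written with [unlift] to match [coordsys]. *)
Definition corner_mx (c : C) (A : 'M[C]_d) : 'M[C]_d.+1 := \matrix_(i, j)
  match unlift ord0 i, unlift ord0 j with None, None => c | Some i', Some j' => A i' j' | _, _ => 0 end.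

Lemma corner_mx00 c A : corner_mx c A ord0 ord0 = c.
Proof. by rewrite mxE unlift_none. Qed.
Lemma corner_mx0l c A i : corner_mx c A ord0 (lift ord0 i) = 0.
Proof. by rewrite mxE unlift_none liftK. Qed.
Lemma corner_mxl0 c A i : corner_mx c A (lift ord0 i) ord0 = 0.
Proof. by rewrite mxE unlift_none liftK. Qed.
Lemma corner_mxll c A i j : corner_mx c A (lift ord0 i) (lift ord0 j) = A i j.
Proof. by rewrite mxE !liftK. Qed.
Definition corner_mxE := (corner_mx00, corner_mx0l, corner_mxl0, corner_mxll).

Lemma corner_mxP (M : 'M[C]_d.+1) c (A : 'M[C]_d) : M ord0 ord0 = c -> (forall i, M ord0 (lift ord0 i) = 0) ->
  (forall i, M (lift ord0 i) ord0 = 0) -> (forall i j, M (lift ord0 i) (lift ord0 j) = A i j) ->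
  M = corner_mx c A.
Proof.
move=> h1 h2 h3 h4; apply/matrixP => i j.
by case: (unliftP ord0 i) => [i'|] ->; case: (unliftP ord0 j) => [j'|] ->; rewrite corner_mxE.
Qed.

Lemma corner_mxM c A c' A' : corner_mx c A *m corner_mx c' A' = corner_mx (c * c') (A *m A').
Proof.
apply: corner_mxP => [|i|i|i j]; rewrite mxE big_ord_recl !corner_mxE; rewrite ?mul0r ?mulr0 ?add0r.
- by rewrite big1 ?addr0 // => k _; rewrite corner_mxE mul0r.
- by rewrite big1 // => k _; rewrite corner_mxE mul0r.
- by rewrite big1 // => k _; rewrite !corner_mxE mulr0.
- by rewrite mxE; apply: eq_bigr => k _; rewrite !corner_mxE.
Qed.

Lemma corner_mxD c A c' A' : corner_mx c A + corner_mx c' A' = corner_mx (c + c') (A + A').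
Proof. by apply: corner_mxP => [|i|i|i j]; rewrite mxE !corner_mxE ?addr0 // mxE. Qed.

Lemma corner_mx1 : corner_mx 1 1%:M = 1%:M.
Proof.
apply/esym/corner_mxP => [|i|i|i j]; rewrite mxE ?eqxx ?lift0_neq //.
by rewrite mxE (inj_eq lift_inj).
Qed.

Lemma corner_mx_unit A : A \in unitmx -> corner_mx 1 A \in unitmx.
Proof.
move=> h; have e : corner_mx 1 A *m corner_mx 1 (invmx A) = 1%:M by rewrite corner_mxM mulr1 mulmxV // corner_mx1.
by have [] := mulmx1_unit e.
Qed.

Lemma corner_mx_exp c A k : corner_mx c A ^+ k = corner_mx (c ^+ k) (A ^+ k).
Proof.
elim: k => [|k IH]; first by rewrite !expr0 corner_mx1.
by rewrite !exprS IH -mulmxE corner_mxM.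
Qed.

Lemma corner_diag_mx c (v : 'rV[C]_d) :
  corner_mx c (diag_mx v) = diag_mx (\row_j if unlift ord0 j is Some i then v 0 i else c).
Proof.
by apply/esym/corner_mxP => [|i|i|i j]; rewrite !mxE ?eqxx ?unlift_none ?liftK ?mulr1n //.
Qed.

Lemma vapply_lft (Y : vf C d.+1) (Y' : vf C d) f : (forall i, Y (lift ord0 i) = lft (Y' i)) ->
  vapply Y (lft f) = lft (vapply Y' f).
Proof. by move=> h; apply: vapply_fpscomp => [|i]; [exact: based_xs | rewrite vapplyX h]. Qed.

Lemma lft_linvf S i : linvf (corner_mx 0 S) (lift ord0 i) = lft (linvf S i).
Proof.
rewrite !linvfE big_ord_recl corner_mxE fpsC0 mul0r add0r lft_sum; apply: eq_bigr => j _.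
rewrite corner_mxE /lft fpscompCM ?fpscompX //; exact: based_xs.
Qed.

Lemma linvf_corner0 S : linvf (corner_mx 0 S) ord0 = 0.
Proof.
rewrite linvfE big_ord_recl big1 => [|i _]; rewrite corner_mxE fpsC0 mul0r //; exact: addr0.
Qed.

Lemma cst_lft (f : fps C d) : cst (lft f) = cst f. Proof. exact/cst_fpscomp/based_xs. Qed.

Lemma lcoef_lft0 (f : fps C d) : lcoef (lft f) ord0 = 0.
Proof. by rewrite -cst_fderiv fderiv0_lft. Qed.

Lemma lcoef_lft (f : fps C d) i : lcoef (lft f) (lift ord0 i) = lcoef f i.
Proof. by rewrite -cst_fderiv fderiv_lift_lft cst_lft cst_fderiv. Qed.

Lemma lie_bracketE (V W : vf C d) k : lie_bracket V W k = vapply V (W k) - vapply W (V k).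
Proof. by []. Qed.
End CornerMatrices.

Theorem theorem5p8 (C : numClosedFieldType) (n m : nat)
  (hn : (0 < n)%N) (hm : (2 < m)%N)
  (g : 'I_(n.*2) -> fps C n.*2)
  (hg0 : forall i, cst (g i) = 0)
  (hsympl : \matrix_(j, k) cst (fpssub (fderiv j (g k)) (fderiv k (g j))) \in unitmx)
  (hdiffeo : \matrix_(i, j) lcoef (g i) j \in unitmx)
  (X : vf C (n.*2).+1)
  (hX0 : forall k, cst (X k) = 0)
  (hLie : lie_form1 X (alpha0 m g) = (fun _ => fps0 _)) :
  exists (phi : 'I_(n.*2) -> fps C (n.*2).+1),
    (forall i, cst (phi i) = 0) /\
    linpart (coordsys phi) \in unitmx /\
  exists (f : fps C n.*2),
    cst f = 0 /\ (exists i, lcoef f i != 0) /\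
  exists (g' : 'I_(n.*2) -> fps C n.*2) (bs : seq nat) (lam : nat -> C)
         (Q : nat -> fps C n.*2) (R : fps C n.*2),
    primitive_normal_form g' bs lam Q R /\
    alpha0 m g = pform (fpssub (fpsexp (theta n) m) (fpsmul (fpscomp f phi) (theta n))) g' phi /\
  (* Y is the vector field X written in the coordinates (theta, x') *)
  exists (Y : vf C (n.*2).+1),
    (forall k, vapply X (coordsys phi k) = fpscomp (Y k) (coordsys phi)) /\
    Y ord0 = fps0 _ /\
    vapply Y (fpscomp f (xcoords n)) = fps0 _ /\
    exists S : 'M[C]_((n.*2).+1),
      semisimple_part (linpart Y) S /\
      lie_bracket (linvf S) Y = (fun _ => fps0 _) /\
      vapply (linvf S) (fpscomp (Qtotal bs Q) (xcoords n)) = fps0 _ /\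
      vapply (linvf S) (fpscomp R (xcoords n)) = fps0 _.
Proof.
have d0 : (0 < n.*2)%N by rewrite double_gt0.
pose i1 := Ordinal d0.
have bxs := @based_xs C n.*2.
have x1E : fpsXn _ 1 = xs C i1 :> fps C (n.*2).+1 by [].
have alE k : alpha0 m g k = fderiv k (theta n ^+ m - xs C i1 * theta n) + pull (@xs C _) g k.
  by rewrite /alpha0 /pform fpsaddE fpssumE fpsexpE x1E.
have pull0 G : pull (@xs C n.*2) G ord0 = 0.
  by rewrite /pull big1 // => i _; rewrite fderiv_fpsX (negbTE (neq_lift _ _)) mulr0.
have pullS G j : pull (@xs C n.*2) G (lift ord0 j) = lft (G j).
  rewrite /pull (bigD1 j) //= fderiv_fpsX eqxx mulr1 big1 ?addr0 // => i ij.
  by rewrite fderiv_fpsX (inj_eq lift_inj) eq_sym (negbTE ij) mulr0.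
have symp : \matrix_(i, j) cst (fderiv i (g j) - fderiv j (g i)) \in unitmx by exact: hsympl.
have [X' [Xth XX Xi1 lieX]] : exists X' : vf C n.*2, [/\ X ord0 = 0, forall i, X (lift ord0 i) = lft (X' i),
    X' i1 = 0 & forall j, lie_form1 X' g j = 0].
  apply: (theta_elimination hm (G := g) (al := alpha0 m g)) => //.
  - by rewrite alE pull0 addr0.
  - by move=> j; rewrite alE pullS.
  - by move=> k; rewrite hLie.
have X'0 i : cst (X' i) = 0 by rewrite -cst_lft -XX.
have [phi1 [G1 [Y1 [M [B [Z [J [w [ch1 t1 nf]]]]]]]]] := normal_coordinates d0 hg0 X'0 symp lieX.
have [phi2 [G2 [Y2 [bs [lam [Q [R [S [ch2 t2 pnf [ssS brS] [QS RS]]]]]]]]]] := primitive_coordinates hn nf.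
pose Phi := fun i => fpscomp (phi2 i) phi1.
have chP : chart Phi by apply: chart_comp.
have bP := chart_based chP.
have tP : transf Phi g X' G2 Y2 by apply: (transf_comp _ _ t1 t2); apply: chart_based.
pose phi i := lft (Phi i).
have csE : coordsys phi = fun k => if unlift ord0 k is Some i then lft (Phi i) else theta n by [].
have cs0 : coordsys phi ord0 = theta n by rewrite csE unlift_none.
have csS i : coordsys phi (lift ord0 i) = lft (Phi i) by rewrite csE liftK.
have bphi : based phi by move=> i; rewrite /phi cst_lft.
have bcs : based (coordsys phi).
  by move=> k; case: (unliftP ord0 k) => [i|] ->; rewrite ?csS ?cs0 ?cst_lft //; apply: cst_fpsX.
have lftPhi F : fpscomp F phi = lft (fpscomp F Phi) by rewrite /lft fpscompA.
have lftcs F : fpscomp (lft F) (coordsys phi) = lft (fpscomp F Phi).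
  rewrite /lft fpscompA // [RHS]fpscompA //; congr fpscomp; apply: funext => i.
  by rewrite fpscompX // csS.
(* [f] is the old coordinate [x_1] in the new chart, so [X(f) = 0] is [X(x_1) = 0], and [df] is
   nonzero at the origin by the chain rule. *)
have [f fE] := chart_surj (fpsX C i1) chP.
have f0 : cst f = 0 by rewrite -(cst_fpscomp bP) fE cst_fpsX.
exists phi; split; first exact: bphi.
split.
  suff -> : linpart (coordsys phi) = corner_mx 1 (linpart Phi) by apply: corner_mx_unit; apply: linpart_chart.
  apply: corner_mxP => [|i|i|i j]; rewrite [LHS]mxE ?cs0 ?csS ?lcoef_lft0 ?lcoef_lft -?cst_fderiv ?fderiv_fpsX ?eqxx.
  - exact: (cstC n.*2.+1 1).
  - by rewrite lift0_neq.
  - by [].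
  - by rewrite mxE cst_fderiv.
exists f; split=> //; split.
  have : lcoef (fpsX C i1) i1 != 0 by rewrite -cst_fderiv fderiv_fpsX eqxx -(fpsC1E C) cstC oner_eq0.
  rewrite -fE -cst_fderiv fderiv_fpscomp // => h; apply/existsP; apply: contraNT h.
  rewrite negb_exists => /forallP h; rewrite cst_sum big1 // => k _.
  by rewrite cstM cst_fpscomp // cst_fderiv; have := h k; rewrite negbK => /eqP ->; rewrite mul0r.
exists G2, bs, lam, Q, R; split=> //; split.
  apply: funext => k; rewrite alE /pform fpsaddE fpssumE fpsexpE lftPhi fE.
  have -> : lft (fpsX C i1) = xs C i1 by exact: fpscompX.
  congr (_ + _); have [tg _] := tP.
  have -> : g = pull Phi G2 by apply: funext.
  by rewrite pull_pull.
pose Y (k : 'I_(n.*2).+1) := if unlift ord0 k is Some i then lft (Y2 i) else 0.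
have Y0 : Y ord0 = 0 by rewrite /Y unlift_none.
have YS i : Y (lift ord0 i) = lft (Y2 i) by rewrite /Y liftK.
exists Y; split.
  move=> k; case: (unliftP ord0 k) => [i|] ->.
    by rewrite csS YS lftcs (vapply_lft _ XX); have [_ ->] := tP.
  by rewrite cs0 vapplyX Xth Y0 -(fpsC0 C) fpscompC.
split; first exact: Y0.
split.
  rewrite (vapply_lft _ YS); have -> : vapply Y2 f = 0; last exact: lft0.
  apply: (chart_inj chP); have [_ hY] := tP.
  by rewrite -(vapply_fpscomp _ bP hY) fE vapplyX Xi1 -(fpsC0 C) fpscompC.
have [[P [v [Pu PS]]] SN [k Nk]] := ssS.
have LY : linpart Y = corner_mx 0 (linpart Y2).
  by apply: corner_mxP => [|i|i|i j]; rewrite mxE ?Y0 ?YS ?lcoef_lft0 ?lcoef_lft // mxE.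
have SL i : linvf (corner_mx 0 S) (lift ord0 i) = lft (linvf S i) by exact: lft_linvf.
exists (corner_mx 0 S); split.
  exists (corner_mx 0 (linpart Y2 - S)); split.
  - by rewrite LY corner_mxD addr0 addrC subrK.
  - by rewrite !corner_mxM SN.
  - exists (corner_mx 1 P); first exact: corner_mx_unit.
    apply/diagonalizable_forPex; eexists; apply/(simmxP (corner_mx_unit Pu)).
    by rewrite corner_mxM PS mulr0 -(mul0r 1) -corner_mxM corner_diag_mx.
  (* The exponent [k.+1] also kills the corner entry when [k = 0], since [0 ^+ 0 = 1]. *)
  - by exists k.+1; rewrite corner_mx_exp exprS mul0r exprS Nk mulr0; apply/esym/corner_mxP => *; rewrite mxE // mxE.
split; last first.
  by split; rewrite (vapply_lft _ SL); [move: QS | move: RS]; rewrite /linop => ->; exact: lft0.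
apply: funext => j; rewrite lie_bracketE; case: (unliftP ord0 j) => [i|] ->.
  by rewrite SL YS (vapply_lft _ SL) (vapply_lft _ YS) -/(linop S _) brS subrr.
by rewrite Y0 linvf_corner0 !vapply0 subrr.
Qed.
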